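(* Let $\hbar>0$, $m\ge 1$, let $\mathbf a\in\mathbb C^m$ satisfy $\langle\mathbf a,\mathbf a\rangle=1$, and let $\alpha,\beta,\gamma\in\mathbb C$ satisfy $\gamma^2-\alpha\beta=1$. Let $*$ denote the standard-ordering product $*_K$, and let $B_*(\alpha,\beta,\gamma)$ be the rank-one quadratic form attached to $\mathbf a$ (both defined in the context). Then the star exponential, expressed in the standard ordering, $$\exp_*\Big(\frac{\pi}{2\hbar}B_*(\alpha,\beta,\gamma)\Big)=\sqrt{-1}\;\exp\Big(\frac{2i}{\hbar}\langle\mathbf a,\mathbf u\rangle\langle\mathbf a,\mathbf v\rangle\Big),$$ where $\sqrt{-1}\in\{i,-i\}$ is understood with sign ambiguity, and this expression is independent of the choice of $(\alpha,\beta,\gamma)$. Precisely: let $F(t)=F(t,\mathbf z)$ be the unique holomorphic solution, for $t\in\mathbb C$ near $0$, of $\partial_tF(t)=B_*(\alpha,\beta,\gamma)*F(t)$, $F(0)=1$. Then for every path in $\mathbb C$ from $t=0$ to $t=\frac{\pi}{2\hbar}$ avoiding the zeros of $\cos 2\hbar t-i\gamma\sin 2\hbar t$, $F$ continues analytically along the path, and its value at the endpoint is $c\,\exp\big(\frac{2i}{\hbar}\langle\mathbf a,\mathbf u\rangle\langle\mathbf a,\mathbf v\rangle\big)$ with $c\in\{i,-i\}$.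
   Context: Notation: $\mathbf z=(\mathbf u,\mathbf v)=(u_1,\dots,u_m,v_1,\dots,v_m)=(z_1,\dots,z_{2m})$ are commuting coordinates on $\mathbb C^{2m}$, and $\langle\mathbf x,\mathbf y\rangle=\sum_{i=1}^m x_iy_i$ (bilinear, no conjugation). Let $J=\begin{pmatrix}0&-I_m\\ I_m&0\end{pmatrix}$ and $K=\begin{pmatrix}0&I_m\\ I_m&0\end{pmatrix}$. The standard-ordering product is $$f*_Kg=f\exp\Big\{\frac{i\hbar}{2}\sum_{i,j=1}^{2m}\overleftarrow{\partial_{z_i}}(K^{ij}+J^{ij})\overrightarrow{\partial_{z_j}}\Big\}g,$$ i.e. $f*_Kg=\sum_{n\ge0}\frac1{n!}\big(\frac{i\hbar}{2}\big)^n\sum (K+J)^{i_1j_1}\cdots(K+J)^{i_nj_n}(\partial_{z_{i_1}}\cdots\partial_{z_{i_n}}f)(\partial_{z_{j_1}}\cdots\partial_{z_{j_n}}g)$. It is defined whenever $f$ is a polynomial and $g$ is a holomorphic function (the sum is then finite). The rank-one quadratic form is $$B_*(\alpha,\beta,\gamma)=\alpha\langle\mathbf a,\mathbf u\rangle*\langle\mathbf a,\mathbf u\rangle+\beta\langle\mathbf a,\mathbf v\rangle*\langle\mathbf a,\mathbf v\rangle+\gamma\big(\langle\mathbf a,\mathbf u\rangle*\langle\mathbf a,\mathbf v\rangle+\langle\mathbf a,\mathbf v\rangle*\langle\mathbf a,\mathbf u\rangle\big),$$ with $*=*_K$. The star exponential $\exp_*(tB_* )$ in the standard ordering means the solution $F(t)$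 of $\partial_tF=B_* *F$, $F(0)=1$, and $\exp_*(\frac{\pi}{2\hbar}B_* )$ is its value at $t=\frac{\pi}{2\hbar}$. The products in the exponent of the answer are ordinary commutative products of functions on $\mathbb C^{2m}$. *)

(* Defs.v *)
From HB Require Import structures.
From mathcomp Require Import all_boot all_order all_algebra.
From mathcomp Require Import complex.
From mathcomp Require Import all_classical all_reals all_analysis.

Set Implicit Arguments.
Unset Strict Implicit.
Unset Printing Implicit Defensive.

Import Order.TTheory GRing.Theory Num.Theory.
Import numFieldNormedType.Exports.

Local Open Scope classical_set_scope.
Local Open Scope complex_scope.
Local Open Scope ring_scope.

(* Equips R[i] with the norm topology it has as a normed space over itself, so
   that derivatives over the scalar field R[i] ('D_v, derive1, differentiable)
   are complex derivatives. *)
HB.instance Definition _ (R : realType) := NormedModule.copy R[i] R[i]^o.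

Section ComplexExponential.
Variable R : realType.

Definition cexp (z : R[i]) : R[i] :=
  (expR (complex.Re z))%:C * (cos (complex.Im z) +i* sin (complex.Im z)).

Definition ccos (z : R[i]) : R[i] := (cexp ('i * z) + cexp (- ('i * z))) / 2.

Definition csin (z : R[i]) : R[i] :=
  (cexp ('i * z) - cexp (- ('i * z))) / (2 * 'i).

End ComplexExponential.

Section StarProduct.
Variable R : realType.

Definition pderiv n (i : 'I_n) (f : 'rV[R[i]]_n -> R[i]) :
    'rV[R[i]]_n -> R[i] :=
  fun z => 'D_(delta_mx 0 i) f z.

Definition pderivs n (s : seq 'I_n) (f : 'rV[R[i]]_n -> R[i]) :
    'rV[R[i]]_n -> R[i] :=
  foldr (@pderiv n) f s.

Definition star_term (hbar : R) n (L : 'M[R[i]]_n)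
    (f g : 'rV[R[i]]_n -> R[i]) (z : 'rV[R[i]]_n) (k : nat) : R[i] :=
  (k`!%:R)^-1 * ('i * hbar%:C / 2) ^+ k *
  \sum_(p : k.-tuple 'I_n) \sum_(q : k.-tuple 'I_n)
    (\prod_(l < k) L (tnth p l) (tnth q l)) * pderivs p f z * pderivs q g z.

(* If f is a polynomial function, the terms vanish for k > deg f, so that the
   limit is a finite sum. *)
Definition star_prod (hbar : R) n (L : 'M[R[i]]_n)
    (f g : 'rV[R[i]]_n -> R[i]) : 'rV[R[i]]_n -> R[i] :=
  fun z => limn (series (star_term hbar L f g z)).

Definition Jmx m : 'M[R[i]]_(m + m) := block_mx 0 (- 1%:M) 1%:M 0.

Definition Kmx m : 'M[R[i]]_(m + m) := block_mx 0 1%:M 1%:M 0.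

Definition starK (hbar : R) m (f g : 'rV[R[i]]_(m + m) -> R[i]) :
    'rV[R[i]]_(m + m) -> R[i] :=
  star_prod hbar (Kmx m + Jmx m) f g.

(* Bilinear: there is no conjugation. *)
Definition pairing m (x y : 'rV[R[i]]_m) : R[i] := \sum_(k < m) x 0 k * y 0 k.

(* z = (u, v) with u = lsubmx z and v = rsubmx z. *)
Definition lin_u m (a : 'rV[R[i]]_m) : 'rV[R[i]]_(m + m) -> R[i] :=
  fun z => pairing a (lsubmx z).

Definition lin_v m (a : 'rV[R[i]]_m) : 'rV[R[i]]_(m + m) -> R[i] :=
  fun z => pairing a (rsubmx z).

Definition Bform (hbar : R) m (a : 'rV[R[i]]_m) (alpha beta gamma : R[i]) :
    'rV[R[i]]_(m + m) -> R[i] :=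
  fun z =>
    alpha * starK hbar (lin_u a) (lin_u a) z
    + beta * starK hbar (lin_v a) (lin_v a) z
    + gamma * (starK hbar (lin_u a) (lin_v a) z
               + starK hbar (lin_v a) (lin_u a) z).

End StarProduct.

Section StarExponential.
Variables (R : realType) (n : nat).
Implicit Types F : R[i] * 'rV[R[i]]_n -> R[i].

(* Joint holomorphy in (t, z) for t in a neighbourhood of t0 and all z in
   C^n; the neighbourhood of t0 does not depend on z. *)
Definition holomorphic_near (t0 : R[i]) F : Prop :=
  \forall t \near t0, forall z : 'rV[R[i]]_n,
    differentiable F (t, z).

Definition germ_eq (t0 : R[i]) F1 F2 : Prop :=
  \forall t \near t0, forall z : 'rV[R[i]]_n, F1 (t, z) = F2 (t, z).

(* Germ family definition of analytic continuation along the path p, whose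
   parameter ranges over [0, 1]: G s is a function element at p s, and for s'
   close to s the elements G s' and G s have the same germ at p s'. The
   continuity of p is a separate hypothesis. *)
Definition analytic_continuation (p : R -> R[i]) F
    (G : R -> R[i] * 'rV[R[i]]_n -> R[i]) : Prop :=
  germ_eq (p 0) (G 0) F /\
  forall s : R, s \in `[0, 1] ->
    holomorphic_near (p s) (G s) /\
    \forall s' \near within `[0, 1]%classic (nbhs s), germ_eq (p s') (G s') (G s).

End StarExponential.

Definition star_exp_solution (R : realType) (hbar : R) m
    (B : 'rV[R[i]]_(m + m) -> R[i])
    (F : R[i] * 'rV[R[i]]_(m + m) -> R[i]) : Prop :=
  [/\ holomorphic_near 0 F,
      (\forall t \near (0 : R[i]), forall z : 'rV[R[i]]_(m + m),
         derive1 (fun s : R[i] => F (s, z)) t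
         = starK hbar B (fun w => F (t, w)) z) &
      forall z : 'rV[R[i]]_(m + m), F (0, z) = 1].

(* Main.v *)
(* With x = <a,u>, y = <a,v> and D = sum_k a_k d/du_k, the equation reads
   F_t = (B + i hbar (2 beta y + 2 gamma x) D + (i hbar)^2 beta D^2) F.
   A Gaussian ansatz F = phi exp(P x^2 + Q x y + S y^2) turns it into a Riccati
   system, solved by means of Delta = cos(2 hbar t) - i gamma sin(2 hbar t):
   phi^2 = 1/Delta, P = alpha sin(2 hbar t)/(2 hbar Delta),
   Q = (1/Delta - 1)/(i hbar), S = beta sin(2 hbar t)/(2 hbar Delta).
   A path avoiding the zeros of Delta lifts to a continuous square root of
   1/Delta, whence the continuation; at t = pi/(2 hbar) one has Delta = -1.

   Uniqueness: the equation has order two in z, so Gronwall arguments fail, but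
   the difference W of two solutions satisfies W = O(t^n) for all n, since Cauchy
   estimates bound the right-hand side of the equation by W on a larger ball.
   A function holomorphic in t and flat at 0 vanishes.  Continuations are unique
   by the identity theorem, another instance of this vanishing.

   Complex differentiability is only pointwise, so the analysis starts with
   Goursat's bisection argument.  Cauchy's formula yields |f w| <= C max |f| on
   the boundary of a rectangle, and applying this to powers of f gives C = 1.
   As finitely many points of mere continuity are allowed, the maximum principle
   applies to (f z - f c)/(z - c) and to f z/(z - c)^n, which gives the Cauchy
   estimates and the vanishing of flat functions. *)

(* What shapes the proof is that [differentiable] supplies first derivatives only, whereas
   multiplication by [B] takes second ones, and that derivatives are total operators with arbitrary
   values where the limit fails to exist. So even the additivity of g |-> B * g, needed for the
   difference of two solutions, waits until second partial derivatives are known to exist; this is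
   why a quadratic Taylor bound is proved along with the bound for the first derivative. Contours
   are rectangles because their integrals reduce to real integrals over segments. The integral of 1
   / (z - w) is only shown to be nonzero: its value enters a constant that disappears on taking
   powers. The factor phi of the Gaussian has no global sign. The explicit solution is therefore a
   family indexed by a number psi, an approximate value of phi that selects the root; a path in t is
   lifted to a path of such psi, whose end value is the constant i or -i. *)
Require Import Defs.
From HB Require Import structures.
From mathcomp Require Import all_boot all_order all_algebra.
From mathcomp Require Import complex.
From mathcomp Require Import all_classical all_reals all_analysis.
From mathcomp Require Import ring lra.

Set Implicit Arguments.
Unset Strict Implicit.
Unset Printing Implicit Defensive.

Import Order.TTheory GRing.Theory Num.Theory.
Import numFieldNormedType.Exports.

Local Open Scope classical_set_scope.
Local Open Scope complex_scope.
Local Open Scope ring_scope.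

(** * Modulus and complex derivative *)

Section ComplexModulus.
Variable R : realType.
Implicit Types (z w : R[i]) (e : R).

(* The norm of R[i] takes its values in R[i] itself. *)
Definition cabs z : R := Num.sqrt (complex.Re z ^+ 2 + complex.Im z ^+ 2).

Lemma cabsE z : `|z| = (cabs z)%:C.
Proof. by rewrite normc_def. Qed.

Lemma cabs_ge0 z : 0 <= cabs z. Proof. exact: sqrtr_ge0. Qed.

Lemma cabs0 : cabs 0 = 0. Proof. by rewrite /cabs /= expr0n addr0 sqrtr0. Qed.

Lemma cabs_eq0 z : (cabs z == 0) = (z == 0).
Proof. by rewrite -(normr_eq0 z) cabsE -(inj_eq (@complexI R)). Qed.

Lemma cabs_gt0 z : (0 < cabs z) = (z != 0).
Proof. by rewrite lt_neqAle cabs_ge0 andbT eq_sym cabs_eq0. Qed.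

Lemma cabsM z w : cabs (z * w) = cabs z * cabs w.
Proof. by apply: complexI; rewrite rmorphM /= -!cabsE normrM. Qed.

Lemma cabsD z w : cabs (z + w) <= cabs z + cabs w.
Proof. by rewrite -lecR rmorphD /= -!cabsE ler_normD. Qed.

Lemma cabsN z : cabs (- z) = cabs z.
Proof. by apply: complexI; rewrite -!cabsE normrN. Qed.

Lemma cabsB z w : cabs (z - w) = cabs (w - z).
Proof. by rewrite -cabsN opprB. Qed.

Lemma cabsV z : cabs z^-1 = (cabs z)^-1.
Proof. by apply: complexI; rewrite -cabsE normfV cabsE fmorphV. Qed.

Lemma cabsX z n : cabs (z ^+ n) = cabs z ^+ n.
Proof. by apply: complexI; rewrite -cabsE normrX cabsE rmorphXn. Qed.

Lemma cabs_real (x : R) : cabs x%:C = `|x|.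
Proof. by rewrite /cabs /= expr0n addr0 sqrtr_sqr. Qed.

Lemma Re_le_cabs z : `|complex.Re z| <= cabs z.
Proof. by rewrite -lecR -cabsE normc_ge_Re. Qed.

Lemma Im_le_cabs z : `|complex.Im z| <= cabs z.
Proof. by rewrite -sqrtr_sqr ler_wsqrtr // lerDr sqr_ge0. Qed.

Lemma cabs_le_ReIm z : cabs z <= `|complex.Re z| + `|complex.Im z|.
Proof.
rewrite -[X in _ <= X]ger0_norm ?addr_ge0 // -sqrtr_sqr ler_wsqrtr //.
rewrite sqrrD !real_normK ?num_real //.
have : 0 <= `|complex.Re z| * `|complex.Im z| by rewrite mulr_ge0.
lra.
Qed.

Lemma cabsD3 z w u : cabs (z - u) <= cabs (z - w) + cabs (w - u).
Proof. by have := cabsD (z - w) (w - u); rewrite addrA subrK. Qed.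

Lemma cabs_lt z e : (`|z| < e%:C) = (cabs z < e).
Proof. by rewrite cabsE ltcR. Qed.

Lemma real_gt0P (e : R[i]) : 0 < e -> exists2 r : R, 0 < r & e = r%:C.
Proof.
case: e => a b; rewrite ltcE /= => /andP[/eqP -> a0].
by exists a.
Qed.

Lemma nbhs_cabsP (x : R[i]) (A : set R[i]) :
  nbhs x A <-> exists2 e : R, 0 < e & forall y, cabs (y - x) < e -> A y.
Proof.
split.
  move=> /nbhs_ballP [e /= /real_gt0P [r r0 ->] xA]; exists r => // y xy.
  by apply: xA; rewrite -ball_normE /= distrC cabs_lt.
move=> [e e0 xA]; apply/nbhs_ballP; exists e%:C => /=; first by rewrite ltcR.
by move=> y; rewrite -ball_normE /= distrC cabs_lt => /xA.
Qed.

(** The difference quotient is multiplied out, so h = 0 needs no exception, and all bounds live in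
    R, where the order is total. *)
Definition cderiv (f : R[i] -> R[i]) (x d : R[i]) :=
  forall e, 0 < e -> exists2 r : R, 0 < r &
    forall h, cabs h < r -> cabs (f (x + h) - f x - h * d) <= e * cabs h.

Lemma is_derive_cderiv (f : R[i] -> R[i]) (x d : R[i]) :
  is_derive x (1 : R[i]) f d <-> cderiv f x d.
Proof.
split.
  move=> [/derivable_nbhs + <-] e e0.
  move=> /eqaddoP /(_ e%:C); rewrite ltcR => /(_ e0) /nbhs_cabsP [r r0 H].
  exists r => // h hr.
  have : `|f (h * 1 + x) - (f x + h * 'D_1 f x)| <= e%:C * `|h| :> R[i].
    by apply: H; rewrite subr0.
  by rewrite mulr1 (addrC h) opprD addrA !cabsE -rmorphM lecR.
move=> H.
have D : (fun h : R[i] => h^-1 *: ((f \o shift x) (h *: (1 : R[i])) - f x)) @ 0^' --> d.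
  move=> A /nbhs_cabsP [e e0 eA].
  have [r r0 Hr] := H _ (divr_gt0 e0 (ltr0Sn _ 1)).
  rewrite /= nbhs_simpl; apply/nbhs_cabsP; exists r => // h /=; rewrite subr0 => hr h0.
  apply: eA; rewrite /shift /= -[h *: 1]/(h * 1) mulr1 (addrC h x).
  rewrite -[_ *: _]/(h^-1 * _).
  rewrite -(@ltr_pM2r _ (cabs h)) ?cabs_gt0 // -cabsM mulrBl mulrAC mulVf //.
  rewrite mul1r (mulrC d); apply: le_lt_trans (Hr _ hr) _.
  by rewrite ltr_pM2r ?cabs_gt0 // gtr_pMr // invf_lt1 // ltr1n.
by split; [apply: (cvgP d)|exact: cvg_lim].
Qed.

Lemma derivable_cderiv (f : R[i] -> R[i]) (x : R[i]) :
  derivable f x 1 <-> exists d, cderiv f x d.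
Proof.
split=> [/derivableP/is_derive_cderiv|[d /is_derive_cderiv []//]].
by exists ('D_1 f x).
Qed.

Definition ccont (f : R[i] -> R[i]) (x : R[i]) :=
  forall e, 0 < e -> exists2 r : R, 0 < r &
    forall y, cabs (y - x) < r -> cabs (f y - f x) < e.

Implicit Types (f g : R[i] -> R[i]) (x d : R[i]).

Lemma cderiv_is_derive f x d : cderiv f x d -> is_derive x (1 : R[i]) f d.
Proof. by move=> /is_derive_cderiv. Qed.

Lemma cderiv_eq f x d d' : cderiv f x d -> d = d' -> cderiv f x d'.
Proof. by move=> ? <-. Qed.

Lemma cderiv_near f g x d : (\forall y \near x, f y = g y) ->
  cderiv f x d -> cderiv g x d.
Proof.
move=> fg /cderiv_is_derive fd; apply/is_derive_cderiv.
exact: near_eq_is_derive fd.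
Qed.

Lemma cderiv_cst c x : cderiv (fun=> c) x 0.
Proof. by apply/is_derive_cderiv; exact: is_derive_cst. Qed.

Lemma cderiv_id x : cderiv id x 1.
Proof. by apply/is_derive_cderiv; exact: is_derive_id. Qed.

Lemma cderivD f g x d d' : cderiv f x d -> cderiv g x d' ->
  cderiv (fun y => f y + g y) x (d + d').
Proof.
move=> /cderiv_is_derive fd /cderiv_is_derive gd.
by apply/is_derive_cderiv; exact: is_deriveD.
Qed.

Lemma cderivN f x d : cderiv f x d -> cderiv (fun y => - f y) x (- d).
Proof.
by move=> /cderiv_is_derive fd; apply/is_derive_cderiv; exact: is_deriveN.
Qed.

Lemma cderivB f g x d d' : cderiv f x d -> cderiv g x d' ->
  cderiv (fun y => f y - g y) x (d - d').
Proof. by move=> fd gd; apply: cderivD => //; exact: cderivN. Qed.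

Lemma cderivM f g x d d' : cderiv f x d -> cderiv g x d' ->
  cderiv (fun y => f y * g y) x (f x * d' + d * g x).
Proof.
move=> /cderiv_is_derive fd /cderiv_is_derive gd; apply/is_derive_cderiv.
by apply: is_derive_eq; rewrite /GRing.scale /= [d * _]mulrC.
Qed.

Lemma cderivMl c f x d : cderiv f x d -> cderiv (fun y => c * f y) x (c * d).
Proof.
by move=> fd; apply: cderiv_eq (cderivM (cderiv_cst c x) fd) _; rewrite mul0r addr0.
Qed.

Lemma cderivV f x d : f x != 0 -> cderiv f x d ->
  cderiv (fun y => (f y)^-1) x (- d / f x ^+ 2).
Proof.
move=> fx0 /cderiv_is_derive fd; apply/is_derive_cderiv.
have [fdr fv] := fd; split; first exact: derivableV.
by rewrite deriveV // fv /GRing.scale /= mulNr mulrC mulNr.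
Qed.

Lemma cderivX f x d n : cderiv f x d ->
  cderiv (fun y => f y ^+ n) x (n%:R * f x ^+ n.-1 * d).
Proof.
elim: n => [|n IH] fd.
  have -> : (fun y => f y ^+ 0) = fun=> 1 by apply/funext => y; rewrite expr0.
  by rewrite !mul0r; exact: cderiv_cst.
have -> : (fun y => f y ^+ n.+1) = (fun y => f y * f y ^+ n).
  by apply/funext => y; rewrite exprS.
apply: cderiv_eq (cderivM fd (IH fd)) _.
rewrite /= -natr1; case: n {IH} => [|n]; first by rewrite !expr0; ring.
by rewrite -[n.+1.-1]/n exprS; ring.
Qed.

Lemma cderiv_ccont f x d : cderiv f x d -> ccont f x.
Proof.
move=> fd e e0; have [r r0 H] := fd _ ltr01.
pose r' := Num.min r (e / (2 + cabs d)).
have d0 := cabs_ge0 d.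
have d20 : 0 < 2 + cabs d by rewrite ltr_pwDl.
exists r' => [|y]; first by rewrite lt_min r0 divr_gt0.
rewrite lt_min => /andP[/H + hy].
rewrite subrKC mul1r => {}H.
have -> : f y - f x = (f y - f x - (y - x) * d) + (y - x) * d by ring.
apply: le_lt_trans (cabsD _ _) _; rewrite cabsM.
move: hy; rewrite ltr_pdivlMr // => hy.
have := cabs_ge0 (y - x); nra.
Qed.

Lemma cderiv_comp g f x a b : cderiv f x a -> cderiv g (f x) b ->
  cderiv (g \o f) x (b * a).
Proof.
move=> fa gb e e0.
have a0 := cabs_ge0 a; have b0 := cabs_ge0 b.
pose e1 := e / (2 * (1 + cabs b)); pose e2 := e / (2 * (1 + cabs a)).
have e10 : 0 < e1 by rewrite divr_gt0 // mulr_gt0 // ltr_pwDl.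
have e20 : 0 < e2 by rewrite divr_gt0 // mulr_gt0 // ltr_pwDl.
have [r1 r10 H1] := fa _ e10; have [r2 r20 H2] := fa _ ltr01.
have [r3 r30 H3] := gb _ e20.
have [r4 r40 H4] := cderiv_ccont fa r30.
exists (Num.min r1 (Num.min r2 r4)); first by rewrite !lt_min r10 r20.
move=> h; rewrite !lt_min => /and3P[/H1 {}H1 /H2 {}H2 h4].
have {H4} : cabs (f (x + h) - f x) < r3 by apply: H4; rewrite addrC addKr.
move=> /H3; rewrite subrKC => {}H3 /=.
set k := f (x + h) - f x in H1 H2 H3 *.
have kh : cabs k <= (1 + cabs a) * cabs h.
  have -> : k = (k - h * a) + h * a by ring.
  by apply: le_trans (cabsD _ _) _; rewrite cabsM; lra.
(* The error of g at the increment [k], plus b times the error of f. [e2] and [e1] give each of them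
   half of e; the 1 added in their denominators avoids dividing by zero. *)
have -> : g (f (x + h)) - g (f x) - h * (b * a) =
   (g (f (x + h)) - g (f x) - k * b) + b * (k - h * a) by ring.
apply: le_trans (cabsD _ _) _; rewrite cabsM.
have E1 : e2 * (1 + cabs a) = e / 2 by rewrite /e2; field; lra.
have E2 : (1 + cabs b) * e1 = e / 2 by rewrite /e1; field; lra.
have T1 : e2 * cabs k <= e / 2 * cabs h.
  by rewrite -E1 -mulrA ler_pM2l.
have T2 : cabs b * cabs (k - h * a) <= e / 2 * cabs h.
  rewrite -E2 -mulrA; apply: ler_pM => //; rewrite ?cabs_ge0 //.
  by rewrite lerDr.
lra.
Qed.

End ComplexModulus.

(** * Integrals along segments and rectangles *)

Section CurveIntegral.
Variable R : realType.
Implicit Types (f g : R -> R[i]) (a b : R).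
Local Notation mu := (@lebesgue_measure R).

Definition segcont f a b := forall x, a <= x <= b -> forall e, 0 < e ->
  exists2 d : R, 0 < d &
    forall y, a <= y <= b -> `|y - x| < d -> cabs (f y - f x) < e.

Lemma segcontP f a b : {within `[a, b], continuous f} <-> segcont f a b.
Proof.
split.
  move=> /subspace_continuousP H x xab e e0.
  have /(H x) : x \in `[a, b] by rewrite in_itv.
  have N : nbhs (f x) [set y | cabs (y - f x) < e] by apply/nbhs_cabsP; exists e.
  move=> /(_ _ N) /nbhs_ballP [d /= d0 Hd]; exists d => // y yab xy.
  by apply: Hd; rewrite /= ?in_itv //= /ball /= distrC.
move=> H; apply/subspace_continuousP => x /=; rewrite in_itv /= => xab.
move=> A /nbhs_cabsP [e e0 eA]; have [d d0 Hd] := H _ xab _ e0.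
apply/nbhs_ballP; exists d => //= y; rewrite /ball /= distrC => xy.
by rewrite in_itv /= => yab; apply: eA; exact: Hd.
Qed.

(** [k] stands for the real part, the imaginary part or the modulus. All three are 1-Lipschitz, so
    facts on real integrals are proved once for them. *)
Lemma segcont_real (k : R[i] -> R) f a b :
  (forall z w, `|k z - k w| <= cabs (z - w)) ->
  segcont f a b -> {within `[a, b], continuous (fun x => k (f x))}.
Proof.
move=> kL H; apply/subspace_continuousP => x /=; rewrite in_itv /= => xab.
apply/cvgrPdist_lt => e e0; have [d d0 Hd] := H _ xab _ e0.
apply/nbhs_ballP; exists d => //= y; rewrite /ball /= => xy.
rewrite in_itv /= => yab; apply: le_lt_trans (kL _ _) _.
by rewrite cabsB; apply: Hd => //; rewrite distrC.
Qed.

Lemma Re_lip (z w : R[i]) : `|complex.Re z - complex.Re w| <= cabs (z - w).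
Proof. by rewrite -raddfB; exact: Re_le_cabs. Qed.

Lemma Im_lip (z w : R[i]) : `|complex.Im z - complex.Im w| <= cabs (z - w).
Proof. by rewrite -raddfB; exact: Im_le_cabs. Qed.

Lemma cabs_lip (z w : R[i]) : `|cabs z - cabs w| <= cabs (z - w).
Proof.
have := cabsD (z - w) w; have := cabsD (w - z) z; rewrite !subrK (cabsB w).
by rewrite ler_norml; lra.
Qed.

Lemma segcont_integrable (k : R[i] -> R) f a b :
  (forall z w, `|k z - k w| <= cabs (z - w)) ->
  segcont f a b -> mu.-integrable `[a, b] (EFin \o (fun x => k (f x))).
Proof.
move=> kL fc; apply: continuous_compact_integrable; first exact: segment_compact.
exact: segcont_real.
Qed.

Lemma segcontW f a b c d : a <= c -> d <= b -> segcont f a b -> segcont f c d.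
Proof.
move=> ac db H x /andP[cx xd] e e0.
have [|r r0 Hr] := H x _ e e0; first by apply/andP; split; lra.
by exists r => // y /andP[cy yd]; apply: Hr; apply/andP; split; lra.
Qed.

Lemma segcont_bounded f a b : a <= b -> segcont f a b ->
  exists2 M : R, 0 < M & forall x, a <= x <= b -> cabs (f x) <= M.
Proof.
move=> ab fc; have [c cab H] := EVT_max ab (segcont_real cabs_lip fc).
exists (1 + cabs (f c)) => [|x xab]; first by rewrite ltr_pwDl // cabs_ge0.
have : cabs (f x) <= cabs (f c) by apply: H; rewrite in_itv.
lra.
Qed.

(** For b < a the interval is empty and the integral is 0; orientation is carried by explicit signs,
    as in [oint]. *)
Definition cint f a b : R[i] :=
  (\int[mu]_(x in `[a, b]) complex.Re (f x)) +i*
  (\int[mu]_(x in `[a, b]) complex.Im (f x)).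

Lemma eq_cint f g a b : (forall x, a <= x <= b -> f x = g x) ->
  cint f a b = cint g a b.
Proof.
move=> fg; congr Complex; apply: eq_Rintegral => x; rewrite inE /= in_itv /= => /fg -> //.
Qed.

Lemma Rint_cat (k : R[i] -> R) f a b c :
  (forall z w, `|k z - k w| <= cabs (z - w)) -> a <= c <= b -> segcont f a b ->
  \int[mu]_(x in `[a, b]) k (f x) =
  \int[mu]_(x in `[a, c]) k (f x) + \int[mu]_(x in `[c, b]) k (f x).
Proof.
move=> kL /andP[ac cb] fc; have fi := segcont_integrable kL fc.
have := @Rintegral_itvB _ (fun x => k (f x)) (BLeft a) (BRight b) c fi.
rewrite !bnd_simp => /(_ ac cb) /eqP; rewrite subr_eq => /eqP ->.
rewrite addrC Rintegral_itv_obnd_cbnd //.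
apply: integrableS fi => //.
by apply: subset_itv; rewrite bnd_simp.
Qed.

Lemma cint_cat f a b c : a <= c <= b -> segcont f a b ->
  cint f a b = cint f a c + cint f c b.
Proof.
move=> acb fc; rewrite /cint (Rint_cat Re_lip acb fc) (Rint_cat Im_lip acb fc) //.
Qed.

Lemma cintD f g a b : segcont f a b -> segcont g a b ->
  cint (fun x => f x + g x) a b = cint f a b + cint g a b.
Proof.
move=> fc gc; rewrite /cint.
have -> : (fun x => complex.Re (f x + g x)) = (fun x => complex.Re (f x) + complex.Re (g x)).
  by apply/funext => x; rewrite raddfD.
have -> : (fun x => complex.Im (f x + g x)) = (fun x => complex.Im (f x) + complex.Im (g x)).
  by apply/funext => x; rewrite raddfD.
by rewrite !RintegralD //; apply: segcont_integrable => //; exact/Re_lip || exact/Im_lip.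
Qed.

Lemma cint_cst (c : R[i]) a b : a <= b -> cint (fun=> c) a b = c * (b - a)%:C.
Proof.
move=> ab; rewrite /cint !Rintegral_cst //= lebesgue_measure_itv /= lte_fin.
have -> : fine (if (a < b)%R then (b%:E - a%:E)%E else 0%E) = b - a.
  case: ifP => //= /negbT; rewrite -leNgt => ba; lra.
by case: c => x y; apply/eqP; rewrite eq_complex /=; apply/andP; split; apply/eqP; ring.
Qed.

Lemma cintZ (c : R[i]) f a b : segcont f a b ->
  cint (fun x => c * f x) a b = c * cint f a b.
Proof.
move=> fc; have iR := segcont_integrable Re_lip fc; have iI := segcont_integrable Im_lip fc.
case: c => u v; rewrite /cint.
have mab : measurable `[a, b] by [].
have Z w h : mu.-integrable `[a, b] (EFin \o h) ->
  mu.-integrable `[a, b] (EFin \o (fun x => w * h x)).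
  by move=> ih; exact: (integrableZl _ w ih).
have -> : (fun x => complex.Re ((u +i* v) * f x)) =
  (fun x => u * complex.Re (f x) - v * complex.Im (f x)).
  by apply/funext => x; case: (f x).
have -> : (fun x => complex.Im ((u +i* v) * f x)) =
  (fun x => u * complex.Im (f x) + v * complex.Re (f x)).
  by apply/funext => x; case: (f x).
rewrite RintegralB // ?RintegralD // ?RintegralZl //; exact: Z.
Qed.

Lemma cint_ge (k : R[i] -> R) f a b m :
  (forall z w, `|k z - k w| <= cabs (z - w)) -> a <= b -> segcont f a b ->
  (forall x, a <= x <= b -> m <= k (f x)) ->
  m * (b - a) <= \int[mu]_(x in `[a, b]) k (f x).
Proof.
move=> kL ab fc mf.
have := @cint_cst m%:C _ _ ab; rewrite -rmorphM => /(congr1 (@complex.Re _)) /= <-.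
apply: le_Rintegral => //.
- by apply: (@segcont_integrable (@complex.Re _) (fun=> m%:C)) => [|x _ e e0];
    [exact: Re_lip|exists 1 => // y _ _; rewrite subrr cabs0].
- exact: segcont_integrable.
Qed.

Lemma Rint_bound (k : R[i] -> R) f a b M :
  (forall z w, `|k z - k w| <= cabs (z - w)) -> k 0 = 0 -> a <= b -> segcont f a b ->
  (forall x, a <= x <= b -> cabs (f x) <= M) ->
  `|\int[mu]_(x in `[a, b]) k (f x)| <= M * (b - a).
Proof.
move=> kL k0 ab fc fM; apply: le_trans (le_normr_Rintegral _ _) _ => //.
  exact: segcont_integrable.
have := @cint_cst M%:C _ _ ab; rewrite -rmorphM => /(congr1 (@complex.Re _)) /= <-.
apply: le_Rintegral => //.
- apply: (@segcont_integrable (fun z => `|k z|)) => // z w.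
  exact: le_trans (ler_dist_dist _ _) _.
- by apply: (@segcont_integrable (@complex.Re _) (fun=> M%:C)) => [|x _ e e0];
    [exact: Re_lip|exists 1 => // y _ _; rewrite subrr cabs0].
- move=> x /=; rewrite in_itv /= => /fM; apply: le_trans.
  by have := kL (f x) 0; rewrite k0 !subr0.
Qed.

(** The factor 2 comes from bounding real and imaginary part separately. Such constants are
    harmless: the powers taken in [maximum_modulus] remove them. *)
Lemma cint_bound f a b M : a <= b -> segcont f a b ->
  (forall x, a <= x <= b -> cabs (f x) <= M) ->
  cabs (cint f a b) <= 2 * M * (b - a).
Proof.
move=> ab fc fM; apply: le_trans (cabs_le_ReIm _) _ => /=.
have := @Rint_bound (@complex.Re R) f a b M Re_lip erefl ab fc fM.
have := @Rint_bound (@complex.Im R) f a b M Im_lip erefl ab fc fM.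
lra.
Qed.

Lemma cint_id a b : a <= b ->
  cint (fun x => x%:C) a b = ((b ^+ 2 - a ^+ 2) / 2)%:C.
Proof.
move=> ab; rewrite /cint /= Rintegral_cst // mul0r; congr Complex.
move: ab; rewrite le_eqVlt => /predU1P[->|ab].
  by rewrite set_itv1 Rintegral_set1 subrr mul0r.
have d x : is_derive x (1 : R) (fun y => y ^+ 2 / 2) x.
  apply: is_derive_eq; rewrite /GRing.scale /=; lra.
have c : continuous (fun y : R => y ^+ 2 / 2).
  by move=> x; apply/differentiable_continuous/derivable1_diffP.
rewrite /Rintegral (@continuous_FTC2 _ _ (fun y => y ^+ 2 / 2)) //=.
- lra.
- by apply: continuous_subspaceT => x; exact: cvg_id.
- split.
  + by move=> x _; exact: ex_derive.
  + by apply: cvg_at_right_filter; exact: c.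
  + by apply: cvg_at_left_filter; exact: c.
- by move=> x _; rewrite derive1E derive_val.
Qed.

End CurveIntegral.

Section RectangleIntegral.
Variable R : realType.
Implicit Types (f g : R[i] -> R[i]) (x y : R).

Lemma segcont_slice (k : R -> R[i]) f a b :
  (forall x y, cabs (k x - k y) <= `|x - y|) ->
  (forall x, a <= x <= b -> ccont f (k x)) -> segcont (fun x => f (k x)) a b.
Proof.
move=> kL fc x xab e e0; have [r r0 H] := fc x xab e e0.
by exists r => // y _ xy; apply: H; exact: le_lt_trans (kL _ _) xy.
Qed.

Lemma hline_lip (y x1 x2 : R) : cabs ((x1 +i* y) - (x2 +i* y)) <= `|x1 - x2|.
Proof.
have -> : (x1 +i* y) - (x2 +i* y) = (x1 - x2)%:C.
  by apply/eqP; rewrite eq_complex /= subrr !eqxx.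
by rewrite cabs_real.
Qed.

Lemma vline_lip (x y1 y2 : R) : cabs ((x +i* y1) - (x +i* y2)) <= `|y1 - y2|.
Proof.
have -> : (x +i* y1) - (x +i* y2) = 'i * (y1 - y2)%:C.
  by apply/eqP; rewrite eq_complex /=; apply/andP; split; apply/eqP; ring.
by rewrite cabsM cabs_real /cabs /= expr0n add0r expr1n sqrtr1 mul1r.
Qed.

Definition inrect x1 x2 y1 y2 (z : R[i]) :=
  (x1 <= complex.Re z <= x2) && (y1 <= complex.Im z <= y2).

Definition rbdry x1 x2 y1 y2 (z : R[i]) := inrect x1 x2 y1 y2 z &&
  [|| complex.Re z == x1, complex.Re z == x2, complex.Im z == y1 | complex.Im z == y2].

(** Counterclockwise contour integral: bottom minus top, and i times right minus left because dz = i
    dy on vertical sides. *)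
Definition oint f x1 x2 y1 y2 : R[i] :=
  cint (fun x => f (x +i* y1)) x1 x2 - cint (fun x => f (x +i* y2)) x1 x2 +
  'i * (cint (fun y => f (x2 +i* y)) y1 y2 - cint (fun y => f (x1 +i* y)) y1 y2).

Definition bcont f x1 x2 y1 y2 := forall z, rbdry x1 x2 y1 y2 z -> ccont f z.

Definition rcont f x1 x2 y1 y2 := forall z, inrect x1 x2 y1 y2 z -> ccont f z.

Lemma rcont_bcont f x1 x2 y1 y2 : rcont f x1 x2 y1 y2 -> bcont f x1 x2 y1 y2.
Proof. by move=> fc z /andP[/fc]. Qed.

Lemma rcontW f x1 x2 y1 y2 x1' x2' y1' y2' :
  x1 <= x1' -> x2' <= x2 -> y1 <= y1' -> y2' <= y2 ->
  rcont f x1 x2 y1 y2 -> rcont f x1' x2' y1' y2'.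
Proof.
move=> a b c d fc z /andP[/andP[? ?] /andP[? ?]]; apply: fc.
by apply/andP; split; apply/andP; split; lra.
Qed.

Lemma rcont_hseg f x1 x2 y1 y2 y : y1 <= y <= y2 -> rcont f x1 x2 y1 y2 ->
  segcont (fun x => f (x +i* y)) x1 x2.
Proof.
move=> yy fc; apply: (segcont_slice (hline_lip y)) => x xx.
by apply: fc; rewrite /inrect /= xx yy.
Qed.

Lemma rcont_vseg f x1 x2 y1 y2 x : x1 <= x <= x2 -> rcont f x1 x2 y1 y2 ->
  segcont (fun y => f (x +i* y)) y1 y2.
Proof.
move=> xx fc; apply: (segcont_slice (vline_lip x)) => y yy.
by apply: fc; rewrite /inrect /= xx yy.
Qed.

Lemma bcont_seg f x1 x2 y1 y2 : x1 <= x2 -> y1 <= y2 -> bcont f x1 x2 y1 y2 ->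
  [/\ segcont (fun x => f (x +i* y1)) x1 x2, segcont (fun x => f (x +i* y2)) x1 x2,
      segcont (fun y => f (x1 +i* y)) y1 y2 & segcont (fun y => f (x2 +i* y)) y1 y2].
Proof.
move=> xx yy fc; split.
- by apply: (segcont_slice (hline_lip y1)) => x xb; apply: fc;
  rewrite /rbdry /inrect /= xb lexx yy eqxx !orbT.
- by apply: (segcont_slice (hline_lip y2)) => x xb; apply: fc;
  rewrite /rbdry /inrect /= xb lexx yy eqxx !orbT.
- by apply: (segcont_slice (vline_lip x1)) => x xb; apply: fc;
  rewrite /rbdry /inrect /= xb lexx xx eqxx.
- by apply: (segcont_slice (vline_lip x2)) => x xb; apply: fc;
  rewrite /rbdry /inrect /= xb lexx xx eqxx !orbT.
Qed.

Lemma ointD f g x1 x2 y1 y2 : x1 <= x2 -> y1 <= y2 ->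
  bcont f x1 x2 y1 y2 -> bcont g x1 x2 y1 y2 ->
  oint (fun z => f z + g z) x1 x2 y1 y2 = oint f x1 x2 y1 y2 + oint g x1 x2 y1 y2.
Proof.
move=> xx yy /(bcont_seg xx yy) [f1 f2 f3 f4] /(bcont_seg xx yy) [g1 g2 g3 g4].
by rewrite /oint !cintD //; ring.
Qed.

Lemma ointZ (c : R[i]) f x1 x2 y1 y2 : x1 <= x2 -> y1 <= y2 ->
  bcont f x1 x2 y1 y2 ->
  oint (fun z => c * f z) x1 x2 y1 y2 = c * oint f x1 x2 y1 y2.
Proof.
by move=> xx yy /(bcont_seg xx yy) [f1 f2 f3 f4]; rewrite /oint !cintZ //; ring.
Qed.

Lemma eq_oint f g x1 x2 y1 y2 : x1 <= x2 -> y1 <= y2 ->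
  (forall z, rbdry x1 x2 y1 y2 z -> f z = g z) ->
  oint f x1 x2 y1 y2 = oint g x1 x2 y1 y2.
Proof.
move=> xx yy fg; rewrite /oint; congr (_ - _ + _ * (_ - _)); apply: eq_cint => x xb;
  by apply: fg; rewrite /rbdry /inrect /= xb ?xx ?yy !lexx eqxx ?orbT.
Qed.

Lemma oint_bound f x1 x2 y1 y2 M : x1 <= x2 -> y1 <= y2 ->
  bcont f x1 x2 y1 y2 ->
  (forall z, rbdry x1 x2 y1 y2 z -> cabs (f z) <= M) ->
  cabs (oint f x1 x2 y1 y2) <= 4 * M * ((x2 - x1) + (y2 - y1)).
Proof.
move=> xx yy /(bcont_seg xx yy) [f1 f2 f3 f4] fM; rewrite /oint.
apply: le_trans (cabsD _ _) _; rewrite cabsM.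
have -> : cabs ('i : R[i]) = 1 by rewrite /cabs /= expr0n add0r expr1n sqrtr1.
have B : forall z w : R[i], cabs (z - w) <= cabs z + cabs w.
  by move=> z w; rewrite -(cabsN w) cabsD.
have := B (cint (fun x => f (x +i* y1)) x1 x2) (cint (fun x => f (x +i* y2)) x1 x2).
have := B (cint (fun y => f (x2 +i* y)) y1 y2) (cint (fun y => f (x1 +i* y)) y1 y2).
have H1 : cabs (cint (fun x => f (x +i* y1)) x1 x2) <= 2 * M * (x2 - x1).
  by apply: cint_bound => // x xb; apply: fM; rewrite /rbdry /inrect /= xb ?xx ?yy !lexx eqxx ?orbT.
have H2 : cabs (cint (fun x => f (x +i* y2)) x1 x2) <= 2 * M * (x2 - x1).
  by apply: cint_bound => // x xb; apply: fM; rewrite /rbdry /inrect /= xb ?xx ?yy !lexx eqxx ?orbT.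
have H3 : cabs (cint (fun y => f (x1 +i* y)) y1 y2) <= 2 * M * (y2 - y1).
  by apply: cint_bound => // x xb; apply: fM; rewrite /rbdry /inrect /= xb ?xx ?yy !lexx eqxx ?orbT.
have H4 : cabs (cint (fun y => f (x2 +i* y)) y1 y2) <= 2 * M * (y2 - y1).
  by apply: cint_bound => // x xb; apply: fM; rewrite /rbdry /inrect /= xb ?xx ?yy !lexx eqxx ?orbT.
lra.
Qed.

Lemma oint_splitx f x1 x2 y1 y2 c : x1 <= c <= x2 -> y1 <= y2 ->
  rcont f x1 x2 y1 y2 ->
  oint f x1 x2 y1 y2 = oint f x1 c y1 y2 + oint f c x2 y1 y2.
Proof.
move=> xx yy fc; rewrite /oint.
rewrite (cint_cat (f := fun x => f (x +i* y1)) xx); last by apply: rcont_hseg fc; rewrite lexx yy.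
rewrite (cint_cat (f := fun x => f (x +i* y2)) xx); last by apply: rcont_hseg fc; rewrite lexx yy.
ring.
Qed.

Lemma oint_splity f x1 x2 y1 y2 c : x1 <= x2 -> y1 <= c <= y2 ->
  rcont f x1 x2 y1 y2 ->
  oint f x1 x2 y1 y2 = oint f x1 x2 y1 c + oint f x1 x2 c y2.
Proof.
move=> xx yy fc; rewrite /oint.
rewrite (cint_cat (f := fun y => f (x1 +i* y)) yy); last by apply: rcont_vseg fc; rewrite lexx xx.
rewrite (cint_cat (f := fun y => f (x2 +i* y)) yy); last by apply: rcont_vseg fc; rewrite lexx xx.
ring.
Qed.

Lemma segcont_cst (c : R[i]) a b : segcont (fun=> c) a b.
Proof. by move=> x _ e e0; exists 1 => // y _ _; rewrite subrr cabs0. Qed.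

Lemma segcont_real_complex a b : segcont (fun x : R => x%:C) a b.
Proof. by move=> x _ e e0; exists e => // y _; rewrite -rmorphB cabs_real. Qed.

Lemma cint_affine (c d : R[i]) a b : a <= b ->
  cint (fun x => c + d * x%:C) a b = c * (b - a)%:C + d * ((b ^+ 2 - a ^+ 2) / 2)%:C.
Proof.
move=> ab; rewrite cintD; first 1 last.
- exact: segcont_cst.
- move=> x xab e e0.
  exists (e / (cabs d + 1)) => [|y yab].
    by rewrite divr_gt0 // ltr_wpDl // cabs_ge0.
  have := cabs_ge0 d => d0.
  rewrite ltr_pdivlMr ?ltr_wpDl // => H.
  rewrite -mulrBr -rmorphB cabsM cabs_real.
  apply: le_lt_trans H; rewrite mulrC ler_wpM2l //; lra.
by rewrite cint_cst // cintZ ?cint_id //; exact: segcont_real_complex.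
Qed.

Lemma complex_xy (x y : R) : x +i* y = x%:C + 'i * y%:C.
Proof. by rewrite [LHS]complexE. Qed.

(** The horizontal sides contribute -i d times the area, the vertical ones i d times the area. This
    covers the tangent function that Goursat's argument subtracts. *)
Lemma oint_affine (c d : R[i]) x1 x2 y1 y2 : x1 <= x2 -> y1 <= y2 ->
  oint (fun z => c + d * z) x1 x2 y1 y2 = 0.
Proof.
move=> xx yy; rewrite /oint.
have H (y : R) : cint (fun x => c + d * (x +i* y)) x1 x2 =
    (c + d * 'i * y%:C) * (x2 - x1)%:C + d * ((x2 ^+ 2 - x1 ^+ 2) / 2)%:C.
  rewrite -cint_affine //; apply: eq_cint => x _; rewrite complex_xy; ring.
have V (x : R) : cint (fun y => c + d * (x +i* y)) y1 y2 =
    (c + d * x%:C) * (y2 - y1)%:C + (d * 'i) * ((y2 ^+ 2 - y1 ^+ 2) / 2)%:C.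
  rewrite -cint_affine //; apply: eq_cint => y _; rewrite complex_xy; ring.
rewrite !H !V !rmorphB /=; ring.
Qed.

End RectangleIntegral.

(** * Goursat's theorem *)

Section Goursat.
Variable R : realType.
Implicit Types (f g : R[i] -> R[i]) (x y w h : R).

(** Left ends increase and right ends decrease, so every left end is below every right end, and the
    supremum of the left ends lies in all segments. *)
Lemma nested_segments (u : nat -> R) w : 0 <= w ->
  (forall n, u n <= u n.+1 /\ u n.+1 + w / 2 ^+ n.+1 <= u n + w / 2 ^+ n) ->
  exists X, forall n, u n <= X <= u n + w / 2 ^+ n.
Proof.
move=> w0 H.
have w2 n : 0 <= w / 2 ^+ n by rewrite divr_ge0 // exprn_ge0.
have lo n k : u n <= u (n + k)%N.
  by elim: k => [|k IH]; rewrite ?addn0 // addnS; case: (H (n + k)%N); lra.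
have hi n k : u (n + k)%N + w / 2 ^+ (n + k) <= u n + w / 2 ^+ n.
  by elim: k => [|k IH]; rewrite ?addn0 // addnS; case: (H (n + k)%N); lra.
have uu n m : u m <= u n + w / 2 ^+ n.
  have [nm|mn] := leqP n m.
    by have := hi n (m - n)%N; rewrite subnKC //; have := w2 m; lra.
  by have := lo m (n - m)%N; rewrite subnKC ?(ltnW mn) //; have := w2 n; lra.
have S : has_sup (range u).
  by split; [exists (u 0%N); exists 0%N|exists (u 0%N + w / 2 ^+ 0) => _ [m _ <-]].
exists (sup (range u)) => n; apply/andP; split.
  by apply: sup_upper_bound => //; exists n.
by apply: ge_sup; [exists (u 0%N); exists 0%N|move=> _ [m _ <-]].
Qed.

(** Keeping one quarter at each step yields nested rectangles with a common point. [P] takes a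
    corner and the two side lengths; it is left free because the same argument serves, with height
    0, for segments. *)
Lemma bisection (P : R -> R -> R -> R -> Prop) x y w h : 0 <= w -> 0 <= h ->
  (forall n a b, x <= a -> a + w / 2 ^+ n <= x + w ->
     y <= b -> b + h / 2 ^+ n <= y + h ->
     P a b (w / 2 ^+ n) (h / 2 ^+ n) ->
   exists a' b', [/\ a' = a \/ a' = a + w / 2 ^+ n.+1, b' = b \/ b' = b + h / 2 ^+ n.+1
     & P a' b' (w / 2 ^+ n.+1) (h / 2 ^+ n.+1)]) ->
  P x y w h ->
  exists X Y, forall n, exists a b,
    [/\ x <= a <= X, X <= a + w / 2 ^+ n <= x + w,
        y <= b <= Y, Y <= b + h / 2 ^+ n <= y + h
      & P a b (w / 2 ^+ n) (h / 2 ^+ n)].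
Proof.
move=> w0 h0 step P0.
pose Q n (c : R * R) := [/\ x <= c.1, c.1 + w / 2 ^+ n <= x + w,
     y <= c.2, c.2 + h / 2 ^+ n <= y + h & P c.1 c.2 (w / 2 ^+ n) (h / 2 ^+ n)].
have half (v : R) n : v / 2 ^+ n.+1 = v / 2 ^+ n / 2.
  by rewrite exprS invfM mulrA mulrAC.
have w2 n : 0 <= w / 2 ^+ n by rewrite divr_ge0 // exprn_ge0.
have h2 n : 0 <= h / 2 ^+ n by rewrite divr_ge0 // exprn_ge0.
(* The invariant [Q] is a premise inside the existential, which makes the relation total and lets
   [choice] apply. *)
have next (nc : nat * (R * R)) : exists c' : R * R, Q nc.1 nc.2 ->
   [/\ Q nc.1.+1 c', nc.2.1 <= c'.1 /\ c'.1 + w / 2 ^+ nc.1.+1 <= nc.2.1 + w / 2 ^+ nc.1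
     & nc.2.2 <= c'.2 /\ c'.2 + h / 2 ^+ nc.1.+1 <= nc.2.2 + h / 2 ^+ nc.1].
  case: nc => n c /=; have [[xa aw yb bh Pc]|nQ] := pselect (Q n c); last by exists c.
  have [a' [b' [Ha Hb P']]] := step n c.1 c.2 xa aw yb bh Pc.
  exists (a', b') => _; rewrite /Q /=.
  rewrite !half in Ha Hb P' *.
  have := w2 n; have := h2 n.
  move: (w / 2 ^+ n) (h / 2 ^+ n) xa aw yb bh Ha Hb P' => W K xa aw yb bh Ha Hb P' W0 K0.
  clear -xa aw yb bh Ha Hb P' W0 K0.
  by case: Ha P' => ->; case: Hb => -> P'; split; try (split => //; lra); split => //; lra.
have [nx Hnx] := choice next.
pose u := fix u n := if n is m.+1 then nx (m, u m) else (x, y).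
have Qu n : Q n (u n).
  elim: n => [|n IH]; first by split; rewrite /= ?expr0 ?divr1.
  by have [] := Hnx (n, u n) IH.
have [X HX] : exists X, forall n, (u n).1 <= X <= (u n).1 + w / 2 ^+ n.
  by apply: (@nested_segments (fun n => (u n).1)) => // n; have [] := Hnx (n, u n) (Qu n).
have [Y HY] : exists Y, forall n, (u n).2 <= Y <= (u n).2 + h / 2 ^+ n.
  by apply: (@nested_segments (fun n => (u n).2)) => // n; have [] := Hnx (n, u n) (Qu n).
exists X, Y => n; exists (u n).1, (u n).2.
have [q1 q2 q3 q4 q5] := Qu n; have /andP[X1 X2] := HX n; have /andP[Y1 Y2] := HY n.
by split => //; apply/andP.
Qed.

Lemma exp2_small (S r : R) : 0 < r -> exists n, S / 2 ^+ n < r.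
Proof.
move=> r0; have [n Hn] : exists n : nat, S / r < n%:R.
  exists (Num.bound (S / r)); have [s|s] := leP 0 (S / r).
    by exact: archi_boundP.
  by apply: lt_le_trans s _; rewrite ler0n.
exists n; rewrite ltr_pdivrMr ?exprn_gt0 // mulrC -ltr_pdivrMr //.
apply: lt_trans Hn _; rewrite -natrX ltr_nat; exact: ltn_expl.
Qed.

Lemma inrect_dist (x1 x2 y1 y2 : R) z z' :
  inrect x1 x2 y1 y2 z -> inrect x1 x2 y1 y2 z' -> cabs (z - z') <= (x2 - x1) + (y2 - y1).
Proof.
move=> /andP[/andP[? ?] /andP[? ?]] /andP[/andP[? ?] /andP[? ?]].
apply: le_trans (cabs_le_ReIm _) _; rewrite !raddfB /=.
by apply: lerD; rewrite ler_norml; apply/andP; split; lra.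
Qed.

Lemma inrectW (x1 x2 y1 y2 x1' x2' y1' y2' : R) z :
  x1 <= x1' -> x2' <= x2 -> y1 <= y1' -> y2' <= y2 ->
  inrect x1' x2' y1' y2' z -> inrect x1 x2 y1 y2 z.
Proof.
move=> ? ? ? ? /andP[/andP[? ?] /andP[? ?]].
by apply/andP; split; apply/andP; split; lra.
Qed.

Lemma Goursat f x1 x2 y1 y2 : x1 <= x2 -> y1 <= y2 ->
  (forall z, inrect x1 x2 y1 y2 z -> exists d, cderiv f z d) ->
  oint f x1 x2 y1 y2 = 0.
Proof.
move=> xx yy fd.
have fc : rcont f x1 x2 y1 y2 by move=> z /fd [d /cderiv_ccont].
pose w := x2 - x1; pose h := y2 - y1; pose S := w + h.
have w0 : 0 <= w by rewrite subr_ge0.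
have h0 : 0 <= h by rewrite subr_ge0.
have Ex : x1 + w = x2 by rewrite /w; ring.
have Ey : y1 + h = y2 by rewrite /h; ring.
apply/eqP; rewrite -cabs_eq0 eq_le cabs_ge0 andbT leNgt; apply/negP => O0.
(* The added 1 keeps the inequality strict even for a degenerate rectangle. *)
have [e e0 He] : exists2 e : R, 0 < e & e * S ^+ 2 < cabs (oint f x1 x2 y1 y2).
  exists (cabs (oint f x1 x2 y1 y2) / (S ^+ 2 + 1)).
    by rewrite divr_gt0 // ltr_wpDl // sqr_ge0.
  rewrite mulrAC ltr_pdivrMr ?ltr_wpDl ?sqr_ge0 //.
  by rewrite ltr_pM2l // ltrDl.
(* Both sides scale alike: halving the sides divides the square of the half perimeter by 4, and some
   quarter carries at least a fourth of the modulus. *)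
pose P a b w' h' := e * (w' + h') ^+ 2 < cabs (oint f a (a + w') b (b + h')).
have [n a b xa aw yb bh| |X [Y H]] := @bisection P x1 y1 w h w0 h0.
- rewrite /P.
  have half (v : R) : v / 2 ^+ n.+1 = v / 2 ^+ n / 2.
    by rewrite exprS invfM mulrA mulrAC.
  rewrite !half.
  have W0 : 0 <= w / 2 ^+ n by rewrite divr_ge0 // exprn_ge0.
  have H0 : 0 <= h / 2 ^+ n by rewrite divr_ge0 // exprn_ge0.
  move: (w / 2 ^+ n) (h / 2 ^+ n) W0 H0 aw bh => W H W0 H0 aw bh.
  have aW : a + W / 2 + W / 2 = a + W by lra.
  have bH : b + H / 2 + H / 2 = b + H by lra.
  rewrite Ex in aw; rewrite Ey in bh.
  have fc' : rcont f a (a + W) b (b + H) by apply: rcontW fc.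
  rewrite (@oint_splitx _ f a (a + W) b (b + H) (a + W / 2)) //; try lra.
  rewrite (@oint_splity _ f a (a + W / 2) b (b + H) (b + H / 2)); try lra.
  2: by apply: rcontW fc'; lra.
  rewrite (@oint_splity _ f (a + W / 2) (a + W) b (b + H) (b + H / 2)); try lra.
  2: by apply: rcontW fc'; lra.
  move=> big.
  set o1 := oint f a (a + W / 2) b (b + H / 2) in big.
  set o2 := oint f a (a + W / 2) (b + H / 2) (b + H) in big.
  set o3 := oint f (a + W / 2) (a + W) b (b + H / 2) in big.
  set o4 := oint f (a + W / 2) (a + W) (b + H / 2) (b + H) in big.
  have := cabsD (o1 + o2) (o3 + o4); have := cabsD o1 o2; have := cabsD o3 o4.
  pose q := e * (W / 2 + H / 2) ^+ 2.
  have Eq : e * (W + H) ^+ 2 = 4 * q by rewrite /q; field.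
  rewrite Eq in big => T1 T2 T3.
  have [q1|q1] := ltP q (cabs o1).
    by exists a, b; split; [left|left|].
  have [q2|q2] := ltP q (cabs o2).
    by exists a, (b + H / 2); split; [left|right|rewrite bH].
  have [q3|q3] := ltP q (cabs o3).
    by exists (a + W / 2), b; split; [right|left|rewrite aW].
  have [q4|q4] := ltP q (cabs o4).
    by exists (a + W / 2), (b + H / 2); split; [right|right|rewrite aW bH].
  by clear -big T1 T2 T3 q1 q2 q3 q4; lra.
- by rewrite /P Ex Ey.
- have Xin : inrect x1 x2 y1 y2 (X +i* Y).
    have [a [b [/andP[? ?] /andP[? ?] /andP[? ?] /andP[? ?] _]]] := H 0%N.
    by rewrite /inrect /= -Ex -Ey; apply/andP; split; apply/andP; split; lra.
  have [d Hd] := fd _ Xin.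
  (* [oint_bound] multiplies the tangent error by 4 times the half perimeter, so e / 8 leaves e / 2
     times its square, against the invariant [P]. *)
  have e80 : 0 < e / 8 by rewrite divr_gt0.
  have [r r0 Hr] := Hd _ e80.
  have [n Hn] := exp2_small S r0.
  have [a [b [/andP[xa aX] /andP[Xa aw] /andP[yb bY] /andP[Yb bh]]]] := H n.
  have W0 : 0 <= w / 2 ^+ n by rewrite divr_ge0 // exprn_ge0.
  have H0 : 0 <= h / 2 ^+ n by rewrite divr_ge0 // exprn_ge0.
  rewrite mulrDl in Hn; rewrite Ex in aw; rewrite Ey in bh.
  rewrite /P; apply/negP; rewrite -leNgt.
  move: (w / 2 ^+ n) (h / 2 ^+ n) W0 H0 Hn aw bh Xa Yb => W K W0 H0 Hn aw bh Xa Yb.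
  have aW : a <= a + W by lra.
  have bK : b <= b + K by lra.
  pose c := X +i* Y.
  (* Subtracting the tangent at [c] leaves the integral unchanged and makes the integrand at most e
     / 8 times the distance to [c]. *)
  pose g z := f z + (- (f c - c * d) + (- d) * z).
  have ac z : ccont (fun z => - (f c - c * d) + (- d) * z) z.
    by apply: cderiv_ccont; apply: cderivD; [exact: cderiv_cst|apply: cderivMl; exact: cderiv_id].
  have fc' : bcont f a (a + W) b (b + K) by apply: rcont_bcont; apply: rcontW fc.
  have -> : oint f a (a + W) b (b + K) = oint g a (a + W) b (b + K).
    by rewrite /g ointD // oint_affine // addr0.
  have B : cabs (oint g a (a + W) b (b + K)) <= 4 * (e / 8 * (W + K)) * (a + W - a + (b + K - b)).
    apply: oint_bound => // z /andP[zin0 _]; have zin := inrectW xa aw yb bh zin0.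
      have [d' Hd'] := fd z zin; apply: cderiv_ccont.
      by apply: cderivD Hd' _; apply: cderivD; [exact: cderiv_cst|apply: cderivMl; exact: cderiv_id].
    have zc : cabs (z - c) <= W + K.
      have -> : W + K = a + W - a + (b + K - b) by ring.
      by apply: inrect_dist => //; rewrite /inrect /= aX Xa bY Yb.
    have := Hr (z - c); rewrite -/c subrKC => Hz.
    have -> : g z = f z - f c - (z - c) * d by rewrite /g; ring.
    apply: le_trans (Hz _) _; first exact: le_lt_trans zc Hn.
    by rewrite ler_pM2l.
  have eWK := mulr_ge0 (ltW e0) (sqr_ge0 (W + K)).
  apply: le_trans B _; clear -eWK; lra.
Qed.

End Goursat.

(** * Goursat's theorem with exceptional points *)

Section MaximumPrinciple.
Variable R : realType.
Implicit Types (f g : R[i] -> R[i]) (S : seq R[i]).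

Lemma cint_point (f : R -> R[i]) a : cint f a a = 0.
Proof. by rewrite /cint set_itv1 !Rintegral_set1. Qed.

Lemma oint_flatx f x y1 y2 : oint f x x y1 y2 = 0.
Proof. by rewrite /oint !cint_point !subrr mulr0 addr0. Qed.

Lemma oint_flaty f x1 x2 y : oint f x1 x2 y y = 0.
Proof. by rewrite /oint !cint_point !subrr mulr0 addr0. Qed.

(** An edge for a small box around c: at distance at most e, and either strictly on one side of c or
    already an edge of the large rectangle, in which case the strip cut off is flat. [clip_hi] is
    the mirror image. *)
Lemma clip_lo (x c e : R) : x <= c -> 0 < e ->
  exists a, [/\ x <= a, a <= c, c - e <= a & a = x \/ a < c].
Proof.
move=> xc e0; have [h|h] := leP x (c - e).
  by exists (c - e); split=> //; [lra|right; lra].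
by exists x; split => //; [lra|left].
Qed.

Lemma clip_hi (x c e : R) : c <= x -> 0 < e ->
  exists a, [/\ c <= a, a <= x, a <= c + e & a = x \/ c < a].
Proof.
move=> xc e0; have [h|h] := leP x (c + e).
  by exists x; split => //; left.
by exists (c + e); split=> //; [lra|lra|right; lra].
Qed.

Definition rderiv_off S f x1 x2 y1 y2 := forall z, inrect x1 x2 y1 y2 z ->
  z \notin S -> exists d, cderiv f z d.

(** By induction on [S]: a small box around the point [c] is cut out by four lines. The outer pieces
    avoid [c], and the box contributes O(e) because continuity bounds [f] near [c]. *)
Lemma Goursat_off S f x1 x2 y1 y2 : x1 <= x2 -> y1 <= y2 ->
  rcont f x1 x2 y1 y2 -> rderiv_off S f x1 x2 y1 y2 -> oint f x1 x2 y1 y2 = 0.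
Proof.
elim: S x1 x2 y1 y2 => [|c S IH] x1 x2 y1 y2 xx yy fc fd.
  by apply: Goursat => // z zr; apply: fd.
have IH' u1 u2 v1 v2 : u1 <= u2 -> v1 <= v2 -> x1 <= u1 -> u2 <= x2 -> y1 <= v1 -> v2 <= y2 ->
    (inrect u1 u2 v1 v2 c = false) -> oint f u1 u2 v1 v2 = 0.
  move=> uu vv h1 h2 h3 h4 cu; apply: IH => //; first exact: rcontW fc.
  move=> z zu zS; apply: fd; first exact: inrectW zu.
  by rewrite inE negb_or zS andbT; apply: contraFN cu => /eqP <-.
have [cin|/negbTE cin] := boolP (inrect x1 x2 y1 y2 c); last exact: IH'.
have [r r0 Hr] := fc _ cin _ ltr01.
pose M := cabs (f c) + 1.
have M0 : 0 < M by rewrite ltr_wpDl // cabs_ge0.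
have small e : 0 < e -> e * 4 < r -> cabs (oint f x1 x2 y1 y2) <= 4 * M * (4 * e).
  move=> e0 er; have /andP[/andP[x1c cx2] /andP[y1c cy2]] := cin.
  have [a [x1a ax ae a']] := clip_lo x1c e0.
  have [b [xb bx be b']] := clip_hi cx2 e0.
  have [p [y1p py pe p']] := clip_lo y1c e0.
  have [q [yq qy qe q']] := clip_hi cy2 e0.
  have ab := le_trans ax xb; have pq := le_trans py yq.
  have out u1 u2 v1 v2 : [|| u2 < complex.Re c, complex.Re c < u1, v2 < complex.Im c |
      complex.Im c < v1] -> inrect u1 u2 v1 v2 c = false.
    move=> H; apply/negbTE; rewrite /inrect !negb_and -!ltNge.
    by case/or4P: H => ->; rewrite ?orbT.
  have zl : oint f x1 a y1 y2 = 0.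
    case: a' => [->|ac]; first exact: oint_flatx.
    by apply: IH' => //; [exact: le_trans ax cx2|rewrite out // ac].
  have zr : oint f b x2 y1 y2 = 0.
    case: b' => [->|cb]; first exact: oint_flatx.
    by apply: IH' => //; [exact: le_trans x1c xb|rewrite out // cb orbT].
  have zb : oint f a b y1 p = 0.
    case: p' => [->|pc]; first exact: oint_flaty.
    by apply: IH' => //; [exact: le_trans py cy2|rewrite out // pc !orbT].
  have zt : oint f a b q y2 = 0.
    case: q' => [->|cq]; first exact: oint_flaty.
    by apply: IH' => //; [exact: le_trans y1c yq|rewrite out // cq !orbT].
  have fcM : rcont f a b y1 y2 by apply: rcontW fc.
  rewrite (@oint_splitx _ f x1 x2 y1 y2 a) //; last first.
    by rewrite x1a /=; exact: le_trans ax cx2.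
  rewrite zl add0r (@oint_splitx _ f a x2 y1 y2 b) //; first last.
  - by apply: rcontW fc.
  - by rewrite ab.
  rewrite zr addr0 (@oint_splity _ f a b y1 y2 p) //; last first.
    by rewrite y1p /=; exact: le_trans py cy2.
  rewrite zb add0r (@oint_splity _ f a b p y2 q) //; first last.
  - by apply: rcontW fcM.
  - by rewrite pq.
  rewrite zt addr0.
  have fcc : bcont f a b p q by apply: rcont_bcont; apply: rcontW fcM.
  have inc : inrect a b p q c by rewrite /inrect ax xb py yq.
  have bnd : forall z, rbdry a b p q z -> cabs (f z) <= M.
    move=> z /andP[zin _]; have zc := inrect_dist zin inc.
    have {}zc : cabs (z - c) < r by clear -zc be ae pe qe er; lra.
    have := Hr _ zc; have := cabsD (f z - f c) (f c); rewrite subrK /M.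
    by clear; lra.
  apply: le_trans (oint_bound ab pq fcc bnd) _.
  have P0 : 0 <= 4 * M by rewrite mulr_ge0 // ltW.
  by apply: ler_wpM2l => //; clear -ae be pe qe; lra.
apply/eqP; rewrite -cabs_eq0 eq_le cabs_ge0 andbT leNgt; apply/negP => O0.
(* [small] then bounds the integral by 16 M e, at most half of its modulus, which contradicts
   [O0]. *)
pose e := Num.min (r / 8) (cabs (oint f x1 x2 y1 y2) / (32 * M)).
have e0 : 0 < e by rewrite lt_min !divr_gt0 // mulr_gt0.
have er : e <= r / 8 by rewrite ge_min lexx.
have eM : e * (32 * M) <= cabs (oint f x1 x2 y1 y2).
  by rewrite -ler_pdivlMr ?mulr_gt0 // ge_min lexx orbT.
have := small e e0; clear -er r0 eM O0 M0.
move=> /(_ _) H; have : e * 4 < r by lra.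
by move=> /H; lra.
Qed.

(** The imaginary part collects Im f on the horizontal and Re f on the vertical sides with the signs
    of the orientation; every term is nonnegative and the bottom one is positive. *)
Lemma oint_Im_gt0 f x1 x2 y1 y2 m : x1 < x2 -> y1 <= y2 -> 0 < m ->
  bcont f x1 x2 y1 y2 ->
  (forall x, x1 <= x <= x2 -> m <= complex.Im (f (x +i* y1))) ->
  (forall x, x1 <= x <= x2 -> complex.Im (f (x +i* y2)) <= 0) ->
  (forall y, y1 <= y <= y2 -> complex.Re (f (x1 +i* y)) <= 0) ->
  (forall y, y1 <= y <= y2 -> 0 <= complex.Re (f (x2 +i* y))) ->
  0 < complex.Im (oint f x1 x2 y1 y2).
Proof.
move=> x12 yy m0 /(bcont_seg (ltW x12) yy) [f1 f2 f3 f4] H1 H2 H3 H4.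
have B := @cint_ge _ _ _ _ _ m (@Im_lip R) (ltW x12) f1 H1.
have Rt := @cint_ge _ _ _ _ _ 0 (@Re_lip R) yy f4 H4.
have neg (k : R[i] -> R) : (forall z w, `|k z - k w| <= cabs (z - w)) ->
    forall z w, `|- k z - (- k w)| <= cabs (z - w).
  by move=> kL z w; rewrite -opprD normrN.
have segN (g : R -> R[i]) a b : segcont g a b -> segcont (fun x => - g x) a b.
  move=> gc x xab e e0; have [d d0 Hd] := gc x xab e e0.
  by exists d => // y yab xy; rewrite -opprD cabsN; exact: Hd.
have cN (g : R -> R[i]) a b : segcont g a b -> cint (fun x => - g x) a b = - cint g a b.
  move=> gc; rewrite -mulN1r -cintZ //; apply: eq_cint => x _; by rewrite mulN1r.
have T : 0 <= complex.Im (- cint (fun x => f (x +i* y2)) x1 x2).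
  rewrite -cN //; apply: le_trans (@cint_ge _ _ _ _ _ 0 (@Im_lip R) (ltW x12) (segN _ _ _ f2) _) => //.
    by rewrite mul0r.
  by move=> x xb; rewrite raddfN /= oppr_ge0 H2.
have L : 0 <= complex.Re (- cint (fun y => f (x1 +i* y)) y1 y2).
  rewrite -cN //; apply: le_trans (@cint_ge _ _ _ _ _ 0 (@Re_lip R) yy (segN _ _ _ f3) _) => //.
    by rewrite mul0r.
  by move=> x xb; rewrite raddfN /= oppr_ge0 H3.
rewrite /oint !raddfD /=.
move: T L => /=; rewrite mul0r mul1r add0r.
have : 0 < m * (x2 - x1) by rewrite mulr_gt0 // subr_gt0.
by move: B Rt; clear; lra.
Qed.

End MaximumPrinciple.

(** * Maximum modulus principle *)

Section MaximumModulus.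
Variable R : realType.
Implicit Types (f g : R[i] -> R[i]) (S : seq R[i]) (z w : R[i]).

Lemma rbdry_neq (x1 x2 y1 y2 : R) w z :
  x1 < complex.Re w < x2 -> y1 < complex.Im w < y2 ->
  rbdry x1 x2 y1 y2 z -> z != w.
Proof.
move=> /andP[a b] /andP[c d] /andP[_ H]; apply/negP => /eqP E; move: H; rewrite E.
by rewrite (gt_eqF a) (lt_eqF b) (gt_eqF c) (lt_eqF d).
Qed.

Lemma rbdry_dist (x1 x2 y1 y2 : R) w z (e : R) :
  x1 + e <= complex.Re w <= x2 - e -> y1 + e <= complex.Im w <= y2 - e ->
  rbdry x1 x2 y1 y2 z -> e <= cabs (z - w).
Proof.
move=> /andP[a b] /andP[c d] /andP[_ H].
have := Re_le_cabs (z - w); have := Im_le_cabs (z - w); rewrite !raddfB /= !ler_norml.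
move=> /andP[i1 i2] /andP[r1 r2].
by case/or4P: H => /eqP H; rewrite H in i1 i2 r1 r2; lra.
Qed.

Lemma cderiv_inv w z : z != w -> cderiv (fun y => (y - w)^-1) z (- 1 / (z - w) ^+ 2).
Proof.
move=> zw; apply: cderiv_eq.
  apply: cderivV; first by rewrite subr_eq0.
  by apply: cderivB; [exact: cderiv_id|exact: cderiv_cst].
by rewrite subr0.
Qed.

Lemma Re_invE z : complex.Re z^-1 = complex.Re z / (complex.Re z ^+ 2 + complex.Im z ^+ 2).
Proof. by case: z. Qed.

Lemma Im_invE z : complex.Im z^-1 = - (complex.Im z / (complex.Re z ^+ 2 + complex.Im z ^+ 2)).
Proof. by case: z. Qed.

(** The number is 2 pi i, but evaluating it is avoided: the signs of the real and imaginary parts of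
    1 / (z - w) on the four sides already make its imaginary part positive. *)
Lemma winding_neq0 (x1 x2 y1 y2 : R) w :
  x1 < complex.Re w < x2 -> y1 < complex.Im w < y2 ->
  oint (fun z => (z - w)^-1) x1 x2 y1 y2 != 0.
Proof.
move=> xw yw; have /andP[a b] := xw; have /andP[c d] := yw.
have kc : bcont (fun z => (z - w)^-1) x1 x2 y1 y2.
  by move=> z /(rbdry_neq xw yw) zw; apply: cderiv_ccont (cderiv_inv zw).
have xx := lt_trans a b; have yy := ltW (lt_trans c d).
(* A lower bound of Im 1 / (z - w) on the bottom side, where |Re (z - w)| <= x2 - x1. *)
pose m := (complex.Im w - y1) / ((x2 - x1) ^+ 2 + (complex.Im w - y1) ^+ 2).
have q0 : 0 < (complex.Im w - y1) ^+ 2 by rewrite exprn_gt0 // subr_gt0.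
have m0 : 0 < m.
  by rewrite divr_gt0 ?subr_gt0 // ltr_wpDl // sqr_ge0.
have ss (u v : R) : 0 <= u ^+ 2 + v ^+ 2 by rewrite addr_ge0 // sqr_ge0.
apply/negP => /eqP O0.
suff : 0 < complex.Im (oint (fun z => (z - w)^-1) x1 x2 y1 y2) by rewrite O0 ltxx.
apply: (oint_Im_gt0 xx yy m0 kc) => [x xb|x xb|y yb|y yb].
- rewrite Im_invE !raddfB /= -mulNr opprB /m ler_pM2l ?subr_gt0 //.
  rewrite lef_pV2 ?posrE //; first last.
  + by rewrite ltr_wpDl ?sqr_ge0 // -sqrrN opprB.
  + by rewrite ltr_wpDl // sqr_ge0.
  rewrite -(sqrrN (y1 - _)) opprB lerD2r.
  have /andP[? ?] := xb; rewrite -(real_normK (num_real (x - _))) ler_sqr ?nnegrE //.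
    by rewrite ler_norml; apply/andP; split; move: xb a b; clear; lra.
  by rewrite subr_ge0 ltW.
- rewrite Im_invE !raddfB /= oppr_le0 divr_ge0 // subr_ge0 ltW //.
- rewrite Re_invE !raddfB /= mulr_le0_ge0 ?invr_ge0 // subr_le0 ltW //.
- by rewrite Re_invE !raddfB /= divr_ge0 // subr_ge0 ltW.
Qed.

Lemma ccont_eq_near f g z : (exists2 r : R, 0 < r & forall y, cabs (y - z) < r -> f y = g y) ->
  ccont f z -> ccont g z.
Proof.
move=> [r r0 fg] fc e e0; have [d d0 Hd] := fc e e0.
exists (Num.min r d) => [|y]; first by rewrite lt_min r0.
rewrite lt_min => /andP[yr yd]; rewrite -!fg ?subrr ?cabs0 //; exact: Hd.
Qed.

Lemma cderiv_eq_near f g z d : (exists2 r : R, 0 < r & forall y, cabs (y - z) < r -> f y = g y) ->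
  cderiv f z d -> cderiv g z d.
Proof. by move=> fg; apply: cderiv_near; apply/nbhs_cabsP. Qed.

Lemma ccontD f g z : ccont f z -> ccont g z -> ccont (fun y => f y + g y) z.
Proof.
move=> fc gc e e0; have e20 : 0 < e / 2 by rewrite divr_gt0.
have [r r0 Hr] := fc _ e20; have [s s0 Hs] := gc _ e20.
exists (Num.min r s) => [|y]; first by rewrite lt_min r0.
rewrite lt_min => /andP[/Hr {}Hr /Hs {}Hs].
have -> : f y + g y - (f z + g z) = (f y - f z) + (g y - g z) by ring.
by apply: le_lt_trans (cabsD _ _) _; move: Hr Hs; clear; lra.
Qed.

(** Stated for values rather than functions, since [ccontM] and [segcontM] both rest on it. The
    minimum with 1 absorbs the product of the two errors. *)
Lemma mul_near z w (e : R) : 0 < e -> exists2 r : R, 0 < r &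
  forall z' w', cabs (z' - z) < r -> cabs (w' - w) < r ->
    cabs (z' * w' - z * w) < e.
Proof.
move=> e0; have F0 := cabs_ge0 z; have G0 := cabs_ge0 w.
pose D := 2 + cabs z + cabs w.
have D0 : 0 < D by rewrite /D; lra.
pose n := Num.min 1 (e / D).
have n0 : 0 < n by rewrite lt_min ltr01 divr_gt0.
have n1 : n <= 1 by rewrite /n ge_min lexx.
have nD : n * D <= e by rewrite -ler_pdivlMr // /n ge_min lexx orbT.
exists n => // z' w' Hz Hw.
have -> : z' * w' - z * w = (z' - z) * (w' - w) + (z' - z) * w + z * (w' - w) by ring.
apply: le_lt_trans (cabsD _ _) _; rewrite !cabsM.
have T := cabsD ((z' - z) * (w' - w)) ((z' - z) * w); rewrite !cabsM in T.
have P1 : cabs (z' - z) * cabs (w' - w) <= n * 1.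
  by apply: ler_pM; rewrite ?cabs_ge0 // ?ltW // (lt_le_trans Hw).
have P2 : cabs (z' - z) * cabs w <= n * cabs w by rewrite ler_wpM2r // ltW.
have P3 : cabs z * cabs (w' - w) <= cabs z * n by rewrite ler_wpM2l // ltW.
by rewrite /D in nD; move: T P1 P2 P3 nD n0; clear; lra.
Qed.

Lemma ccontM f g z : ccont f z -> ccont g z -> ccont (fun y => f y * g y) z.
Proof.
move=> fc gc e /(mul_near (f z) (g z)) [n n0 Hn].
have [r r0 Hr] := fc _ n0; have [s s0 Hs] := gc _ n0.
exists (Num.min r s) => [|y]; first by rewrite lt_min r0.
by rewrite lt_min => /andP[/Hr {}Hr /Hs {}Hs]; exact: Hn.
Qed.

Definition dquot f w d z := if z == w then d else (f z - f w) / (z - w).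

Lemma dquot_neq f w d z : z != w -> dquot f w d z = (f z - f w) / (z - w).
Proof. by rewrite /dquot => /negbTE ->. Qed.

Lemma dquot_near f w d z : z != w -> exists2 r : R, 0 < r &
  forall y, cabs (y - z) < r -> (f y - f w) * (y - w)^-1 = dquot f w d y.
Proof.
move=> zw; exists (cabs (z - w)); first by rewrite cabs_gt0 subr_eq0.
move=> y yz; rewrite dquot_neq //; apply: contraTneq yz => ->.
by rewrite cabsB ltxx.
Qed.

Lemma dquot_cderiv f w d z : z != w -> (exists b, cderiv f z b) ->
  exists b, cderiv (dquot f w d) z b.
Proof.
move=> zw [b fb]; exists ((f z - f w) * (- 1 / (z - w) ^+ 2) + (b - 0) * (z - w)^-1).
apply: cderiv_eq_near (dquot_near _ _ zw) _.
apply: cderivM; last exact: cderiv_inv.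
by apply: cderivB => //; exact: cderiv_cst.
Qed.

Lemma dquot_ccont f w d z : cderiv f w d -> ccont f z -> ccont (dquot f w d) z.
Proof.
move=> fd fc; have [->|zw] := eqVneq z w.
  move=> e e0; have [r r0 Hr] := fd _ (divr_gt0 e0 (ltr0Sn _ 1)).
  exists r => // y yw; rewrite {2}/dquot eqxx.
  have [->|ynw] := eqVneq y w; first by rewrite /dquot eqxx subrr cabs0.
  have yw0 : 0 < cabs (y - w) by rewrite cabs_gt0 subr_eq0.
  rewrite dquot_neq // -(ltr_pM2r yw0) -cabsM mulrBl divfK ?subr_eq0 //.
  have := Hr _ yw; rewrite subrKC (mulrC d) => H; apply: le_lt_trans H _.
  by rewrite ltr_pM2r // gtr_pMr // invf_lt1 // ltr1n.
apply: ccont_eq_near (dquot_near _ _ zw) _.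
apply: ccontM; last exact: cderiv_ccont (cderiv_inv zw).
by apply: ccontD => // e e0; exists 1 => // y _; rewrite subrr cabs0.
Qed.

Definition holoff S f x1 x2 y1 y2 := rcont f x1 x2 y1 y2 /\ rderiv_off S f x1 x2 y1 y2.

(** The filled-in difference quotient is continuous, and differentiable off w :: S, so its integral
    vanishes; splitting it gives the formula, with the winding integral left unevaluated. *)
Lemma Cauchy_formula S f x1 x2 y1 y2 w :
  x1 < complex.Re w < x2 -> y1 < complex.Im w < y2 -> w \notin S ->
  holoff S f x1 x2 y1 y2 ->
  oint (fun z => f z * (z - w)^-1) x1 x2 y1 y2 =
  f w * oint (fun z => (z - w)^-1) x1 x2 y1 y2.
Proof.
move=> xw yw wS [fc fd]; have /andP[a b] := xw; have /andP[c d] := yw.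
have xx := ltW (lt_trans a b); have yy := ltW (lt_trans c d).
have win : inrect x1 x2 y1 y2 w by rewrite /inrect !ltW.
have [fw Hfw] := fd _ win wS.
have kc : bcont (fun z => (z - w)^-1) x1 x2 y1 y2.
  by move=> z /(rbdry_neq xw yw) zw; apply: cderiv_ccont (cderiv_inv zw).
have G0 : oint (dquot f w fw) x1 x2 y1 y2 = 0.
  apply: (@Goursat_off _ (w :: S)) => // z zin; first exact: dquot_ccont (fc _ zin).
  by rewrite inE negb_or => /andP[zw zS]; apply: dquot_cderiv => //; exact: fd.
have : oint (fun z => f z * (z - w)^-1 + (- f w) * (z - w)^-1) x1 x2 y1 y2 = 0.
  rewrite -G0; apply: eq_oint => // z /(rbdry_neq xw yw) zw.
  by rewrite dquot_neq // mulrBl mulNr.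
rewrite ointD ?ointZ // => [/eqP|z zb|z zb].
- by rewrite mulNr subr_eq0 => /eqP.
- by apply: ccontM; [exact: rcont_bcont zb|exact: kc].
- by apply: ccontM; [move=> e e0; exists 1 => // y _; rewrite subrr cabs0|exact: kc].
Qed.

(* Removes the constant from the bounds given by Cauchy's formula. *)
Lemma exprn_le_bound (x M C : R) : 0 <= x -> 0 < M ->
  (forall n, x ^+ n <= C * M ^+ n) -> x <= M.
Proof.
move=> x0 M0 H; rewrite leNgt; apply/negP => Mx.
pose t := x / M - 1.
have t0 : 0 < t by rewrite subr_gt0 ltr_pdivlMr // mul1r.
have B n : 1 + t *+ n <= (x / M) ^+ n.
  elim: n => [|n IH]; first by rewrite mulr0n addr0 expr0.
  have tn : 0 <= t *+ n by rewrite mulrn_wge0 // ltW.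
  have E : x / M = 1 + t by rewrite /t; ring.
  rewrite exprS mulrS; rewrite !E in IH *.
  have : (1 + t) * (1 + t *+ n) <= (1 + t) * (1 + t) ^+ n.
    by rewrite ler_pM2l // addr_gt0.
  by have := mulr_ge0 (ltW t0) tn; clear; lra.
have [n Hn] : exists n : nat, C / t < n%:R.
  exists (Num.bound (C / t)); have [s|s] := leP 0 (C / t); first exact: archi_boundP.
  by apply: lt_le_trans s _; rewrite ler0n.
have := H n; rewrite -ler_pdivrMr ?exprn_gt0 // -expr_div_n => {}H.
have := le_trans (B n) H; rewrite ltr_pdivrMr // mulr_natl in Hn.
by move: Hn; clear; lra.
Qed.

Lemma holoffX S f x1 x2 y1 y2 n : holoff S f x1 x2 y1 y2 ->
  holoff S (fun z => f z ^+ n) x1 x2 y1 y2.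
Proof.
move=> [fc fd]; split=> [z zin|z zin zS].
  elim: n => [|n IH]; first by move=> e e0; exists 1 => // y _; rewrite !expr0 subrr cabs0.
  have -> : (fun y => f y ^+ n.+1) = (fun y => f y * f y ^+ n).
    by apply/funext => y; rewrite exprS.
  by apply: ccontM => //; exact: fc.
by have [d Hd] := fd _ zin zS; eexists; exact: cderivX Hd.
Qed.

Lemma maximum_modulus S f x1 x2 y1 y2 w M :
  x1 < complex.Re w < x2 -> y1 < complex.Im w < y2 -> w \notin S ->
  holoff S f x1 x2 y1 y2 -> 0 < M ->
  (forall z, rbdry x1 x2 y1 y2 z -> cabs (f z) <= M) -> cabs (f w) <= M.
Proof.
move=> xw yw wS fh M0 fM; have /andP[a b] := xw; have /andP[c d] := yw.
have xx := ltW (lt_trans a b); have yy := ltW (lt_trans c d).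
pose k z := (z - w)^-1.
have kc : bcont k x1 x2 y1 y2.
  by move=> z /(rbdry_neq xw yw) zw; apply: cderiv_ccont (cderiv_inv zw).
have K0 : 0 < cabs (oint k x1 x2 y1 y2) by rewrite cabs_gt0 winding_neq0.
have [e e0 [xe ye]] : exists2 e, 0 < e & (x1 + e <= complex.Re w <= x2 - e) /\
    (y1 + e <= complex.Im w <= y2 - e).
  exists (Num.min (Num.min (complex.Re w - x1) (x2 - complex.Re w))
                  (Num.min (complex.Im w - y1) (y2 - complex.Im w))).
    by rewrite !lt_min !subr_gt0 a b c d.
  set m := Num.min _ _.
  have m1 : m <= complex.Re w - x1 by rewrite /m !ge_min lexx.
  have m2 : m <= x2 - complex.Re w by rewrite /m !ge_min lexx !orbT.
  have m3 : m <= complex.Im w - y1 by rewrite /m !ge_min lexx !orbT.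
  have m4 : m <= y2 - complex.Im w by rewrite /m !ge_min lexx !orbT.
  by move: m1 m2 m3 m4; clear; move=> *; split; apply/andP; split; lra.
(* Made of the perimeter, the distance to the boundary and the winding integral: [C] depends neither
   on [f] nor on the power n. *)
pose C := 4 * e^-1 * ((x2 - x1) + (y2 - y1)) / cabs (oint k x1 x2 y1 y2).
apply: (@exprn_le_bound _ _ C) => //; first exact: cabs_ge0.
move=> n; have fnh := holoffX n fh.
have := Cauchy_formula xw yw wS fnh => /(congr1 (@cabs R)); rewrite cabsM -/k cabsX => E.
rewrite -(ler_pM2r K0) -E.
have -> : C * M ^+ n * cabs (oint k x1 x2 y1 y2) =
   4 * (M ^+ n * e^-1) * ((x2 - x1) + (y2 - y1)).
  by rewrite /C; field; rewrite !gt_eqF.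
apply: oint_bound => // z zb.
  by apply: ccontM; [apply: rcont_bcont zb; case: fnh|exact: kc].
rewrite cabsM cabsX cabsV; apply: ler_pM; rewrite ?exprn_ge0 ?invr_ge0 ?cabs_ge0 //.
  by apply: lerXn2r; rewrite ?nnegrE ?cabs_ge0 ?fM // ltW.
rewrite lef_pV2 ?posrE //; first exact: rbdry_dist zb.
by rewrite cabs_gt0 subr_eq0; exact: rbdry_neq zb.
Qed.

End MaximumModulus.

(** * Cauchy estimates *)

Section CauchyEstimates.
Variable R : realType.
Implicit Types (f g : R[i] -> R[i]) (c z w h d : R[i]) (r L M : R).

Definition holo_ball f c r := forall z, cabs (z - c) < r -> exists d, cderiv f z d.

(** Contours are squares while domains are balls: the square of half-side L lies in the ball of
    radius 2 L and contains that of radius L. The cruder 2 replaces the square root of 2. *)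
Lemma square_ball c L z :
  inrect (complex.Re c - L) (complex.Re c + L) (complex.Im c - L) (complex.Im c + L) z ->
  cabs (z - c) <= 2 * L.
Proof.
move=> /andP[/andP[a b] /andP[e f]]; apply: le_trans (cabs_le_ReIm _) _.
rewrite !raddfB /= mulr_natl mulr2n; apply: lerD; rewrite ler_norml; apply/andP;
  by move: a b e f; clear; move=> ? ? ? ?; split; lra.
Qed.

Lemma in_square c L z : cabs (z - c) < L ->
  complex.Re c - L < complex.Re z < complex.Re c + L /\
  complex.Im c - L < complex.Im z < complex.Im c + L.
Proof.
move=> zc; have := le_lt_trans (Re_le_cabs _) zc; have := le_lt_trans (Im_le_cabs _) zc.
rewrite !raddfB /= !ltr_norml => /andP[? ?] /andP[? ?].
by split; apply/andP; split; lra.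
Qed.

Lemma square_bdry_dist c L z w e : cabs (w - c) <= L - e ->
  rbdry (complex.Re c - L) (complex.Re c + L) (complex.Im c - L) (complex.Im c + L) z ->
  e <= cabs (z - w).
Proof.
move=> wc; apply: rbdry_dist; have := le_trans (Re_le_cabs _) wc;
  have := le_trans (Im_le_cabs _) wc; rewrite !raddfB /= !ler_norml => /andP[? ?] /andP[? ?];
  by apply/andP; split; lra.
Qed.

Lemma bcont_bounded f (x1 x2 y1 y2 : R) : x1 <= x2 -> y1 <= y2 ->
  bcont f x1 x2 y1 y2 ->
  exists2 M, 0 < M & forall z, rbdry x1 x2 y1 y2 z -> cabs (f z) <= M.
Proof.
move=> xx yy /(bcont_seg xx yy) [f1 f2 f3 f4].
have [M1 M10 H1] := segcont_bounded xx f1; have [M2 M20 H2] := segcont_bounded xx f2.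
have [M3 M30 H3] := segcont_bounded yy f3; have [M4 M40 H4] := segcont_bounded yy f4.
exists (M1 + M2 + M3 + M4) => [|[x y]]; first by rewrite !addr_gt0.
move=> /andP[/andP[/= xb yb]] /or4P[] /eqP E; subst.
- by have := H3 _ yb; move: M10 M20 M40; clear; lra.
- by have := H4 _ yb; move: M10 M20 M30; clear; lra.
- by have := H1 _ xb; move: M20 M30 M40; clear; lra.
- by have := H2 _ xb; move: M10 M30 M40; clear; lra.
Qed.

(** [maximum_modulus] is silent at exceptional points; continuity carries the bound over to them. *)
Lemma ccont_le f c M r : 0 < r -> ccont f c ->
  (forall z, z != c -> cabs (z - c) < r -> cabs (f z) <= M) -> cabs (f c) <= M.
Proof.
move=> r0 fc H; rewrite leNgt; apply/negP => Mf.
have [|s s0 Hs] := fc (cabs (f c) - M); first by rewrite subr_gt0.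
pose t := Num.min r s / 2.
have m0 : 0 < Num.min r s by rewrite lt_min r0.
have t0 : 0 < t by rewrite divr_gt0.
have tm : t < Num.min r s by rewrite /t gtr_pMr // invf_lt1 // ltr1n.
have E : cabs (c + t%:C - c) = t by rewrite addrC addKr cabs_real gtr0_norm.
have tc : c + t%:C != c by rewrite -subr_eq0 -cabs_eq0 E gt_eqF.
rewrite lt_min in tm; have /andP[tr ts] := tm.
have := H _ tc; rewrite E => /(_ tr).
have := Hs (c + t%:C); rewrite E => /(_ ts).
have := cabsD (f c - f (c + t%:C)) (f (c + t%:C)); rewrite subrK cabsB.
by clear; lra.
Qed.

(** The maximum principle for f z / (z - c)^n on a square of half-side L > |w - c| gives |f w| (L /
    |w - c|)^n <= M for all n, which forces f w = 0 as the base exceeds 1. The radius r / 2 does not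
    depend on the constants of flatness. *)
Lemma flat_zero f c r :
  holo_ball f c r ->
  (forall n, exists C, exists2 s, 0 < s & forall z, cabs (z - c) < s ->
     cabs (f z) <= C * cabs (z - c) ^+ n) ->
  forall z, cabs (z - c) < r / 2 -> f z = 0.
Proof.
move=> fh fl w wr.
have fc0 : f c = 0.
  have [C [s s0 /(_ c)]] := fl 1%N; rewrite subrr cabs0 expr1 mulr0 => /(_ s0).
  by rewrite le_eqVlt ltNge cabs_ge0 orbF cabs_eq0 => /eqP.
have [->//|wc] := eqVneq w c.
(* Midway between |w - c| and r / 2: [w] is inside the square, and the square inside the ball where
   [f] is holomorphic. *)
pose L := (cabs (w - c) + r / 2) / 2.
have wL : cabs (w - c) < L by rewrite /L; move: wr; clear; lra.
have Lr : 2 * L < r by rewrite /L; move: wr; clear; lra.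
have L0 : 0 < L by apply: le_lt_trans wL; exact: cabs_ge0.
have wc0 : 0 < cabs (w - c) by rewrite cabs_gt0 subr_eq0.
have fd z : inrect (complex.Re c - L) (complex.Re c + L) (complex.Im c - L)
    (complex.Im c + L) z -> exists d, cderiv f z d.
  by move=> /square_ball zL; apply: fh; exact: le_lt_trans zL Lr.
have xx : complex.Re c - L <= complex.Re c + L by move: L0; clear; lra.
have yy : complex.Im c - L <= complex.Im c + L by move: L0; clear; lra.
have [M M0 HM] : exists2 M, 0 < M & forall z,
   rbdry (complex.Re c - L) (complex.Re c + L) (complex.Im c - L) (complex.Im c + L) z ->
   cabs (f z) <= M.
  by apply: bcont_bounded => // z /andP[/fd [d /cderiv_ccont]].
have [xw yw] := in_square wL.
have main n : cabs (f w) * (L / cabs (w - c)) ^+ n <= M.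
  case: n => [|n].
    rewrite expr0 mulr1; apply: (@maximum_modulus _ [::]) xw yw _ _ M0 HM => //.
    by split=> z /fd [d]; [exact: cderiv_ccont|move=> Hd _; exists d].
  pose g z := f z * ((z - c) ^+ n.+1)^-1.
  have gd z : z != c -> (exists d, cderiv f z d) -> exists d, cderiv g z d.
    move=> zc [d Hd]; eexists; apply: cderivM; first exact: Hd.
    apply: cderivV; first by rewrite expf_neq0 // subr_eq0.
    by apply: cderivX; apply: cderivB; [exact: cderiv_id|exact: cderiv_cst].
  have gc : ccont g c.
    (* One order more than the exponent in [g]: then g z = O(|z - c|), which is continuity at [c]
       with value 0. *)
    have [C [s s0 Hs]] := fl n.+2 => e e0.
    exists (Num.min s (e / (1 + `|C|))); first by rewrite lt_min s0 divr_gt0 // ltr_pwDl.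
    move=> y; rewrite lt_min => /andP[ys].
    rewrite {2}/g fc0 mul0r subr0 ltr_pdivlMr ?ltr_pwDl // => yC.
    have [->|yc] := eqVneq y c; first by rewrite /g fc0 mul0r cabs0.
    have yc0 : 0 < cabs (y - c) by rewrite cabs_gt0 subr_eq0.
    rewrite /g cabsM cabsV cabsX; apply: le_lt_trans yC.
    rewrite ler_pdivrMr ?exprn_gt0 // mulrAC -exprS.
    apply: le_trans (Hs _ ys) _; rewrite mulrC ler_pM2l ?exprn_gt0 //.
    by have := ler_norm C; clear; lra.
  have gM z : rbdry (complex.Re c - L) (complex.Re c + L) (complex.Im c - L) (complex.Im c + L) z ->
      cabs (g z) <= M / L ^+ n.+1.
    move=> zb; rewrite /g cabsM cabsV cabsX.
    have zL : L <= cabs (z - c) by apply: square_bdry_dist zb; rewrite subrr cabs0 subrr.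
    apply: ler_pM; rewrite ?invr_ge0 ?exprn_ge0 ?cabs_ge0 ?HM //.
    rewrite lef_pV2 ?posrE ?exprn_gt0 ?(lt_le_trans L0 zL) //.
    by apply: lerXn2r; rewrite ?nnegrE ?cabs_ge0 // ltW.
  have : cabs (g w) <= M / L ^+ n.+1.
    apply: (@maximum_modulus _ [:: c]) xw yw _ _ _ gM.
    - by rewrite inE.
    - split=> z /fd zd.
        have [->//|zc] := eqVneq z c.
        by have [d /cderiv_ccont] := gd z zc zd.
      by rewrite inE => zc; exact: gd.
    - by rewrite divr_gt0 // exprn_gt0.
  rewrite /g cabsM cabsV cabsX (expr_div_n L) ler_pdivlMr ?exprn_gt0 //.
  by rewrite mulrAC mulrA.
apply/eqP; rewrite -cabs_eq0 eq_le cabs_ge0 andbT leNgt; apply/negP => f0.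
have : L / cabs (w - c) <= 1.
  apply: (@exprn_le_bound _ _ _ (M / cabs (f w))) => // [|n].
    by rewrite divr_ge0 // ltW.
  by rewrite expr1n mulr1 ler_pdivlMr // mulrC.
by rewrite ler_pdivrMr // mul1r leNgt wL.
Qed.

Definition sqbdry c L z := rbdry (complex.Re c - L) (complex.Re c + L)
  (complex.Im c - L) (complex.Im c + L) z.

Definition sqin c L z := inrect (complex.Re c - L) (complex.Re c + L)
  (complex.Im c - L) (complex.Im c + L) z.

Definition sqholo S f c L := holoff S f (complex.Re c - L) (complex.Re c + L)
  (complex.Im c - L) (complex.Im c + L).

(** On the boundary the numerator is at most 2 M and the denominator at least L; the maximum
    principle takes the bound inside, except to [c] itself, which is exceptional. *)
Lemma dquot_square f c r L M d : 0 < L -> 2 * L < r -> holo_ball f c r -> 0 < M ->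
  (forall z, cabs (z - c) < r -> cabs (f z) <= M) -> cderiv f c d ->
  [/\ sqholo [:: c] (dquot f c d) c L,
      forall z, sqbdry c L z -> cabs (dquot f c d z) <= 2 * M / L &
      forall z, z != c -> cabs (z - c) < L -> cabs (dquot f c d z) <= 2 * M / L].
Proof.
move=> L0 Lr fh M0 fM fd.
have inball z : sqin c L z -> cabs (z - c) < r.
  by move=> /square_ball zL; exact: le_lt_trans zL Lr.
have qh : sqholo [:: c] (dquot f c d) c L.
  split=> z /inball zr; have [b fb] := fh z zr.
    by apply: dquot_ccont => //; exact: cderiv_ccont fb.
  by rewrite inE => zc; apply: dquot_cderiv => //; exists b.
have qM z : sqbdry c L z -> cabs (dquot f c d z) <= 2 * M / L.
  move=> zb; have zL : L <= cabs (z - c) by apply: square_bdry_dist zb; rewrite subrr cabs0 subrr.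
  have zc : z != c by rewrite -subr_eq0 -cabs_gt0; exact: lt_le_trans L0 zL.
  rewrite dquot_neq // cabsM cabsV.
  apply: ler_pM; rewrite ?invr_ge0 ?cabs_ge0 //; last by rewrite lef_pV2 ?posrE // (lt_le_trans L0).
  have /andP[/inball zr _] := zb.
  have r0 : 0 < r by apply: le_lt_trans Lr; rewrite mulr_ge0 // ltW.
  have := fM z zr; have := fM c; rewrite subrr cabs0 => /(_ r0).
  by have := cabsD (f z) (- f c); rewrite cabsN; clear; lra.
have B0 : 0 < 2 * M / L by rewrite divr_gt0 // mulr_gt0.
split => // z zc /in_square[xz yz].
by apply: (maximum_modulus xz yz _ qh B0 qM); rewrite inE.
Qed.

(** The derivative is the value at [c] of the filled-in difference quotient; L = r / 4 turns 2 M / L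
    into 8 M / r. *)
Lemma Cauchy_derivative_bound f c r M d : 0 < r -> holo_ball f c r -> 0 < M ->
  (forall z, cabs (z - c) < r -> cabs (f z) <= M) -> cderiv f c d ->
  cabs d <= 8 * M / r.
Proof.
move=> r0 fh M0 fM fd; pose L := r / 4.
have L0 : 0 < L by rewrite divr_gt0.
have Lr : 2 * L < r by rewrite /L; lra.
have [_ _ q_le] := dquot_square L0 Lr fh M0 fM fd.
have -> : 8 * M / r = 2 * M / L by rewrite /L; field; rewrite gt_eqF.
have -> : d = dquot f c d c by rewrite /dquot eqxx.
apply: ccont_le L0 _ q_le.
by apply: dquot_ccont => //; exact: cderiv_ccont fd.
Qed.

(** The second difference quotient [p], that of q = [dquot f c d] based at w = c + h, satisfies p c
    = (q w - d) / h, so the Taylor remainder is h^2 times p c. As |h| < L / 2 keeps [w] at distance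
    L / 2 from the boundary, p is bounded there by 2 (2 M / L) / (L / 2) = 128 M / r^2 for L = r /
    4. *)
Lemma Cauchy_taylor_bound f c r M d h : 0 < r -> holo_ball f c r -> 0 < M ->
  (forall z, cabs (z - c) < r -> cabs (f z) <= M) -> cderiv f c d ->
  cabs h < r / 8 ->
  cabs (f (c + h) - f c - h * d) <= 128 * M / r ^+ 2 * cabs h ^+ 2.
Proof.
move=> r0 fh M0 fM fd hr; pose L := r / 4.
have L0 : 0 < L by rewrite divr_gt0.
have Lr : 2 * L < r by rewrite /L; move: r0; clear; lra.
have [qh qM q_le] := dquot_square L0 Lr fh M0 fM fd.
set q := dquot f c d in qh qM q_le.
have [->|h0] := eqVneq h 0.
  by rewrite addr0 subrr mul0r subrr cabs0 expr0n mulr0.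
have h0' : 0 < cabs h by rewrite cabs_gt0.
pose w := c + h.
have wcE : w - c = h by rewrite /w addrC addKr.
have wc : w != c by rewrite -subr_eq0 wcE.
have wr : cabs (w - c) < r by rewrite wcE; move: hr r0; clear; lra.
have [b fb] := fh _ wr.
have [b' qb'] : exists b', cderiv q w b' by apply: dquot_cderiv => //; exists b.
have B20 : 0 < 128 * M / r ^+ 2 by rewrite divr_gt0 ?exprn_gt0 // mulr_gt0.
pose p := dquot q w b'.
have ph : sqholo [:: c; w] p c L.
  have [q1 q2] := qh; split=> z zin; first by apply: dquot_ccont => //; exact: q1.
  by rewrite !inE negb_or => /andP[zc zw]; apply: dquot_cderiv => //; apply: q2; rewrite ?inE.
have qw : cabs (q w) <= 2 * M / L.
  by apply: q_le => //; rewrite wcE /L; move: hr r0; clear; lra.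
have pM z : sqbdry c L z -> cabs (p z) <= 128 * M / r ^+ 2.
  move=> zb.
  have zL : L / 2 <= cabs (z - w).
    by apply: square_bdry_dist zb; rewrite wcE /L; move: hr r0; clear; lra.
  have L20 : 0 < L / 2 by rewrite divr_gt0.
  have zw : z != w by rewrite -subr_eq0 -cabs_gt0; exact: lt_le_trans L20 zL.
  rewrite /p dquot_neq // cabsM cabsV.
  have -> : 128 * M / r ^+ 2 = (2 * (2 * M / L)) * (L / 2)^-1.
    by rewrite /L; field; rewrite gt_eqF.
  apply: ler_pM; rewrite ?invr_ge0 ?cabs_ge0 //; last by rewrite lef_pV2 ?posrE // (lt_le_trans L20).
  by have := cabsD (q z) (- q w); have := qM _ zb; rewrite cabsN; move: qw; clear; lra.
have : cabs (p c) <= 128 * M / r ^+ 2.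
  apply: (@ccont_le _ _ _ (Num.min L (cabs h))); first by rewrite lt_min L0.
    apply: dquot_ccont => //; have [q1 _] := qh; apply: q1.
    by rewrite /inrect; move: L0; clear; move=> ?; apply/andP; split; apply/andP; split; lra.
  move=> z zc; rewrite lt_min => /andP[zL zh].
  have [xz yz] := in_square zL.
  apply: (maximum_modulus xz yz _ ph B20 pM); rewrite !inE negb_or zc /=.
  by apply: contraTneq zh => ->; rewrite wcE ltxx.
rewrite /p dquot_neq 1?eq_sym // cabsM cabsV.
have -> : q c = d by rewrite /q /dquot eqxx.
rewrite /q dquot_neq // (cabsB c) wcE ler_pdivrMr // => H.
have -> : f (c + h) - f c - h * d = - ((d - (f w - f c) / h) * h).
  by rewrite mulrBl divfK // -/w; ring.
by rewrite cabsN cabsM expr2 mulrA ler_pM2r.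
Qed.

End CauchyEstimates.

(** * Mixed partial derivatives *)

Section MixedDerivatives.
Variable R : realType.

Lemma cderiv_ext (f g : R[i] -> R[i]) x d : f =1 g -> cderiv f x d -> cderiv g x d.
Proof. by move=> /funext ->. Qed.

(** The limit is the supremum of the lower bounds phi h - K |h|, each of which lies below every phi
    k + K |k|. The rate is kept because [mixed_derivative] reads the derivative off from it. *)
Lemma real_limit (phi : R[i] -> R) (K r : R) : 0 < r ->
  (forall h k, h != 0 -> k != 0 -> cabs h < r -> cabs k < r ->
     `|phi h - phi k| <= K * (cabs h + cabs k)) ->
  exists b, forall h, h != 0 -> cabs h < r -> `|phi h - b| <= K * cabs h.
Proof.
move=> r0 H.
pose E := [set phi h - K * cabs h | h in [set h | h != 0 /\ cabs h < r]].
have ub k : k != 0 -> cabs k < r -> ubound E (phi k + K * cabs k).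
  move=> k0 kr _ [h [h0 hr] <-]; have := H _ _ h0 k0 hr kr.
  by rewrite ler_norml => /andP[_]; clear; lra.
have r2 : cabs (r / 2)%:C < r.
  by rewrite cabs_real gtr0_norm ?divr_gt0 // gtr_pMr // invf_lt1 // ltr1n.
have r20 : (r / 2)%:C != 0.
  by rewrite -cabs_eq0 cabs_real normr_eq0 mulf_neq0 // ?invr_neq0 // gt_eqF.
have E0 : E !=set0 by exists (phi (r / 2)%:C - K * cabs (r / 2)%:C); exists (r / 2)%:C.
have Es : has_sup E by split=> //; exists (phi (r / 2)%:C + K * cabs (r / 2)%:C); exact: ub.
exists (sup E) => h h0 hr; rewrite ler_norml.
have H1 : phi h - K * cabs h <= sup E by apply: sup_upper_bound => //; exists h.
have H2 : sup E <= phi h + K * cabs h by apply: ge_sup => //; exact: ub.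
by move: H1 H2; clear; move=> *; apply/andP; split; lra.
Qed.

Lemma complex_limit (phi : R[i] -> R[i]) (K r : R) : 0 < r ->
  (forall h k, h != 0 -> k != 0 -> cabs h < r -> cabs k < r ->
     cabs (phi h - phi k) <= K * (cabs h + cabs k)) ->
  exists b, forall h, h != 0 -> cabs h < r -> cabs (phi h - b) <= 2 * K * cabs h.
Proof.
move=> r0 H.
have [|a Ha] := @real_limit (fun h => complex.Re (phi h)) K r r0.
  by move=> h k h0 k0 hr kr; apply: le_trans (Re_lip _ _) _; exact: H.
have [|b Hb] := @real_limit (fun h => complex.Im (phi h)) K r r0.
  by move=> h k h0 k0 hr kr; apply: le_trans (Im_lip _ _) _; exact: H.
exists (a +i* b) => h h0 hr; apply: le_trans (cabs_le_ReIm _) _.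
have := Ha _ h0 hr; have := Hb _ h0 hr.
by case: (phi h) => x y /=; clear; lra.
Qed.

(* The difference quotients of w in its first variable are uniformly Cauchy by
   the second order Taylor bound, hence so are their derivatives in the second
   variable. *)
Lemma mixed_derivative (w : R[i] -> R[i] -> R[i]) (d : R[i] -> R[i]) (r M : R) :
  0 < r -> 0 < M ->
  (forall y, cabs y < r -> holo_ball (w^~ y) 0 r) ->
  (forall x, cabs x < r -> holo_ball (w x) 0 r) ->
  (forall x y, cabs x < r -> cabs y < r -> cabs (w x y) <= M) ->
  (forall x, cabs x < r -> cderiv (w x) 0 (d x)) ->
  exists b, cderiv d 0 b.
Proof.
move=> r0 M0 w1 w2 wM wd.
have c00 : cabs (0 : R[i]) < r by rewrite cabs0.
pose K := 128 * M / r ^+ 2.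
have K0 : 0 < K by rewrite divr_gt0 ?exprn_gt0 // mulr_gt0.
have r80 : 0 < r / 8 by rewrite divr_gt0.
have r8r : r / 8 < r by rewrite gtr_pMr // invf_lt1 // ltr1n.
pose Q h y := (w h y - w 0 y) / h.
have QQ h k y : h != 0 -> k != 0 -> cabs h < r / 8 -> cabs k < r / 8 -> cabs y < r ->
    cabs (Q h y - Q k y) <= K * (cabs h + cabs k).
  move=> h0 k0 hr kr yr.
  have [a Ha] : exists a, cderiv (w^~ y) 0 a by apply: (w1 _ yr); rewrite subr0.
  have T l : l != 0 -> cabs l < r / 8 -> cabs (Q l y - a) <= K * cabs l.
    move=> l0 lr.
    have wb z : cabs (z - 0) < r -> cabs (w z y) <= M by rewrite subr0 => zr; exact: wM.
    have := Cauchy_taylor_bound r0 (w1 _ yr) M0 wb Ha lr; rewrite add0r => H.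
    have l0' : 0 < cabs l by rewrite cabs_gt0.
    by rewrite -(ler_pM2r l0') -mulrA -expr2 -cabsM /Q mulrBl divfK // (mulrC a).
  have := T _ h0 hr; have := T _ k0 kr; have := cabsD (Q h y - a) (a - Q k y).
  by rewrite addrA subrK (cabsB a); clear; lra.
pose phi h := (d h - d 0) / h.
have [h k h0 k0 hr kr|b Hb] := @complex_limit phi (8 * K / r) (r / 8) r80.
  have hr' := lt_trans hr r8r; have kr' := lt_trans kr r8r.
  have Qd l : l != 0 -> cabs l < r -> cderiv (Q l) 0 (phi l).
    move=> l0 lr; have D := cderivMl l^-1 (cderivB (wd _ lr) (wd _ c00)).
    by rewrite mulrC in D; apply: cderiv_ext D => y; rewrite /Q mulrC.
  pose S := K * (cabs h + cabs k).
  have S0 : 0 < S by rewrite mulr_gt0 // addr_gt0 // cabs_gt0.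
  have := @Cauchy_derivative_bound _ (fun y => Q h y - Q k y) 0 r S (phi h - phi k) r0.
  move=> H; have {H} : cabs (phi h - phi k) <= 8 * S / r.
    apply: H => //.
    - move=> y yr.
      have [u Hu] := w2 _ hr' y yr; have [v Hv] := w2 _ kr' y yr.
      have [x Hx] := w2 _ c00 y yr.
      have B l u' : cderiv (w l) y u' -> exists q, cderiv (Q l) y q.
        move=> Hu'; exists (l^-1 * (u' - x)).
        by apply: cderiv_ext (cderivMl l^-1 (cderivB Hu' Hx)) => y'; rewrite /Q mulrC.
      have [q1 Hq1] := B _ _ Hu; have [q2 Hq2] := B _ _ Hv.
      by exists (q1 - q2); exact: cderivB.
    - by move=> y; rewrite subr0 => yr; exact: QQ.
    - by apply: cderivB; exact: Qd.
  have -> : 8 * K / r * (cabs h + cabs k) = 8 * S / r by rewrite /S; field; rewrite gt_eqF.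
  by [].
exists b => e e0; pose K' := 2 * (8 * K / r).
have K'0 : 0 < K' by rewrite mulr_gt0 // divr_gt0 // mulr_gt0.
exists (Num.min (r / 8) (e / K')) => [|h]; first by rewrite lt_min r80 divr_gt0.
rewrite lt_min (ltr_pdivlMr _ _ K'0) => /andP[hr he].
have [->|h0] := eqVneq h 0; first by rewrite addr0 subrr mul0r subrr cabs0 mulr0.
have h0' : 0 < cabs h by rewrite cabs_gt0.
have -> : d (0 + h) - d 0 - h * b = (phi h - b) * h.
  by rewrite add0r mulrBl divfK // (mulrC b).
rewrite cabsM ler_pM2r //; apply: le_trans (Hb _ h0 hr) _.
by rewrite -/K' mulrC ltW.
Qed.

(** * Partial derivatives as derivatives along coordinate lines *)

Section PartialDerivatives.
Variables (n : nat).
Implicit Types (g : 'rV[R[i]]_n -> R[i]) (z v : 'rV[R[i]]_n).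

Definition vabs z : R := complex.Re `|z|.

Lemma vabsE z : `|z| = (vabs z)%:C.
Proof. by rewrite /vabs RRe_real // ger0_real. Qed.

Lemma vabsD z v : vabs (z + v) <= vabs z + vabs v.
Proof. by rewrite -lecR rmorphD /= -!vabsE ler_normD. Qed.

Lemma vabsZ (s : R[i]) z : vabs (s *: z) = cabs s * vabs z.
Proof. by apply: complexI; rewrite rmorphM /= -cabsE -!vabsE normrZ. Qed.

Lemma vabs_delta i : vabs (delta_mx 0 i) <= 1.
Proof.
rewrite -lecR -vabsE rmorph1; set e := delta_mx 0 i.
rewrite -[`|e|]/(mx_norm e).
have [->|/mx_norm_neq0 [[j k] ->]] := eqVneq (mx_norm e) 0; first exact: ler01.
by rewrite /e /= mxE; case: (_ && _); rewrite ?normr1 ?normr0 // ler01.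
Qed.

Lemma nbhs_vabsP z (A : set 'rV[R[i]]_n) :
  nbhs z A <-> exists2 e : R, 0 < e & forall y, vabs (y - z) < e -> A y.
Proof.
split.
  move=> /nbhs_ballP [e /= /real_gt0P [r r0 ->] xA]; exists r => // y xy.
  by apply: xA; rewrite -ball_normE /= distrC vabsE ltcR.
move=> [e e0 xA]; apply/nbhs_ballP; exists e%:C => /=; first by rewrite ltcR.
by move=> y; rewrite -ball_normE /= distrC vabsE ltcR => /xA.
Qed.

(** The Cauchy estimates reach partial derivatives through this reduction to one complex
    variable. *)
Lemma derive_line g z v d :
  is_derive z v g d <-> cderiv (fun s : R[i] => g (z + s *: v)) 0 d.
Proof.
have E : (fun s : R[i] => g (z + s *: v)) = (fun s => g (s *: v + z)).
  by apply/funext => s; rewrite addrC.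
have D : 'D_v g z = 'D_1 (fun s : R[i] => g (s *: v + z)) 0.
  rewrite /derive; set g1 := fun h => h^-1 *: _; set g2 := fun h => h^-1 *: _.
  suff -> : g1 = g2 by [].
  by apply/funext => h; rewrite /g1 /g2 /= addr0 scale0r add0r [_%:A]mulr1.
rewrite E; split=> [[gd gv]|/is_derive_cderiv [gd gv]].
  by apply/is_derive_cderiv; split; [exact: (proj1 (derivable1P g z v))|rewrite -D].
by split; [exact: (proj2 (derivable1P g z v))|rewrite D].
Qed.

End PartialDerivatives.
End MixedDerivatives.

(** * The star product with a quadratic form *)

Section StarFormula.
Variable R : realType.
Variable hbar : R.

Lemma star_prod_trunc n (L : 'M[R[i]]_n) f g z N :
  (forall s : seq 'I_n, (N <= size s)%N -> pderivs s f z = 0) ->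
  star_prod hbar L f g z = \sum_(k < N) star_term hbar L f g z k.
Proof.
move=> f0; rewrite /star_prod.
apply: cvg_lim; first exact: norm_hausdorff.
have E k : (N <= k)%N -> star_term hbar L f g z k = 0.
  move=> Nk; rewrite /star_term big1 ?mulr0 // => p _; rewrite big1 // => q _.
  by rewrite f0 ?size_tuple // mulr0 mul0r.
apply: cvg_near_cst.
exists N => // k /= Nk; rewrite /series /= -(big_mkord xpredT (star_term hbar L f g z)).
rewrite (big_cat_nat (n := N)) //=.
have -> : \sum_(N <= i < k) star_term hbar L f g z i = 0.
  by rewrite big_nat_cond big1 // => i /andP[/andP[Ni _] _]; exact: E.
by rewrite addr0 big_mkord.
Qed.

Lemma big_tuple0 (T : finType) (F : 0.-tuple T -> R[i]) : \sum_(p : 0.-tuple T) F p = F [tuple].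
Proof.
by rewrite (bigD1 [tuple]) //= big1 ?addr0 // => p /negP[]; rewrite (tuple0 p).
Qed.

Lemma big_tuple1 (T : finType) (F : 1.-tuple T -> R[i]) :
  \sum_(p : 1.-tuple T) F p = \sum_i F [tuple i].
Proof.
rewrite (reindex (fun i : T => [tuple i])) //.
exists (fun p : 1.-tuple T => thead p) => // p _; apply/val_inj => /=.
by case/tupleP: p => x p; rewrite (tuple0 p) theadE.
Qed.

Lemma big_tuple2 (T : finType) (F : 2.-tuple T -> R[i]) :
  \sum_(p : 2.-tuple T) F p = \sum_i \sum_j F [tuple i; j].
Proof.
rewrite pair_bigA /= (reindex (fun q : T * T => [tuple q.1; q.2])) //.
exists (fun p : 2.-tuple T => (tnth p ord0, tnth p ord_max)) => [[x y] _|p _] //.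
apply/val_inj => /=; case: p => -[//|x [//|y [|//]]] i; rewrite /tnth /=; congr [:: _; _];
  exact: set_nth_default.
Qed.

Lemma star_term0 n (L : 'M[R[i]]_n) f g z : star_term hbar L f g z 0 = f z * g z.
Proof. by rewrite /star_term !big_tuple0 big_ord0 /= fact0 invr1 expr0 !mul1r. Qed.

Lemma star_term1 n (L : 'M[R[i]]_n) f g z : star_term hbar L f g z 1 =
  'i * hbar%:C / 2 * \sum_i \sum_j L i j * (pderiv i f z * pderiv j g z).
Proof.
rewrite /star_term big_tuple1 invr1 mul1r expr1; congr (_ * _).
apply: eq_bigr => i _; rewrite big_tuple1; apply: eq_bigr => j _.
by rewrite big_ord1 /= -mulrA.
Qed.

Lemma star_term2 n (L : 'M[R[i]]_n) f g z : star_term hbar L f g z 2 =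
  2^-1 * ('i * hbar%:C / 2) ^+ 2 *
  \sum_i \sum_j \sum_i' \sum_j' L i j * (L i' j' *
   (pderiv i (pderiv i' f) z * pderiv j (pderiv j' g) z)).
Proof.
rewrite /star_term big_tuple2; congr (_ * _).
apply: eq_bigr => i _; rewrite [in RHS]exchange_big; apply: eq_bigr => i' _.
rewrite big_tuple2; apply: eq_bigr => j _; apply: eq_bigr => j' _.
by rewrite !big_ord_recl big_ord0 /= mulr1 !mulrA /tnth.
Qed.

(** K + J has a single nonzero block, 2 I at the lower left: the left factor is differentiated in v
    only and the right one in u only. The 2 cancels the denominator of i hbar / 2. *)
Lemma big_KJ m (F : 'I_(m + m) -> 'I_(m + m) -> R[i]) :
  \sum_i \sum_j (Kmx R m + Jmx R m) i j * F i j =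
  2 * \sum_(k < m) F (rshift m k) (lshift m k).
Proof.
have -> : Kmx R m + Jmx R m = block_mx 0 0 2%:M 0.
  by rewrite /Kmx /Jmx add_block_mx !addr0 subrr -raddfD.
rewrite big_split_ord /= [X in X + _]big1 ?add0r => [|i _]; last first.
  rewrite big_split_ord /= !big1 ?addr0 // => j _.
    by rewrite block_mxEur mxE mul0r.
  by rewrite block_mxEul mxE mul0r.
rewrite mulr_sumr; apply: eq_bigr => i _.
rewrite big_split_ord /= [X in _ + X]big1 ?addr0 => [|j _]; last first.
  by rewrite block_mxEdr mxE mul0r.
rewrite (bigD1 i) //= block_mxEdl mxE eqxx mulr1n big1 ?addr0 // => j ji.
by rewrite block_mxEdl mxE eq_sym (negbTE ji) mulr0n mul0r.
Qed.

Lemma starK_trunc1 m f g z :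
  (forall s : seq 'I_(m + m), (2 <= size s)%N -> pderivs s f z = 0) ->
  starK hbar f g z = f z * g z +
   'i * hbar%:C * \sum_(k < m) pderiv (rshift m k) f z * pderiv (lshift m k) g z.
Proof.
move=> f0; rewrite /starK (star_prod_trunc _ _ f0) !big_ord_recl big_ord0 /= addr0.
rewrite star_term0 /bump /= addn0 star_term1 big_KJ; congr (_ + _).
by rewrite mulrA; congr (_ * _); field.
Qed.

Lemma starK_trunc2 m f g z :
  (forall s : seq 'I_(m + m), (3 <= size s)%N -> pderivs s f z = 0) ->
  starK hbar f g z = f z * g z +
   'i * hbar%:C * \sum_(k < m) pderiv (rshift m k) f z * pderiv (lshift m k) g z +
   ('i * hbar%:C) ^+ 2 / 2 * \sum_(k < m) \sum_(l < m)
     pderiv (rshift m k) (pderiv (rshift m l) f) z *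
     pderiv (lshift m k) (pderiv (lshift m l) g) z.
Proof.
move=> f0; rewrite /starK (star_prod_trunc _ _ f0) !big_ord_recl big_ord0 /= addr0.
rewrite star_term0 /bump /= star_term1 star_term2 big_KJ addrA; congr (_ + _ + _).
  by rewrite mulrA; congr (_ * _); field.
have E : forall H : 'I_(m + m) -> 'I_(m + m) -> 'I_(m + m) -> 'I_(m + m) -> R[i],
  let L := Kmx R m + Jmx R m in
  \sum_i \sum_j \sum_i' \sum_j' L i j * (L i' j' * H i j i' j') =
  2 * \sum_(k < m) (2 * \sum_(l < m) H (rshift m k) (lshift m k) (rshift m l) (lshift m l)).
  move=> H L; rewrite -(big_KJ (fun i j => 2 * \sum_(l < m) H i j (rshift m l) (lshift m l))).
  apply: eq_bigr => i _; apply: eq_bigr => j _; rewrite -big_KJ mulr_sumr.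
  by apply: eq_bigr => i' _; rewrite mulr_sumr.
by rewrite E -mulr_sumr !mulrA; congr (_ * _); field.
Qed.

Lemma cderiv_quadratic (c0 c1 c2 : R[i]) :
  cderiv (fun s => c0 + s * c1 + s ^+ 2 * c2) 0 c1.
Proof.
apply: cderiv_eq; first apply: cderivD; first apply: cderivD.
- exact: cderiv_cst.
- by apply: cderivM; [exact: cderiv_id|exact: cderiv_cst].
- by apply: cderivM; [exact: cderivX (cderiv_id _)|exact: cderiv_cst].
by rewrite expr1; ring.
Qed.

(** The forms differentiated here have degree at most two along coordinate lines, so the derivative
    is read off as the linear coefficient. *)
Lemma pderiv_quadratic n i (f : 'rV[R[i]]_n -> R[i]) z c1 c2 :
  (forall s : R[i], f (z + s *: delta_mx 0 i) = f z + s * c1 + s ^+ 2 * c2) ->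
  pderiv i f z = c1.
Proof.
move=> fE; have : is_derive z (delta_mx 0 i) f c1.
  by apply/derive_line; apply: cderiv_ext (cderiv_quadratic (f z) c1 c2) => s; rewrite fE.
by case.
Qed.

Lemma pderivs_cst n (s : seq 'I_n) (c : R[i]) z : (0 < size s)%N -> pderivs s (fun=> c) z = 0.
Proof.
case: s => // i s _; elim: s i z => [|j s IH] i z /=.
  by apply: (@pderiv_quadratic _ _ _ _ 0 0) => t; rewrite !mulr0 !addr0.
change (pderiv i (pderivs (j :: s) (fun=> c)) z = 0).
have -> : pderivs (j :: s) (fun=> c) = fun=> 0 by apply/funext => y; exact: IH.
by apply: (@pderiv_quadratic _ _ _ _ 0 0) => t; rewrite !mulr0 !addr0.
Qed.

Lemma pderivs_rcons n (s : seq 'I_n) i (f : 'rV[R[i]]_n -> R[i]) :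
  pderivs (rcons s i) f = pderivs s (pderiv i f).
Proof. by rewrite /pderivs -cats1 foldr_cat. Qed.

Section LinearForms.
Variables (m : nat) (a : 'rV[R[i]]_m).
Implicit Types (z v : 'rV[R[i]]_(m + m)) (s : R[i]).

Lemma lin_u_line z s v : lin_u a (z + s *: v) = lin_u a z + s * lin_u a v.
Proof.
rewrite /lin_u /pairing mulr_sumr -big_split /=; apply: eq_bigr => k _.
by rewrite !mxE; ring.
Qed.

Lemma lin_v_line z s v : lin_v a (z + s *: v) = lin_v a z + s * lin_v a v.
Proof.
rewrite /lin_v /pairing mulr_sumr -big_split /=; apply: eq_bigr => k _.
by rewrite !mxE; ring.
Qed.

Lemma pairing_delta k : \sum_l a 0 l * (l == k)%:R = a 0 k.
Proof.
by rewrite (bigD1 k) //= eqxx mulr1 big1 ?addr0 // => l /negbTE ->; rewrite mulr0.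
Qed.

Lemma lin_u_lshift k : lin_u a (delta_mx 0 (lshift m k)) = a 0 k.
Proof.
rewrite -[RHS]pairing_delta; apply: eq_bigr => l _.
by rewrite !mxE eqxx /= eq_lshift.
Qed.

Lemma lin_u_rshift k : lin_u a (delta_mx 0 (rshift m k)) = 0.
Proof.
by rewrite /lin_u /pairing big1 // => l _; rewrite !mxE eqxx /= eq_lrshift mulr0.
Qed.

Lemma lin_v_lshift k : lin_v a (delta_mx 0 (lshift m k)) = 0.
Proof.
by rewrite /lin_v /pairing big1 // => l _; rewrite !mxE eqxx /= eq_rlshift mulr0.
Qed.

Lemma lin_v_rshift k : lin_v a (delta_mx 0 (rshift m k)) = a 0 k.
Proof.
rewrite -[RHS]pairing_delta; apply: eq_bigr => l _.
by rewrite !mxE eqxx /= eq_rshift.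
Qed.

Lemma pderiv_lin (f : 'rV[R[i]]_(m + m) -> R[i]) i :
  (forall z s v, f (z + s *: v) = f z + s * f v) ->
  pderiv i f = fun=> f (delta_mx 0 i).
Proof.
move=> fl; apply/funext => z; apply: (@pderiv_quadratic _ _ _ _ _ 0) => s.
by rewrite fl mulr0 addr0.
Qed.

Lemma pderivs_lin (f : 'rV[R[i]]_(m + m) -> R[i]) (s : seq 'I_(m + m)) z :
  (forall z s v, f (z + s *: v) = f z + s * f v) -> (2 <= size s)%N ->
  pderivs s f z = 0.
Proof.
move=> fl; case/lastP: s => // s i; rewrite size_rcons => s2.
by rewrite pderivs_rcons pderiv_lin // pderivs_cst.
Qed.

Hypothesis a_unit : pairing a a = 1.

Lemma starK_lin (f g : 'rV[R[i]]_(m + m) -> R[i]) z :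
  (forall z s v, f (z + s *: v) = f z + s * f v) ->
  (forall z s v, g (z + s *: v) = g z + s * g v) ->
  starK hbar f g z = f z * g z + 'i * hbar%:C *
    \sum_(k < m) f (delta_mx 0 (rshift m k)) * g (delta_mx 0 (lshift m k)).
Proof.
move=> fl gl; rewrite starK_trunc1 => [|s s2]; last exact: pderivs_lin.
by congr (_ + _ * _); apply: eq_bigr => k _; rewrite !pderiv_lin.
Qed.

(** As the product differentiates its left factor in v and its right one in u, only <a,v> * <a,u>
    has a correction, i hbar <a,a> = i hbar. *)
Lemma BformE alpha beta gamma z : Bform hbar a alpha beta gamma z =
  alpha * lin_u a z ^+ 2 + beta * lin_v a z ^+ 2 +
  gamma * (2 * (lin_u a z * lin_v a z) + 'i * hbar%:C).
Proof.
rewrite /Bform !starK_lin; try exact: lin_u_line; try exact: lin_v_line.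
rewrite [X in alpha * (_ + _ * X)]big1 => [|k _]; last by rewrite lin_u_rshift mul0r.
rewrite [X in beta * (_ + _ * X)]big1 => [|k _]; last by rewrite lin_v_lshift mulr0.
rewrite [X in gamma * ((_ + _ * X) + _)]big1 => [|k _]; last by rewrite lin_u_rshift mul0r.
under eq_bigr do rewrite lin_v_rshift lin_u_lshift.
by rewrite -/(pairing a a) a_unit; ring.
Qed.

Lemma pderiv_Bform alpha beta gamma i z :
  pderiv i (Bform hbar a alpha beta gamma) z =
  2 * alpha * lin_u a z * lin_u a (delta_mx 0 i) +
  2 * beta * lin_v a z * lin_v a (delta_mx 0 i) +
  2 * gamma * (lin_u a z * lin_v a (delta_mx 0 i) + lin_v a z * lin_u a (delta_mx 0 i)).
Proof.
set e := delta_mx 0 i.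
apply: (@pderiv_quadratic _ _ _ _ _ (alpha * lin_u a e ^+ 2 + beta * lin_v a e ^+ 2 +
  2 * gamma * (lin_u a e * lin_v a e))) => s.
by rewrite !BformE lin_u_line lin_v_line -/e; ring.
Qed.

Lemma pderiv2_Bform alpha beta gamma i j z :
  pderiv i (pderiv j (Bform hbar a alpha beta gamma)) z =
  2 * alpha * lin_u a (delta_mx 0 i) * lin_u a (delta_mx 0 j) +
  2 * beta * lin_v a (delta_mx 0 i) * lin_v a (delta_mx 0 j) +
  2 * gamma * (lin_u a (delta_mx 0 i) * lin_v a (delta_mx 0 j) +
               lin_v a (delta_mx 0 i) * lin_u a (delta_mx 0 j)).
Proof.
apply: (@pderiv_quadratic _ _ _ _ _ 0) => s.
by rewrite !pderiv_Bform lin_u_line lin_v_line; ring.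
Qed.

Lemma pderivs_Bform alpha beta gamma (s : seq 'I_(m + m)) z : (3 <= size s)%N ->
  pderivs s (Bform hbar a alpha beta gamma) z = 0.
Proof.
case/lastP: s => // s i; case/lastP: s => // s j; rewrite !size_rcons => s3.
rewrite !pderivs_rcons.
have -> : pderiv j (pderiv i (Bform hbar a alpha beta gamma)) =
  fun=> pderiv j (pderiv i (Bform hbar a alpha beta gamma)) z.
  by apply/funext => y; rewrite !pderiv2_Bform.
exact: pderivs_cst.
Qed.

(** Only v-derivatives of the form enter: a_k (2 beta y + 2 gamma x) at first order, and 2 beta a_k
    a_l at second order, whose 2 cancels the factorial. *)
Lemma starK_Bform alpha beta gamma g z :
  starK hbar (Bform hbar a alpha beta gamma) g z =
  Bform hbar a alpha beta gamma z * g z +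
  'i * hbar%:C * (2 * beta * lin_v a z + 2 * gamma * lin_u a z) *
     \sum_(k < m) a 0 k * pderiv (lshift m k) g z +
  ('i * hbar%:C) ^+ 2 * beta * \sum_(k < m) \sum_(l < m)
     a 0 k * a 0 l * pderiv (lshift m k) (pderiv (lshift m l) g) z.
Proof.
rewrite starK_trunc2 => [|s]; last exact: pderivs_Bform.
congr (_ + _ + _).
  rewrite -[RHS]mulrA; congr (_ * _); rewrite [RHS]mulr_sumr; apply: eq_bigr => k _.
  by rewrite pderiv_Bform lin_u_rshift lin_v_rshift; ring.
rewrite !mulr_sumr; apply: eq_bigr => k _; rewrite !mulr_sumr; apply: eq_bigr => l _.
by rewrite pderiv2_Bform !lin_u_rshift !lin_v_rshift; field.
Qed.

End LinearForms.
End StarFormula.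

(** * First and second derivatives of entire functions *)

Section EntireFunctions.
Variables (R : realType) (n : nat).
Implicit Types (g : 'rV[R[i]]_n -> R[i]) (z v : 'rV[R[i]]_n).

Lemma cderiv_shift (f : R[i] -> R[i]) x d :
  cderiv (fun h => f (x + h)) 0 d <-> cderiv f x d.
Proof.
by split=> H e e0; have [r r0 Hr] := H e e0; exists r => // h /Hr; rewrite add0r addr0.
Qed.

Lemma differentiable_line g z v (s : R[i]) : (forall z, differentiable g z) ->
  cderiv (fun s => g (z + s *: v)) s ('D_v g (z + s *: v)).
Proof.
move=> gd; apply/cderiv_shift.
apply: (@cderiv_ext _ (fun h : R[i] => g (z + s *: v + h *: v))).
  by move=> h; rewrite scalerDl addrA.
by apply/derive_line; split => //; exact: diff_derivable.
Qed.

Lemma differentiable_locally_bounded g z : differentiable g z ->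
  exists2 r : R, 0 < r & forall y, vabs (y - z) < r -> cabs (g y) <= cabs (g z) + 1.
Proof.
move=> /differentiable_continuous gc.
have /gc /nbhs_vabsP [r r0 Hr] : nbhs (g z) [set w | cabs (w - g z) < 1].
  by apply/nbhs_cabsP; exists 1.
exists r => // y /Hr /=; have := cabsD (g y - g z) (g z); rewrite subrK; lra.
Qed.

Lemma vabs_scale_delta (s : R[i]) i : vabs (s *: delta_mx 0 i : 'rV[R[i]]_n) <= cabs s.
Proof. by rewrite vabsZ ler_piMr ?cabs_ge0 // vabs_delta. Qed.

Lemma vabs_line z0 z (s : R[i]) i (r1 r2 : R) : vabs (z - z0) < r1 -> cabs s < r2 ->
  vabs (z + s *: delta_mx 0 i - z0) < r1 + r2.
Proof.
move=> zr sr; rewrite addrAC; apply: le_lt_trans (vabsD _ _) _.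
by apply: ltrD => //; apply: le_lt_trans sr; exact: vabs_scale_delta.
Qed.

Lemma pderiv_bound g z0 (r M : R) i z : (forall z, differentiable g z) ->
  0 < r -> 0 < M -> (forall y, vabs (y - z0) < r -> cabs (g y) <= M) ->
  vabs (z - z0) < r / 2 -> cabs (pderiv i g z) <= 16 * M / r.
Proof.
move=> gd r0 M0 gM zr; have r20 : 0 < r / 2 by rewrite divr_gt0.
have -> : 16 * M / r = 8 * M / (r / 2) by field; rewrite gt_eqF.
apply: (@Cauchy_derivative_bound _ (fun s => g (z + s *: delta_mx 0 i)) 0) => //.
- by move=> s _; eexists; exact: differentiable_line.
- move=> s; rewrite subr0 => sr; apply: gM.
  have -> : r = r / 2 + r / 2 by field.
  exact: vabs_line.
- by have := differentiable_line z (delta_mx 0 i) 0 gd; rewrite scale0r addr0.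
Qed.

(** Without this, [pderiv i (pderiv j g)] might be an arbitrary value, neither additive in g nor
    controlled by it. Local boundedness of g supplies the bound that [mixed_derivative] asks for. *)
Lemma pderiv_line_derivable g z i j : (forall z, differentiable g z) ->
  exists b, cderiv (fun s : R[i] => pderiv j g (z + s *: delta_mx 0 i)) 0 b.
Proof.
move=> gd; have [r r0 Hr] := differentiable_locally_bounded (gd z).
have r20 : 0 < r / 2 by rewrite divr_gt0.
pose w (x y : R[i]) := g (z + x *: delta_mx 0 i + y *: delta_mx 0 j).
apply: (@mixed_derivative _ w _ (r / 2) (cabs (g z) + 1) r20).
- by rewrite ltr_wpDl // cabs_ge0.
- move=> y _ x _; eexists.
  apply: (@cderiv_ext _ (fun x : R[i] => g (z + y *: delta_mx 0 j + x *: delta_mx 0 i))).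
    by move=> x'; rewrite /w addrAC.
  exact: differentiable_line.
- by move=> x _ y _; eexists; exact: differentiable_line.
- move=> x y xr yr; apply: Hr.
  have -> : r = r / 2 + r / 2 by field.
  apply: vabs_line => //; rewrite addrC addKr.
  by apply: le_lt_trans xr; exact: vabs_scale_delta.
- move=> x _; have := differentiable_line (z + x *: delta_mx 0 i) (delta_mx 0 j) 0 gd.
  by rewrite scale0r addr0.
Qed.

Lemma pderiv2_line g z i j (s : R[i]) : (forall z, differentiable g z) ->
  cderiv (fun s : R[i] => pderiv j g (z + s *: delta_mx 0 i)) s
    (pderiv i (pderiv j g) (z + s *: delta_mx 0 i)).
Proof.
move=> gd; apply/cderiv_shift.
apply: (@cderiv_ext _ (fun h : R[i] => pderiv j g (z + s *: delta_mx 0 i + h *: delta_mx 0 i))).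
  by move=> h; rewrite scalerDl addrA.
have [b Hb] := pderiv_line_derivable (z + s *: delta_mx 0 i) i j gd.
apply: cderiv_eq (Hb) _.
by have /derive_line [_ <-] := Hb.
Qed.

(** Two Cauchy estimates in a row, each using up part of the radius: 8 (16 M / r) / (r / 4) = 512 M
    / r^2. *)
Lemma pderiv2_bound g z0 (r M : R) i j z : (forall z, differentiable g z) ->
  0 < r -> 0 < M -> (forall y, vabs (y - z0) < r -> cabs (g y) <= M) ->
  vabs (z - z0) < r / 4 -> cabs (pderiv i (pderiv j g) z) <= 512 * M / r ^+ 2.
Proof.
move=> gd r0 M0 gM zr; have r40 : 0 < r / 4 by rewrite divr_gt0.
have -> : 512 * M / r ^+ 2 = 8 * (16 * M / r) / (r / 4) by field; rewrite gt_eqF.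
apply: (@Cauchy_derivative_bound _ (fun s : R[i] => pderiv j g (z + s *: delta_mx 0 i)) 0) => //.
- by move=> s _; eexists; exact: pderiv2_line.
- by rewrite divr_gt0 // mulr_gt0.
- move=> s; rewrite subr0 => sr; apply: (pderiv_bound j gd r0 M0 gM).
  have -> : r / 2 = r / 4 + r / 4 by field.
  exact: vabs_line.
- by have := pderiv2_line z i j 0 gd; rewrite scale0r addr0.
Qed.

Lemma pderivB g1 g2 i : (forall z, differentiable g1 z) -> (forall z, differentiable g2 z) ->
  pderiv i (fun z => g1 z - g2 z) = (fun z => pderiv i g1 z - pderiv i g2 z).
Proof.
by move=> g1d g2d; apply/funext => z; rewrite /pderiv deriveB //; exact: diff_derivable.
Qed.

Lemma pderiv2B g1 g2 i j : (forall z, differentiable g1 z) -> (forall z, differentiable g2 z) ->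
  pderiv i (pderiv j (fun z => g1 z - g2 z)) =
  (fun z => pderiv i (pderiv j g1) z - pderiv i (pderiv j g2) z).
Proof.
move=> g1d g2d; rewrite pderivB //; apply/funext => z.
have D g : (forall z, differentiable g z) -> derivable (pderiv j g) z (delta_mx 0 i).
  move=> gd; have [b Hb] := pderiv_line_derivable z i j gd.
  by have /derive_line [] := Hb.
by rewrite {1}/pderiv deriveB //; exact: D.
Qed.

End EntireFunctions.

(** * Uniqueness of the star exponential *)

Section Uniqueness.
Variable R : realType.

Lemma real_is_derive (f : R -> R) (x d : R) :
  (forall e, 0 < e -> exists2 r, 0 < r & forall h, `|h| < r ->
     `|f (x + h) - f x - h * d| <= e * `|h|) -> is_derive x (1 : R) f d.
Proof.
move=> H.
have D : (fun h : R => h^-1 *: ((f \o shift x) (h *: (1 : R)) - f x)) @ 0^' --> d.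
  apply/cvgrPdist_lt => e e0.
  have [r r0 Hr] := H _ (divr_gt0 e0 (ltr0Sn _ 1)).
  rewrite near_withinE; apply/nbhs_ballP; exists r => //= h.
  rewrite /ball /= sub0r normrN => hr h0.
  rewrite -[h *: 1]/(h * 1) mulr1 (addrC h x) -[_ *: _]/(h^-1 * _).
  have h0' : 0 < `|h| by rewrite normr_gt0.
  rewrite -(@ltr_pM2r _ `|h|) // -normrM mulrBl mulrAC mulVf // mul1r.
  rewrite distrC (mulrC d); apply: le_lt_trans (Hr _ hr) _.
  by rewrite ltr_pM2r // gtr_pMr // invf_lt1 // ltr1n.
by split; [apply: (cvgP d)|exact: cvg_lim].
Qed.

(** The mean value theorem fails for complex values, so it is applied to [k] of f along the segment
    from 0 to t, [k] being the real or the imaginary part. *)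
Lemma complex_mvt_part (k : R[i] -> R) (f d : R[i] -> R[i]) t N :
  (forall z w, k (z + w) = k z + k w) -> (forall (r : R) z, k (r%:C * z) = r * k z) ->
  (forall z, `|k z| <= cabs z) ->
  (forall s : R, 0 <= s <= 1 -> cderiv f (s%:C * t) (d (s%:C * t))) ->
  (forall s : R, 0 < s < 1 -> cabs (d (s%:C * t)) <= N) ->
  `|k (f t) - k (f 0)| <= N * cabs t.
Proof.
move=> kD kZ kN fd dN.
have kB z w : k (z - w) = k z - k w.
  by have := kD (z - w) w; rewrite subrK => ->; rewrite addrK.
have D (s : R) : 0 <= s <= 1 ->
    is_derive s (1 : R) (fun x : R => k (f (x%:C * t))) (k (t * d (s%:C * t))).
  move=> s01; apply: real_is_derive => e e0.
  have t1 : 0 < cabs t + 1 by rewrite ltr_wpDl // cabs_ge0.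
  have [r r0 Hr] := fd s s01 _ (divr_gt0 e0 t1).
  exists (r / (cabs t + 1)) => [|h]; first by rewrite divr_gt0.
  rewrite ltr_pdivlMr // => hr.
  have ht : cabs (h%:C * t) <= `|h| * (cabs t + 1).
    by rewrite cabsM cabs_real ler_wpM2l // lerDl.
  rewrite -kB -kZ -kB; apply: le_trans (kN _) _.
  have := Hr (h%:C * t) (le_lt_trans ht hr).
  rewrite rmorphD mulrDl mulrA => H; apply: le_trans H _.
  rewrite mulrAC ler_pdivrMr // -mulrA; apply: ler_wpM2l => //; exact: ltW.
have C : {within `[0, 1], continuous (fun x : R => k (f (x%:C * t)))}.
  by apply: derivable_within_continuous => x; rewrite in_itv /= => /D [].
have [x x01 E] := @MVT _ (fun x : R => k (f (x%:C * t))) _ 0 1 ltr01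
  (fun x x01 => D x (subset_itv_oo_cc x01)) C.
move: E; rewrite rmorph0 rmorph1 mul0r mul1r subr0 mulr1 => ->.
apply: le_trans (kN _) _; rewrite cabsM mulrC ler_wpM2r ?cabs_ge0 // dN //.
Qed.

Lemma complex_mvt (f d : R[i] -> R[i]) t N :
  (forall s : R, 0 <= s <= 1 -> cderiv f (s%:C * t) (d (s%:C * t))) ->
  (forall s : R, 0 < s < 1 -> cabs (d (s%:C * t)) <= N) ->
  cabs (f t - f 0) <= 2 * N * cabs t.
Proof.
move=> fd dN; apply: le_trans (cabs_le_ReIm _) _; rewrite !raddfB /=.
have H1 : `|complex.Re (f t) - complex.Re (f 0)| <= N * cabs t.
  apply: complex_mvt_part fd dN; [by move=> *; rewrite raddfD| |exact: Re_le_cabs].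
  by move=> r [x y] /=; rewrite mul0r subr0.
have H2 : `|complex.Im (f t) - complex.Im (f 0)| <= N * cabs t.
  apply: complex_mvt_part fd dN; [by move=> *; rewrite raddfD| |exact: Im_le_cabs].
  by move=> r [x y] /=; rewrite mul0r addr0.
by move: H1 H2; clear; lra.
Qed.

Lemma half_quarter (r : R) : 0 < r -> [/\ 0 < r / 4 <= r, r / 4 < r / 2 & r / 2 < r].
Proof. by move=> r0; split; [apply/andP; split| |]; lra. Qed.

Lemma cabs_sum (I : finType) (F : I -> R[i]) : cabs (\sum_i F i) <= \sum_i cabs (F i).
Proof.
elim/big_ind2 : _ => // [|x1 x2 y1 y2 H1 H2]; first by rewrite cabs0.
by apply: le_trans (cabsD _ _) _; exact: lerD.
Qed.

Section Solutions.
Variables (hbar : R) (m : nat) (a : 'rV[R[i]]_m) (alpha beta gamma : R[i]).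
Implicit Types (z : 'rV[R[i]]_(m + m)).

Lemma differentiable_lin_u z : differentiable (lin_u a) z.
Proof.
have -> : lin_u a = \sum_(k < m) (fun z : 'rV[R[i]]_(m + m) => a 0 k *: (z 0 (lshift m k) : R[i])).
  by apply/funext => y; rewrite fct_sumE; apply: eq_bigr => k _; rewrite mxE.
apply: differentiable_sum => k; apply: differentiableZ; exact: differentiable_coord.
Qed.

Lemma differentiable_lin_v z : differentiable (lin_v a) z.
Proof.
have -> : lin_v a = \sum_(k < m) (fun z : 'rV[R[i]]_(m + m) => a 0 k *: (z 0 (rshift m k) : R[i])).
  by apply/funext => y; rewrite fct_sumE; apply: eq_bigr => k _; rewrite mxE.
apply: differentiable_sum => k; apply: differentiableZ; exact: differentiable_coord.
Qed.

Hypothesis a_unit : pairing a a = 1.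
Local Notation B := (Bform hbar a alpha beta gamma).

(** [K] and [r'] are fixed before g and M, so one choice serves all times of a solution at once. The
    radius drops to a quarter or less, the cost of two successive Cauchy estimates; the minimum with
    [ru] and [rv] keeps the linear forms bounded. *)
Lemma starK_bound z0 (r : R) : 0 < r -> exists2 K, 0 < K & exists2 r', 0 < r' <= r &
  forall g M, (forall z, differentiable g z) -> 0 < M ->
   (forall z, vabs (z - z0) < r -> cabs (g z) <= M) ->
   forall z, vabs (z - z0) < r' -> cabs (starK hbar B g z) <= K * M.
Proof.
move=> r0.
have [ru ru0 Hu] := differentiable_locally_bounded (differentiable_lin_u z0).
have [rv rv0 Hv] := differentiable_locally_bounded (differentiable_lin_v z0).
set X := cabs (lin_u a z0) + 1 in Hu; set Y := cabs (lin_v a z0) + 1 in Hv.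
have X0 : 0 <= X by rewrite addr_ge0 ?cabs_ge0.
have Y0 : 0 <= Y by rewrite addr_ge0 ?cabs_ge0.
pose b0 := cabs alpha * X ^+ 2 + cabs beta * Y ^+ 2 + cabs gamma * (2 * (X * Y) + cabs ('i * hbar%:C)).
pose c1 := cabs ('i * hbar%:C) * (cabs (2 * beta) * Y + cabs (2 * gamma) * X).
pose c2 := cabs (('i * hbar%:C) ^+ 2 * beta).
pose s1 := \sum_(k < m) cabs (a 0 k) * (16 / r).
pose s2 := \sum_(k < m) \sum_(l < m) cabs (a 0 k * a 0 l) * (512 / r ^+ 2).
have s10 : 0 <= s1 by apply: sumr_ge0 => k _; rewrite mulr_ge0 ?cabs_ge0 // divr_ge0 // ltW.
have s20 : 0 <= s2.
  by apply: sumr_ge0 => k _; apply: sumr_ge0 => l _; rewrite mulr_ge0 ?cabs_ge0 ?divr_ge0 ?ler0n ?exprn_ge0 ?ltW.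
have b00 : 0 <= b0.
  by rewrite /b0 !addr_ge0 // mulr_ge0 ?cabs_ge0 // ?sqr_ge0 // addr_ge0 ?cabs_ge0 // !mulr_ge0.
have c10 : 0 <= c1 by rewrite /c1 mulr_ge0 ?cabs_ge0 // addr_ge0 // mulr_ge0 // cabs_ge0.
have c20 : 0 <= c2 by exact: cabs_ge0.
exists (b0 + c1 * s1 + c2 * s2 + 1).
  by have := mulr_ge0 c10 s10; have := mulr_ge0 c20 s20; move: b00; clear; lra.
exists (Num.min (r / 4) (Num.min ru rv)).
  have [/andP[r40 r4r] _ _] := half_quarter r0.
  by rewrite !lt_min r40 ru0 rv0 /= ge_min r4r.
move=> g M gd M0 gM z; rewrite !lt_min => /and3P[zr /Hu {}Hu /Hv {}Hv].
have zr2 : vabs (z - z0) < r / 2.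
  by apply: lt_trans zr _; have [] := half_quarter r0.
have gz : cabs (g z) <= M.
  by apply: gM; apply: lt_trans zr2 _; have [] := half_quarter r0.
rewrite starK_Bform //.
have T1 : cabs (B z * g z) <= b0 * M.
  rewrite cabsM; apply: ler_pM => //; rewrite ?cabs_ge0 // BformE //.
  apply: le_trans (cabsD _ _) _; apply: lerD.
    apply: le_trans (cabsD _ _) _; rewrite [cabs (alpha * _)]cabsM
      [cabs (beta * _)]cabsM !cabsX; apply: lerD; apply: ler_wpM2l; rewrite ?cabs_ge0 //;
      by apply: lerXn2r; rewrite ?nnegrE ?cabs_ge0.
  rewrite cabsM; apply: ler_wpM2l; rewrite ?cabs_ge0 //.
  apply: le_trans (cabsD _ _) _; rewrite lerD2r.
  have -> : cabs (2 * (lin_u a z * lin_v a z)) = 2 * cabs (lin_u a z * lin_v a z).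
    have -> : (2 : R[i]) = (2%:R : R)%:C by rewrite rmorph_nat.
    by rewrite cabsM cabs_real ger0_norm.
  by rewrite ler_pM2l // cabsM; apply: ler_pM; rewrite ?cabs_ge0.
have T2 : cabs ('i * hbar%:C * (2 * beta * lin_v a z + 2 * gamma * lin_u a z) *
     \sum_(k < m) a 0 k * pderiv (lshift m k) g z) <= c1 * s1 * M.
  rewrite cabsM -[leRHS]mulrA; apply: ler_pM; rewrite ?cabs_ge0 //.
    rewrite cabsM; apply: ler_wpM2l; rewrite ?cabs_ge0 //.
    apply: le_trans (cabsD _ _) _; rewrite ![cabs (_ * lin_v a z)]cabsM ![cabs (_ * lin_u a z)]cabsM.
    by apply: lerD; apply: ler_wpM2l; rewrite ?cabs_ge0.
  apply: le_trans (cabs_sum _) _; rewrite mulr_suml; apply: ler_sum => k _.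
  rewrite cabsM -[leRHS]mulrA; apply: ler_wpM2l; rewrite ?cabs_ge0 // mulrAC.
  exact: pderiv_bound zr2.
have T3 : cabs (('i * hbar%:C) ^+ 2 * beta * \sum_(k < m) \sum_(l < m)
     a 0 k * a 0 l * pderiv (lshift m k) (pderiv (lshift m l) g) z) <= c2 * s2 * M.
  rewrite cabsM -[leRHS]mulrA; apply: ler_wpM2l; rewrite ?cabs_ge0 //.
  apply: le_trans (cabs_sum _) _; rewrite mulr_suml; apply: ler_sum => k _.
  apply: le_trans (cabs_sum _) _; rewrite mulr_suml; apply: ler_sum => l _.
  rewrite cabsM -[leRHS]mulrA; apply: ler_wpM2l; rewrite ?cabs_ge0 // mulrAC.
  exact: pderiv2_bound zr.
apply: le_trans (cabsD _ _) _.
apply: le_trans (lerD (cabsD _ _) (lexx _)) _.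
apply: le_trans (lerD (lerD T1 T2) T3) _.
have -> : (b0 + c1 * s1 + c2 * s2 + 1) * M = b0 * M + c1 * s1 * M + c2 * s2 * M + M by ring.
by rewrite lerDl ltW.
Qed.

Lemma starK_BformB g1 g2 z : (forall z, differentiable g1 z) -> (forall z, differentiable g2 z) ->
  starK hbar B (fun z => g1 z - g2 z) z = starK hbar B g1 z - starK hbar B g2 z.
Proof.
move=> g1d g2d; rewrite !starK_Bform //.
have L (b c d x y S S1 S2 T T1 T2 : R[i]) : S = S1 - S2 -> T = T1 - T2 ->
    b * (x - y) + c * S + d * T = b * x + c * S1 + d * T1 - (b * y + c * S2 + d * T2).
  by move=> -> ->; ring.
apply: L.
  rewrite -sumrB; apply: eq_bigr => k _; rewrite -mulrBr; congr (_ * _).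
  by have /(congr1 (@^~ z)) := pderivB (lshift m k) g1d g2d.
rewrite -sumrB; apply: eq_bigr => k _; rewrite -sumrB; apply: eq_bigr => l _.
rewrite -mulrBr; congr (_ * _).
by have /(congr1 (@^~ z)) := pderiv2B (lshift m k) (lshift m l) g1d g2d.
Qed.

(** One step: |W| <= C |t|^n on a ball bounds the t-derivative by K C |t|^n on a smaller one, and
    the mean value inequality gives 2 K C |t|^(n+1). The balls shrink with n, which is harmless, as
    flatness at t = 0 allows radius and constant to depend on n. *)
Lemma flow_flat (W : R[i] -> 'rV[R[i]]_(m + m) -> R[i]) (r : R) z0 : 0 < r ->
  (forall t, cabs t < r -> forall z, differentiable (W t) z) ->
  (forall t, cabs t < r -> forall z, cderiv (W^~ z) t (starK hbar B (W t) z)) ->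
  (forall z, W 0 z = 0) ->
  (exists2 s : R, 0 < s & forall t z, cabs t < s -> vabs (z - z0) < s -> cabs (W t z) <= 1) ->
  forall n, exists2 C, 0 < C & exists2 s : R, 0 < s & forall t z, cabs t < s ->
    vabs (z - z0) < s -> cabs (W t z) <= C * cabs t ^+ n.
Proof.
move=> r0 Wd Wt W0 [s0 s00 Ws0]; elim=> [|n [C C0 [s s0' Hs]]].
  by exists 1 => //; exists s0 => // t z ts zs; rewrite expr0 mulr1; exact: Ws0.
have [K K0 [s' /andP[s'0 s's] HK]] := starK_bound z0 s0'.
exists (2 * (K * C)); first by rewrite !mulr_gt0.
exists (Num.min r s'); first by rewrite lt_min r0.
move=> t z; rewrite !lt_min => /andP[tr ts] /andP[_ zs].
have [->|t0] := eqVneq t 0; first by rewrite W0 cabs0 mulr_ge0 ?exprn_ge0 // ltW // !mulr_gt0.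
have st (x : R) : 0 <= x <= 1 -> cabs (x%:C * t) <= cabs t.
  by move=> /andP[x0 x1]; rewrite cabsM cabs_real ger0_norm // ler_piMl // cabs_ge0.
rewrite -[W t z]subr0 -(W0 z).
have -> : 2 * (K * C) * cabs t ^+ n.+1 = 2 * (K * (C * cabs t ^+ n)) * cabs t.
  by rewrite exprS; ring.
apply: (@complex_mvt (W^~ z) (fun t => starK hbar B (W t) z)) => x x01.
  by apply: Wt; exact: le_lt_trans (st _ x01) tr.
have x01' : 0 <= x <= 1 by have /andP[? ?] := x01; rewrite !ltW.
have xt : cabs (x%:C * t) < s.
  by apply: le_lt_trans (st _ x01') _; exact: lt_le_trans ts s's.
apply: HK => //.
- by apply: Wd; exact: le_lt_trans (st _ x01') tr.
- by rewrite mulr_gt0 // exprn_gt0 // cabs_gt0.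
- move=> y ys; apply: le_trans (Hs _ _ xt ys) _.
  by rewrite ler_pM2l //; apply: lerXn2r; rewrite ?nnegrE ?cabs_ge0 ?st.
Qed.

Lemma slice_t (F : R[i] * 'rV[R[i]]_(m + m) -> R[i]) t z : differentiable F (t, z) ->
  exists d, cderiv (fun s => F (s, z)) t d.
Proof.
move=> Fd; apply/derivable_cderiv; apply/derivable1_diffP.
apply: (@differentiable_comp _ _ _ _ (fun s : R[i] => (s, z)) F) => //.
Qed.

Lemma slice_z (F : R[i] * 'rV[R[i]]_(m + m) -> R[i]) t z : differentiable F (t, z) ->
  differentiable (fun y => F (t, y)) z.
Proof.
move=> Fd.
apply: (@differentiable_comp _ _ _ _ (fun y : 'rV[R[i]]_(m + m) => (t, y)) F) => //.
Qed.

(** For each fixed z0 the difference is flat at t = 0 and vanishes for |t| < r / 2 by [flat_zero].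
    Since r comes from hypotheses uniform in z, it does not depend on z0, as an equality of germs
    requires. *)
Lemma star_exp_unique F1 F2 : star_exp_solution hbar B F1 -> star_exp_solution hbar B F2 ->
  germ_eq 0 F1 F2.
Proof.
move=> [h1 e1 i1] [h2 e2 i2].
have [r r0 Hr] : exists2 r : R, 0 < r & forall t, cabs t < r -> forall z,
   [/\ differentiable F1 (t, z), differentiable F2 (t, z),
      derive1 (fun s : R[i] => F1 (s, z)) t = starK hbar B (fun w => F1 (t, w)) z &
      derive1 (fun s : R[i] => F2 (s, z)) t = starK hbar B (fun w => F2 (t, w)) z].
  have [r1 r10 H1] := proj1 (nbhs_cabsP _ _) h1; have [r2 r20 H2] := proj1 (nbhs_cabsP _ _) h2.
  have [r3 r30 H3] := proj1 (nbhs_cabsP _ _) e1; have [r4 r40 H4] := proj1 (nbhs_cabsP _ _) e2.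
  exists (Num.min (Num.min r1 r2) (Num.min r3 r4)); first by rewrite !lt_min r10 r20 r30.
  move=> t; rewrite !lt_min => /andP[/andP[t1 t2] /andP[t3 t4]] z.
  by split; [apply: H1|apply: H2|apply: H3|apply: H4]; rewrite subr0.
pose W t z := F1 (t, z) - F2 (t, z).
have d1 t : cabs t < r -> forall z, differentiable (fun y => F1 (t, y)) z.
  by move=> tr z; have [D _ _ _] := Hr t tr z; exact: slice_z.
have d2 t : cabs t < r -> forall z, differentiable (fun y => F2 (t, y)) z.
  by move=> tr z; have [_ D _ _] := Hr t tr z; exact: slice_z.
have Wt t : cabs t < r -> forall z, cderiv (W^~ z) t (starK hbar B (W t) z).
  move=> tr z; have [D1 D2 E1 E2] := Hr t tr z.
  rewrite starK_BformB; [|exact: d1|exact: d2].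
  have T F d : differentiable F (t, z) -> derive1 (fun s : R[i] => F (s, z)) t = d ->
      cderiv (fun s => F (s, z)) t d.
    move=> /slice_t [b Hb] <-; apply: cderiv_eq (Hb) _.
    by have /is_derive_cderiv [_ <-] := Hb; rewrite derive1E.
  by apply: cderivB; exact: T.
have W0 z : W 0 z = 0 by rewrite /W i1 i2 subrr.
apply/nbhs_cabsP; exists (r / 2); first by rewrite divr_gt0.
move=> t tr z0; apply/eqP; rewrite -subr_eq0; apply/eqP.
apply: (@flat_zero _ (W^~ z0) 0 r) => //.
- by move=> s; rewrite subr0 => sr; eexists; exact: Wt.
- move=> n.
  have [| |C C0 [s s0 Hs]] := @flow_flat W r z0 r0 _ Wt W0 _ n.
  + by move=> s sr z; apply: differentiableB; [exact: d1|exact: d2].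
  (* Joint continuity at (0, z0), where the difference vanishes, gives the bound 1 that starts the
     induction. *)
  + have cW : {for (0 : R[i], z0), continuous (fun p => F1 p - F2 p)}.
      have [D1 D2 _ _] := Hr 0 (eq_ind_r (fun x => x < r) r0 (cabs0 R)) z0.
      by apply: differentiable_continuous; exact: differentiableB.
    have N : nbhs (F1 (0, z0) - F2 (0, z0)) [set w : R[i] | cabs w < 1].
      apply/nbhs_cabsP; exists 1 => // w; rewrite i1 i2 subrr subr0 //.
    have [[P1 P2] /= [/nbhs_cabsP [s1 s10 H1] /nbhs_vabsP [s2 s20 H2]] H] := cW _ N.
    exists (Num.min s1 s2) => [|t' z]; first by rewrite lt_min s10.
    rewrite !lt_min => /andP[t1 _] /andP[_ z2]; apply: ltW.
    by apply: (H (t', z)); split; [apply: H1; rewrite subr0|apply: H2].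
  exists C; exists s => // t'; rewrite subr0 => ts; apply: Hs => //.
  by rewrite subrr /vabs normr0.
Qed.

End Solutions.

End Uniqueness.

(** * Complex exponential and square root *)

Section Exponential.
Variable R : realType.
Implicit Types (z w : R[i]).

Lemma real_is_derive_eps (f : R -> R) (x d : R) : is_derive x (1 : R) f d ->
  forall e, 0 < e -> exists2 r, 0 < r & forall h, `|h| < r ->
     `|f (x + h) - f x - h * d| <= e * `|h|.
Proof.
move=> [/derivable_nbhs + <-] e e0 => /eqaddoP /(_ e e0) /nbhs_ballP [r r0 H].
exists r => // h hr.
have : `|f (h * 1 + x) - (f x + h * 'D_1 f x)| <= e * `|h|.
  by apply: H; rewrite /ball /= sub0r normrN.
by rewrite mulr1 (addrC h) opprD addrA.
Qed.

Lemma cexpD z w : cexp (z + w) = cexp z * cexp w.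
Proof.
case: z w => [a b] [c d]; rewrite /cexp /= expRD cosD sinD.
by apply/eqP; rewrite eq_complex /=; apply/andP; split; apply/eqP; ring.
Qed.

Lemma cexp0 : cexp (0 : R[i]) = 1.
Proof. by rewrite /cexp /= expR0 cos0 sin0 mul1r. Qed.

Lemma cexpN z : cexp z * cexp (- z) = 1.
Proof. by rewrite -cexpD subrr cexp0. Qed.

Lemma cderiv_cexp0 : cderiv (@cexp R) 0 1.
Proof.
(* With 3 as a bound of exp near 0, the real part contributes an error of 4 n |h| and the imaginary
   part 5 n |h|, whence the 9. *)
move=> e e0; pose n := Num.min 1 (e / 9).
have n0 : 0 < n by rewrite lt_min ltr01 divr_gt0.
have n1 : n <= 1 by rewrite ge_min lexx.
have ne : 9 * n <= e by rewrite mulrC -ler_pdivlMr // ge_min lexx orbT.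
clearbody n.
have [r1 r10 H1] := real_is_derive_eps (is_derive_expR (0 : R)) n0.
have [r2 r20 H2] := real_is_derive_eps (is_derive_cos (0 : R)) n0.
have [r3 r30 H3] := real_is_derive_eps (is_derive_sin (0 : R)) n0.
exists (Num.min (Num.min r1 n) (Num.min r2 r3)); first by rewrite !lt_min r10 n0 r20.
move=> h; rewrite !lt_min => /andP[/andP[h1 hn] /andP[h2 h3]].
have Rh := Re_le_cabs h; have Ih := Im_le_cabs h.
have {H1} := H1 _ (le_lt_trans Rh h1); have {H2} := H2 _ (le_lt_trans Ih h2).
have {H3} := H3 _ (le_lt_trans Ih h3).
rewrite !add0r expR0 cos0 sin0 oppr0 mulr0 !subr0 !mulr1 => H3 H2 H1.
rewrite cexp0; apply: le_trans (cabs_le_ReIm _) _.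
move: Rh Ih H1 H2 H3; move: (cabs h) hn => N hN; case: h {h1 h2 h3} => x y /=.
rewrite !mul0r !subr0 !addr0.
set E := expR x; set c := cos y; set s := sin y => xN yN H1 H2 H3.
have E3 : `|E| <= 3.
  have := ler_normD (E - 1 - x) (1 + x); have := ler_normD 1 x; rewrite normr1.
  have -> : E - 1 - x + (1 + x) = E by ring.
  have : n * `|x| <= 1 * 1 by apply: ler_pM => //; [exact: ltW|exact: le_trans xN (le_trans (ltW hN) n1)].
  by move: xN hN n1 H1; clear; lra.
have A : `|E * c - 1 - x| <= 3 * (n * N) + n * N.
  have -> : E * c - 1 - x = E * (c - 1) + (E - 1 - x) by ring.
  apply: le_trans (ler_normD _ _) _; rewrite normrM; apply: lerD.
    by apply: ler_pM => //; apply: le_trans H2 _; rewrite ler_pM2l.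
  by apply: le_trans H1 _; rewrite ler_pM2l.
have B : `|E * s - y| <= 3 * (n * N) + 2 * (n * N).
  have -> : E * s - y = E * (s - y) + (E - 1) * y by ring.
  apply: le_trans (ler_normD _ _) _; rewrite !normrM; apply: lerD.
    by apply: ler_pM => //; apply: le_trans H3 _; rewrite ler_pM2l.
  have E1 : `|E - 1| <= 2 * n.
    have := ler_normD (E - 1 - x) x; rewrite subrK.
    have : n * `|x| <= 1 * `|x| by rewrite ler_wpM2r.
    by move: xN hN H1; clear; lra.
  by rewrite mulrA; apply: ler_pM.
have nN : 0 <= n * N by rewrite mulr_ge0 ?(le_trans _ xN) // ltW.
have N0 : 0 <= N by exact: le_trans xN.
have : 9 * n * N <= e * N by rewrite ler_wpM2r.
by move: A B; clear; lra.
Qed.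

Lemma cderiv_cexp z : cderiv (@cexp R) z (cexp z).
Proof.
apply/cderiv_shift; apply: (@cderiv_ext _ (fun h => cexp z * cexp h)).
  by move=> h; rewrite cexpD.
by apply: cderiv_eq (cderivMl (cexp z) cderiv_cexp0) _; rewrite mulr1.
Qed.

Lemma sqr_iC : 'i ^+ 2 = -1 :> R[i].
Proof. exact: sqrCi. Qed.

Lemma iC_neq0 : 'i != 0 :> R[i].
Proof. exact: neq0Ci. Qed.

Lemma two_neq0 : 2 != 0 :> R[i]. Proof. by rewrite pnatr_eq0. Qed.

Lemma iC_inv : 'i^-1 = - 'i :> R[i].
Proof. by apply: (mulfI iC_neq0); rewrite mulrN divff ?iC_neq0 // -expr2 sqr_iC opprK. Qed.

Lemma cderiv_cexp_mul (c z : R[i]) : cderiv (fun w => cexp (c * w)) z (cexp (c * z) * c).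
Proof.
apply: (cderiv_comp (g := @cexp R) (f := fun w => c * w)); last exact: cderiv_cexp.
by apply: cderiv_eq (cderivMl c (cderiv_id z)) _; rewrite mulr1.
Qed.

Lemma cderiv_ccos z : cderiv (@ccos R) z (- csin z).
Proof.
have D := cderivM (cderivD (cderiv_cexp_mul 'i z) (cderiv_cexp_mul (- 'i) z)) (cderiv_cst (2^-1) z).
apply: cderiv_eq; first by apply: cderiv_ext D => w /=; rewrite mulNr.
by rewrite mulr0 add0r /csin mulNr invfM iC_inv; ring.
Qed.

Lemma cderiv_csin z : cderiv (@csin R) z (ccos z).
Proof.
have D := cderivM (cderivB (cderiv_cexp_mul 'i z) (cderiv_cexp_mul (- 'i) z)) (cderiv_cst ((2 * 'i)^-1) z).
apply: cderiv_eq; first by apply: cderiv_ext D => w /=; rewrite mulNr.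
rewrite mulr0 add0r /ccos mulNr invfM mulrN opprK -mulrDl -mulrA; congr (_ * _).
by rewrite mulrCA divff ?mulr1 // iC_neq0.
Qed.

Lemma ccos2Dcsin2 z : ccos z ^+ 2 + csin z ^+ 2 = 1.
Proof.
rewrite /ccos /csin invfM iC_inv.
have := cexpN ('i * z); move: (cexp ('i * z)) (cexp (- ('i * z))) => A B AB.
transitivity (A * B); last exact: AB.
have I2 := sqr_iC; move: ('i : R[i]) I2 => I I2.
have -> : ((A - B) * (2^-1 * - I)) ^+ 2 = (A - B) ^+ 2 * (I ^+ 2) / 4 by field.
by rewrite I2; field.
Qed.

Lemma ccos0 : ccos (0 : R[i]) = 1.
Proof. by rewrite /ccos mulr0 oppr0 cexp0; field. Qed.

Lemma csin0 : csin (0 : R[i]) = 0.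
Proof. by rewrite /csin mulr0 oppr0 cexp0 subrr mul0r. Qed.

Lemma cexp_ipi : cexp ('i * (pi : R)%:C) = -1 :> R[i].
Proof.
have -> : 'i * (pi : R)%:C = 0 +i* pi.
  rewrite -complexiE; apply/eqP; rewrite eq_complex /=.
  by apply/andP; split; apply/eqP; ring.
rewrite /cexp /= expR0 cospi sinpi.
by apply/eqP; rewrite eq_complex /=; apply/andP; split; apply/eqP; ring.
Qed.

Lemma cexp_Nipi : cexp (- ('i * (pi : R)%:C)) = -1 :> R[i].
Proof.
by have := cexpN ('i * (pi : R)%:C); rewrite cexp_ipi mulN1r => /eqP; rewrite eqr_oppLR => /eqP.
Qed.

Lemma ccos_pi : ccos (pi : R)%:C = -1 :> R[i].
Proof. by rewrite /ccos cexp_ipi cexp_Nipi; field. Qed.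

Lemma csin_pi : csin (pi : R)%:C = 0 :> R[i].
Proof. by rewrite /csin cexp_ipi cexp_Nipi subrr mul0r. Qed.

(** If the root is x + i y, then Re w = x^2 - y^2. The sector |Im| < Re obtained here is what later
    excludes opposite signs between two roots. *)
Lemma sqrtc_Re_gt0 w : 0 < complex.Re w -> `|complex.Im (sqrtc w)| < complex.Re (sqrtc w).
Proof.
move=> w0; have := sqr_sqrtc w.
have : 0 <= complex.Re (sqrtc w) by case: (w) => a b /=; exact: sqrtr_ge0.
case: (sqrtc w) => x y /= x0 E.
have : complex.Re w = x ^+ 2 - y ^+ 2 by rewrite -E /= expr2 /= -!expr2.
move=> Ew; rewrite Ew subr_gt0 in w0.
by rewrite -ltr_sqr ?nnegrE // real_normK ?num_real.
Qed.

(** With q and r the roots at w + h and w, one has h = (q - r) (q + r), and the remainder is -(q -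
    r)^2 / (2 r). As |q + r| and |r| are at least p = Re r, it is at most |h|^2 / (2 p^3). *)
Lemma cderiv_sqrtc w : 0 < complex.Re w -> cderiv (@sqrtc R) w (2 * sqrtc w)^-1.
Proof.
move=> w0; set r := sqrtc w.
have r0 : 0 < complex.Re r by apply: le_lt_trans (sqrtc_Re_gt0 w0).
pose p := complex.Re r.
have rp : p <= cabs r by apply: le_trans (Re_le_cabs _); exact: ler_norm.
have rn0 : r != 0 by rewrite -cabs_gt0; exact: lt_le_trans rp.
have C0 : 0 < 2 * p ^+ 3 by rewrite mulr_gt0 // exprn_gt0.
move=> e e0; exists (Num.min (complex.Re w) (e * (2 * p ^+ 3))).
  by rewrite lt_min w0 mulr_gt0.
move=> h; rewrite lt_min => /andP[hw he].
have wh0 : 0 < complex.Re (w + h).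
  by rewrite raddfD /=; have := le_lt_trans (Re_le_cabs h) hw; rewrite ltr_norml => /andP[+ _]; clear; lra.
have q0 : 0 < complex.Re (sqrtc (w + h)) by apply: le_lt_trans (sqrtc_Re_gt0 wh0).
set q := sqrtc (w + h).
have hE : h = (q - r) * (q + r).
  by have := sqr_sqrtc w; have := sqr_sqrtc (w + h); rewrite -/q -/r => Eq Er; rewrite -subr_sqr Eq Er; ring.
have pq : p <= cabs (q + r).
  apply: le_trans (Re_le_cabs _); apply: le_trans (ler_norm _).
  by rewrite raddfD /= lerDr ltW.
have -> : q - r - h * (2 * r)^-1 = - ((q - r) ^+ 2 * (2 * r)^-1) by rewrite hE; field.
rewrite cabsN cabsM cabsV cabsX.
have -> : cabs (2 * r) = 2 * cabs r.
  have -> : (2 : R[i]) = (2%:R : R)%:C by rewrite rmorph_nat.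
  by rewrite cabsM cabs_real ger0_norm.
have h1 : p * cabs (q - r) <= cabs h.
  by rewrite [in leRHS]hE cabsM mulrC ler_wpM2l ?cabs_ge0.
have D0 : 0 < 2 * cabs r by rewrite mulr_gt0 // (lt_le_trans r0).
rewrite ler_pdivrMr //.
have p20 : 0 < p ^+ 2 by rewrite exprn_gt0.
rewrite -(ler_pM2l p20) -exprMn.
apply: (@le_trans _ _ (cabs h ^+ 2)).
  by apply: lerXn2r; rewrite ?nnegrE ?mulr_ge0 ?cabs_ge0 // ltW.
have -> : p ^+ 2 * (e * cabs h * (2 * cabs r)) = cabs h * (e * (2 * (p ^+ 2 * cabs r))) by ring.
rewrite expr2; apply: ler_wpM2l; first exact: cabs_ge0.
apply: le_trans (ltW he) _; rewrite ler_pM2l // ler_pM2l // exprSr ler_pM2l //.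
Qed.

End Exponential.

(** * The explicit solution *)

Section Gaussian.
Variables (R : realType) (hbar : R) (m : nat) (a : 'rV[R[i]]_m).
Implicit Types (z : 'rV[R[i]]_(m + m)).

Lemma pderiv_line n i (g : 'rV[R[i]]_n -> R[i]) (y : 'rV[R[i]]_n) d :
  cderiv (fun s : R[i] => g (y + s *: delta_mx 0 i)) 0 d -> pderiv i g y = d.
Proof. by move=> /derive_line []. Qed.

Definition gauss (k P Q S : R[i]) z : R[i] :=
  k * cexp (P * lin_u a z ^+ 2 + Q * (lin_u a z * lin_v a z) + S * lin_v a z ^+ 2).

Lemma gauss_line k P Q S z j (s : R[i]) :
  cderiv (fun s => gauss k P Q S (z + s *: delta_mx 0 (lshift m j))) s
    (a 0 j * (2 * P * lin_u a (z + s *: delta_mx 0 (lshift m j))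
              + Q * lin_v a (z + s *: delta_mx 0 (lshift m j)))
     * gauss k P Q S (z + s *: delta_mx 0 (lshift m j))).
Proof.
set x := lin_u a z; set y := lin_v a z; pose b := a 0 j.
have U s' : lin_u a (z + s' *: delta_mx 0 (lshift m j)) = x + s' * b.
  by rewrite lin_u_line lin_u_lshift.
have V s' : lin_v a (z + s' *: delta_mx 0 (lshift m j)) = y.
  by rewrite lin_v_line lin_v_lshift mulr0 addr0.
pose f (s' : R[i]) := P * (x + s' * b) ^+ 2 + Q * ((x + s' * b) * y) + S * y ^+ 2.
have D1 : cderiv (fun s' => x + s' * b) s b.
  apply: cderiv_eq; first apply: cderivD; first exact: cderiv_cst.
    by apply: cderivM; [exact: cderiv_id|exact: cderiv_cst].
  by rewrite /=; ring.
have D : cderiv f s (b * (2 * P * (x + s * b) + Q * y)).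
  apply: cderiv_eq; first apply: cderivD; first apply: cderivD.
  - by apply: cderivMl; exact: (cderivX 2 D1).
  - by apply: cderivMl; apply: cderivM; [exact: D1|exact: cderiv_cst].
  - exact: cderiv_cst.
  by rewrite /= expr1; ring.
apply: cderiv_eq; first apply: (cderiv_ext (f := fun s' => k * (@cexp R \o f) s')).
- by move=> s'; rewrite /gauss U V.
- by apply: cderivMl; apply: cderiv_comp D _; exact: cderiv_cexp.
by rewrite /gauss U V -/b /f; ring.
Qed.

Lemma pderiv_gauss k P Q S j : pderiv (lshift m j) (gauss k P Q S) =
  fun z => a 0 j * (2 * P * lin_u a z + Q * lin_v a z) * gauss k P Q S z.
Proof.
apply/funext => z; apply: pderiv_line.
by apply: cderiv_eq (gauss_line k P Q S z j 0) _; rewrite !scale0r !addr0.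
Qed.

Lemma pderiv2_gauss k P Q S j l z :
  pderiv (lshift m j) (pderiv (lshift m l) (gauss k P Q S)) z =
  a 0 j * a 0 l * (2 * P + (2 * P * lin_u a z + Q * lin_v a z) ^+ 2) * gauss k P Q S z.
Proof.
rewrite pderiv_gauss.
have D : cderiv (fun s : R[i] => a 0 l * (2 * P * lin_u a (z + s *: delta_mx 0 (lshift m j))
      + Q * lin_v a (z + s *: delta_mx 0 (lshift m j)))) 0 (a 0 l * (2 * P * a 0 j)).
  apply: cderivMl.
  apply: cderiv_ext (cderiv_quadratic (2 * P * lin_u a z + Q * lin_v a z) (2 * P * a 0 j) 0) => s.
  by rewrite lin_u_line lin_v_line lin_u_lshift lin_v_lshift; ring.
apply: pderiv_line; apply: cderiv_eq (cderivM D (gauss_line k P Q S z j 0)) _.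
by rewrite !scale0r !addr0; ring.
Qed.

Hypothesis a_unit : pairing a a = 1.

(** A Gaussian is reproduced up to a quadratic polynomial in x and y, the sums over k and l
    collapsing by <a,a> = 1; this is what reduces the equation to finitely many coefficients. *)
Lemma starK_gauss alpha beta gamma k P Q S z :
  starK hbar (Bform hbar a alpha beta gamma) (gauss k P Q S) z =
  (alpha * lin_u a z ^+ 2 + beta * lin_v a z ^+ 2 +
   gamma * (2 * (lin_u a z * lin_v a z) + 'i * hbar%:C) +
   'i * hbar%:C * (2 * beta * lin_v a z + 2 * gamma * lin_u a z) *
     (2 * P * lin_u a z + Q * lin_v a z) +
   ('i * hbar%:C) ^+ 2 * beta * (2 * P + (2 * P * lin_u a z + Q * lin_v a z) ^+ 2))
  * gauss k P Q S z.
Proof.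
rewrite starK_Bform // BformE //; set g := gauss k P Q S z.
set L := 2 * P * lin_u a z + Q * lin_v a z.
have E X : \sum_(j < m) a 0 j * a 0 j * X = X.
  by rewrite -mulr_suml -/(pairing a a) a_unit mul1r.
have S1 : \sum_(j < m) a 0 j * pderiv (lshift m j) (gauss k P Q S) z = L * g.
  rewrite -[RHS]E; apply: eq_bigr => j _.
  by rewrite pderiv_gauss -/L -/g; ring.
have S2 : \sum_(j < m) \sum_(l < m)
     a 0 j * a 0 l * pderiv (lshift m j) (pderiv (lshift m l) (gauss k P Q S)) z =
   (2 * P + L ^+ 2) * g.
  rewrite -[RHS]E; apply: eq_bigr => j _.
  rewrite -[RHS]E; apply: eq_bigr => l _.
  by rewrite pderiv2_gauss -/L -/g; ring.
have F (b c d T1 T2 : R[i]) : T1 = L * g -> T2 = (2 * P + L ^+ 2) * g ->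
    b * g + c * T1 + d * T2 = (b + c * L + d * (2 * P + L ^+ 2)) * g.
  by move=> -> ->; ring.
exact: F.
Qed.

(** * Solving the Riccati system *)

Section Solution.
Variables (alpha beta gamma : R[i]).
Hypotheses (hbar_gt0 : 0 < hbar) (disc : gamma ^+ 2 - alpha * beta = 1).

Definition tcos (t : R[i]) := ccos (2 * hbar%:C * t).
Definition tsin (t : R[i]) := csin (2 * hbar%:C * t).
(** Riccati's substitution: for phi = Delta^(-1/2), the equations phi' / phi = i hbar gamma - 2
    hbar^2 beta P and P' = alpha + 4 i hbar gamma P - 4 hbar^2 beta P^2 combine into the linear
    equation Delta'' = -4 hbar^2 (gamma^2 - alpha beta) Delta, with Delta(0) = 1 and Delta'(0) = -2
    i hbar gamma. *)
Definition Delta (t : R[i]) := tcos t - 'i * gamma * tsin t.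
Definition dDelta (t : R[i]) := 2 * hbar%:C * (- tsin t - 'i * gamma * tcos t).

Lemma cderiv_tcos t : cderiv tcos t (- (2 * hbar%:C * tsin t)).
Proof.
apply: cderiv_eq.
  apply: (cderiv_comp (g := @ccos R) (f := fun t => 2 * hbar%:C * t)); last exact: cderiv_ccos.
  exact: cderivMl (cderiv_id _).
by rewrite /tsin; ring.
Qed.

Lemma cderiv_tsin t : cderiv tsin t (2 * hbar%:C * tcos t).
Proof.
apply: cderiv_eq.
  apply: (cderiv_comp (g := @csin R) (f := fun t => 2 * hbar%:C * t)); last exact: cderiv_csin.
  exact: cderivMl (cderiv_id _).
by rewrite /tcos; ring.
Qed.

Lemma cderiv_Delta t : cderiv Delta t (dDelta t).
Proof.
apply: cderiv_eq.
  by apply: cderivB; [exact: cderiv_tcos|apply: cderivMl; exact: cderiv_tsin].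
by rewrite /dDelta; ring.
Qed.

(** A root of 1 / Delta whose sign is selected by [psi]. [branch_dom] keeps 1 / (Delta psi^2) in the
    right half-plane, away from the cut of the principal root; where psi^2 = 1 / Delta the value is
    [psi] itself. *)
Definition branch (psi t : R[i]) := psi * sqrtc (Delta t * psi ^+ 2)^-1.

Definition branch_dom (psi t : R[i]) := 0 < complex.Re (Delta t * psi ^+ 2)^-1.

Lemma branch_dom_neq0 psi t : branch_dom psi t -> Delta t != 0 /\ psi != 0.
Proof.
rewrite /branch_dom => H; suff : Delta t * psi ^+ 2 != 0.
  by rewrite mulf_eq0 negb_or expf_eq0 /= => /andP.
by apply: contraTneq H => ->; rewrite invr0 /= ltxx.
Qed.

Lemma branch_sqr psi t : branch_dom psi t -> branch psi t ^+ 2 = (Delta t)^-1.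
Proof.
move=> /branch_dom_neq0 [D0 p0]; rewrite /branch exprMn sqr_sqrtc; field.
by rewrite D0 p0.
Qed.

Lemma cderiv_branch psi t : branch_dom psi t ->
  cderiv (branch psi) t (- dDelta t / (2 * Delta t) * branch psi t).
Proof.
move=> H; have [D0 p0] := branch_dom_neq0 H.
have Dp0 : Delta t * psi ^+ 2 != 0 by rewrite mulf_neq0 // expf_neq0.
have D1 : cderiv (fun t => Delta t * psi ^+ 2) t (dDelta t * psi ^+ 2).
  apply: cderiv_eq (cderivM (cderiv_Delta t) (cderiv_cst _ _)) _.
  by rewrite mulr0 add0r.
have D2 := cderiv_comp (g := @sqrtc R) (cderivV (f := fun t => Delta t * psi ^+ 2) Dp0 D1) (cderiv_sqrtc H).
apply: cderiv_eq (cderivMl psi D2) _; rewrite /branch.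
have := sqr_sqrtc (Delta t * psi ^+ 2)^-1; move: (sqrtc _) => r r2.
have r0 : r != 0.
  by rewrite -sqrf_eq0 r2 invr_eq0.
have E : Delta t = (r ^+ 2 * psi ^+ 2)^-1 by rewrite r2; field; rewrite D0 p0.
by rewrite E; field; rewrite ?r0 ?p0.
Qed.

Definition coefP t := alpha * tsin t / (2 * hbar%:C * Delta t).
Definition coefQ t := ((Delta t)^-1 - 1) / ('i * hbar%:C).
Definition coefS t := beta * tsin t / (2 * hbar%:C * Delta t).

Definition sol (psi : R[i]) (p : R[i] * 'rV[R[i]]_(m + m)) : R[i] :=
  gauss (branch psi p.1) (coefP p.1) (coefQ p.1) (coefS p.1) p.2.

Lemma hbarC_neq0 : hbar%:C != 0 :> R[i].
Proof. by rewrite -cabs_eq0 cabs_real normr_eq0 gt_eqF. Qed.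

Lemma cderiv_coef (c t : R[i]) : Delta t != 0 ->
  cderiv (fun t => c * tsin t / (2 * hbar%:C * Delta t)) t (c / Delta t ^+ 2).
Proof.
move=> D0; have h0 := hbarC_neq0.
have H0 : 2 * hbar%:C * Delta t != 0 by rewrite !mulf_neq0 // two_neq0.
apply: cderiv_eq.
  apply: cderivM; first exact: cderivMl (cderiv_tsin t).
  by apply: cderivV => //; exact: cderivMl (cderiv_Delta t).
have E : tcos t * Delta t * (2 * hbar%:C) - tsin t * dDelta t = 2 * hbar%:C * (tcos t ^+ 2 + tsin t ^+ 2).
  by rewrite /dDelta /Delta; ring.
rewrite ccos2Dcsin2 mulr1 in E.
transitivity (c * (2 * hbar%:C) / (2 * hbar%:C * Delta t ^+ 2)).
  by rewrite -[X in _ = c * X / _]E; field; rewrite D0 h0.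
by field; rewrite D0 h0.
Qed.

Lemma cderiv_coefQ t : Delta t != 0 ->
  cderiv coefQ t (- dDelta t / ('i * hbar%:C * Delta t ^+ 2)).
Proof.
move=> D0; have h0 := hbarC_neq0; have i0 := iC_neq0 R.
apply: cderiv_eq.
  apply: cderivM; last exact: cderiv_cst.
  by apply: cderivB; [exact: cderivV (cderiv_Delta t)|exact: cderiv_cst].
by rewrite /=; field; rewrite D0 h0 i0.
Qed.

Lemma cderiv_sol psi t z : branch_dom psi t ->
  cderiv (fun s => sol psi (s, z)) t
    (starK hbar (Bform hbar a alpha beta gamma) (fun w => sol psi (t, w)) z).
Proof.
move=> H; have [D0 p0] := branch_dom_neq0 H.
have h0 := hbarC_neq0; have i0 := iC_neq0 R.
set x := lin_u a z; set y := lin_v a z.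
pose f s := coefP s * x ^+ 2 + coefQ s * (x * y) + coefS s * y ^+ 2.
have Df : cderiv f t (alpha / Delta t ^+ 2 * x ^+ 2 +
   (- dDelta t / ('i * hbar%:C * Delta t ^+ 2)) * (x * y) + beta / Delta t ^+ 2 * y ^+ 2).
  have M c g d : cderiv g t d -> cderiv (fun s => g s * c) t (d * c).
    by move=> gd; apply: cderiv_eq (cderivM gd (cderiv_cst c t)) _; rewrite mulr0 add0r.
  by apply: cderivD; [apply: cderivD|]; apply: M; [exact: cderiv_coef|exact: cderiv_coefQ|exact: cderiv_coef].
have De := cderiv_comp Df (cderiv_cexp (f t)).
apply: cderiv_eq; first exact: cderivM (cderiv_branch H) De.
have -> : (fun w => sol psi (t, w)) = gauss (branch psi t) (coefP t) (coefQ t) (coefS t) by [].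
rewrite starK_gauss /gauss -/x -/y /= -/(f t).
move: (cexp (f t)) (branch psi t) => e b.
transitivity ((- dDelta t / (2 * Delta t) + (alpha / Delta t ^+ 2 * x ^+ 2 +
   (- dDelta t / ('i * hbar%:C * Delta t ^+ 2)) * (x * y) + beta / Delta t ^+ 2 * y ^+ 2)) * (b * e)).
  by ring.
congr (_ * _).
(* The left side is cos^2 + (gamma^2 - alpha beta) sin^2, so the normalisation makes it 1. It turns
   alpha / Delta^2, the derivative of P, into the right-hand side of the Riccati equation. *)
have K : Delta t ^+ 2 + 2 * 'i * gamma * tsin t * Delta t + 'i ^+ 2 * alpha * beta * tsin t ^+ 2 = 1.
  transitivity (tcos t ^+ 2 + tsin t ^+ 2 * (gamma ^+ 2 - alpha * beta)); last first.
    by rewrite disc mulr1; exact: ccos2Dcsin2.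
  rewrite /Delta; have i2 := sqr_iC R; move: ('i : R[i]) i2 => I I2.
  have -> : I ^+ 2 * alpha * beta * tsin t ^+ 2 = - (alpha * beta * tsin t ^+ 2) by rewrite I2; ring.
  have -> : (tcos t - I * gamma * tsin t) ^+ 2 + 2 * I * gamma * tsin t * (tcos t - I * gamma * tsin t)
    = tcos t ^+ 2 - I ^+ 2 * gamma ^+ 2 * tsin t ^+ 2 by ring.
  by rewrite I2; ring.
have E0 : - dDelta t = 2 * hbar%:C * ('i * gamma * Delta t + 'i ^+ 2 * alpha * beta * tsin t).
  have i2 := sqr_iC R; rewrite /dDelta /Delta.
  transitivity (2 * hbar%:C * (tsin t * (gamma ^+ 2 - alpha * beta) + 'i * gamma * tcos t)).
    by rewrite disc; ring.
  move: ('i : R[i]) i2 => I I2; rewrite I2.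
  have -> : I * gamma * (tcos t - I * gamma * tsin t) =
    I * gamma * tcos t - I ^+ 2 * (gamma ^+ 2 * tsin t) by ring.
  by rewrite I2; ring.
(* The Riccati system: coefficients of 1, x^2, x y and y^2 in turn. *)
have e0 : - dDelta t / (2 * Delta t) = gamma * ('i * hbar%:C) +
    ('i * hbar%:C) ^+ 2 * beta * (2 * coefP t).
  by rewrite E0 /coefP; field; rewrite D0 h0.
have e1 : alpha / Delta t ^+ 2 = alpha + 'i * hbar%:C * (4 * gamma * coefP t) +
    ('i * hbar%:C) ^+ 2 * beta * (4 * coefP t ^+ 2).
  transitivity (alpha * (Delta t ^+ 2 + 2 * 'i * gamma * tsin t * Delta t +
    'i ^+ 2 * alpha * beta * tsin t ^+ 2) / Delta t ^+ 2); first by rewrite K mulr1.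
  by rewrite /coefP; field; rewrite D0 h0.
have e2 : - dDelta t / ('i * hbar%:C * Delta t ^+ 2) = 2 * gamma +
    'i * hbar%:C * (4 * beta * coefP t + 2 * gamma * coefQ t) +
    ('i * hbar%:C) ^+ 2 * beta * (4 * coefP t * coefQ t).
  by rewrite E0 /coefP /coefQ; field; rewrite D0 h0 i0.
have e3 : beta / Delta t ^+ 2 = beta + 'i * hbar%:C * (2 * beta * coefQ t) +
    ('i * hbar%:C) ^+ 2 * beta * coefQ t ^+ 2.
  by rewrite /coefQ; field; rewrite D0 h0 i0.
by rewrite e0 e1 e2 e3; ring.
Qed.

End Solution.
End Gaussian.

(** * Path lifting *)

Section Segments.
Variable R : realType.

(** If it failed, halving would give failing segments that shrink to a point, against the local
    hypothesis. This form of the compactness of [0, 1] (Cousin's principle) drives both path lifting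
    and uniqueness of continuations; [bisection] is used with a second side of length 0. *)
Lemma segment_induction (P : R -> R -> Prop) :
  (forall a c b, 0 <= a -> a <= c <= b -> b <= 1 -> P a c -> P c b -> P a b) ->
  (forall x, 0 <= x <= 1 -> exists2 d : R, 0 < d &
     forall a b, 0 <= a <= b -> b <= 1 -> `|a - x| < d -> `|b - x| < d -> P a b) ->
  P 0 1.
Proof.
move=> cat loc; apply: contrapT => N.
pose Q (a _ w _ : R) := ~ P a (a + w).
have [n a b a0 aw _ _ nP||X [Y H]] := @bisection R Q 0 0 1 0 ler01 (lexx 0).
- have -> : 1 / 2 ^+ n.+1 = 1 / 2 ^+ n / 2 :> R by rewrite exprS invfM mulrA mulrAC.
  have W0 : 0 <= 1 / 2 ^+ n :> R by rewrite divr_ge0 // exprn_ge0.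
  rewrite add0r in aw; rewrite /Q in nP *; move: (1 / 2 ^+ n) W0 aw nP => W W0 aw nP.
  have E : a + W / 2 + W / 2 = a + W by field.
  have [p1|p1] := pselect (P a (a + W / 2)).
    exists (a + W / 2), b; split; [by right|by left|rewrite E => p2; apply: nP].
    by apply: cat p1 p2 => //; apply/andP; split; lra.
  by exists a, b; split; [left|left|].
- by rewrite /Q add0r.
have [d d0 Hd] : exists2 d : R, 0 < d &
     forall a b, 0 <= a <= b -> b <= 1 -> `|a - X| < d -> `|b - X| < d -> P a b.
  apply: loc; have [a [b [/andP[a0 aX] /andP[Xa a1] _ _ _]]] := H 0%N.
  by apply/andP; split; lra.
have [n Hn] := exp2_small 1 d0.
have [a [b [/andP[a0 aX] /andP[Xa a1] _ _ nP]]] := H n.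
have W0 : 0 <= 1 / 2 ^+ n :> R by rewrite divr_ge0 // exprn_ge0.
apply: nP; rewrite add0r in a1; move: (1 / 2 ^+ n) W0 Hn Xa a1 => W W0 Hn Xa a1.
apply: Hd => //; first by apply/andP; split=> //; lra.
  by rewrite ltr_norml; apply/andP; split; lra.
by rewrite ltr_norml; apply/andP; split; lra.
Qed.

Lemma segcont_comp (f : R -> R[i]) (g : R[i] -> R[i]) a b : segcont f a b ->
  (forall x, a <= x <= b -> ccont g (f x)) -> segcont (fun x => g (f x)) a b.
Proof.
move=> fc gc x xab e e0; have [r r0 Hr] := gc x xab e e0.
by have [d d0 Hd] := fc x xab r r0; exists d => // y yab xy; apply: Hr; exact: Hd.
Qed.

Lemma segcontM (f g : R -> R[i]) a b : segcont f a b -> segcont g a b ->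
  segcont (fun x => f x * g x) a b.
Proof.
move=> fc gc x xab e /(mul_near (f x) (g x)) [n n0 Hn].
have [r r0 Hr] := fc _ xab _ n0; have [s s0 Hs] := gc _ xab _ n0.
exists (Num.min r s) => [|y yab]; first by rewrite lt_min r0.
by rewrite lt_min => /andP[/(Hr _ yab) {}Hr /(Hs _ yab) {}Hs]; exact: Hn.
Qed.

Lemma segcont_reparam (f : R -> R[i]) (k : R -> R) a b c d :
  (forall x y, `|k x - k y| <= `|x - y|) -> (forall x, a <= x <= b -> c <= k x <= d) ->
  segcont f c d -> segcont (fun x => f (k x)) a b.
Proof.
move=> kL kab fc x xab e e0; have [r r0 Hr] := fc _ (kab _ xab) e e0.
exists r => // y yab xy; apply: Hr; first exact: kab.
exact: le_lt_trans (kL _ _) xy.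
Qed.

Lemma min_lip (c x y : R) : `|Num.min x c - Num.min y c| <= `|x - y|.
Proof.
have [h1|h1] := leP x c; have [h2|h2] := leP y c; rewrite // ?subrr ?normr0 //.
  by rewrite !ler0_norm; lra.
by rewrite !ger0_norm; lra.
Qed.

Lemma max_lip (c x y : R) : `|Num.max x c - Num.max y c| <= `|x - y|.
Proof.
have [h1|h1] := leP x c; have [h2|h2] := leP y c; rewrite // ?subrr ?normr0 //.
  by rewrite !ler0_norm; lra.
by rewrite !ger0_norm; lra.
Qed.

Lemma segcont_Re_gt0 (f : R -> R[i]) a b x : segcont f a b -> a <= x <= b ->
  0 < complex.Re (f x) ->
  exists2 d : R, 0 < d & forall y, a <= y <= b -> `|y - x| < d -> 0 < complex.Re (f y).
Proof.
move=> fc xab fx; have [d d0 Hd] := fc x xab _ fx; exists d => // y yab xy.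
have := le_lt_trans (Re_le_cabs _) (Hd y yab xy); rewrite raddfB /= ltr_norml => /andP[+ _].
by clear; lra.
Qed.

Lemma ccont_Re_gt0 (f : R[i] -> R[i]) x : ccont f x -> 0 < complex.Re (f x) ->
  exists2 d : R, 0 < d & forall y, cabs (y - x) < d -> 0 < complex.Re (f y).
Proof.
move=> fc fx; have [d d0 Hd] := fc _ fx; exists d => // y xy.
have := le_lt_trans (Re_le_cabs _) (Hd y xy); rewrite raddfB /= ltr_norml => /andP[+ _].
by clear; lra.
Qed.

Lemma ccont_inv (w : R[i]) : w != 0 -> ccont (fun z => z^-1) w.
Proof. by move=> w0; apply: cderiv_ccont; exact: (cderivV (f := id) w0 (cderiv_id w)). Qed.

Lemma ccont_cstM (c : R[i]) (f : R[i] -> R[i]) w : ccont f w -> ccont (fun z => c * f z) w.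
Proof. by move=> fc; apply: ccontM => // e e0; exists 1 => // y _; rewrite subrr cabs0. Qed.

(* Continuous square roots of 1 / D along a path glue, so they exist globally. *)
Lemma sqrt_lift (D : R -> R[i]) : segcont D 0 1 -> (forall x, 0 <= x <= 1 -> D x != 0) ->
  exists psi : R -> R[i], [/\ segcont psi 0 1, psi 0 = 1 &
    forall x, 0 <= x <= 1 -> D x * psi x ^+ 2 = D 0].
Proof.
move=> Dc D0.
apply: (@segment_induction (fun a b => exists psi : R -> R[i], [/\ segcont psi a b, psi a = 1 &
    forall x, a <= x <= b -> D x * psi x ^+ 2 = D a])).
- move=> a c b a0 /andP[ac cb] b1 [p1 [p1c p1a p1D]] [p2 [p2c p2a p2D]].
  (* Gluing without case distinction: left of [c] the second factor is p2 c = 1, right of it the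
     first one is frozen at p1 c. *)
  exists (fun x => p1 (Num.min x c) * p2 (Num.max x c)); split.
  + apply: segcontM.
      apply: (segcont_reparam (c := a) (d := c)) p1c; first exact: min_lip.
      by move=> x /andP[ax xb]; rewrite le_min ax ac ge_min lexx orbT.
    apply: (segcont_reparam (c := c) (d := b)) p2c; first exact: max_lip.
    by move=> x /andP[ax xb]; rewrite le_max lexx orbT ge_max xb.
  + by rewrite (min_idPl ac) (max_idPr ac) p1a p2a mulr1.
  + move=> x /andP[ax xb]; have [xc|cx] := leP x c.
      by rewrite p2a mulr1 p1D // ax.
    have E1 := p1D c; rewrite ac lexx in E1.
    by rewrite exprMn mulrCA p2D ?(ltW cx) // mulrC E1.
- move=> x x01.
  (* Two values within m of D x differ by less than |D x| / 2, while each has modulus above 3 |D x|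
     / 4. So D a / D y is at distance less than 1 from 1, in the right half-plane, where the
     principal root is continuous. *)
  pose m := cabs (D x) / 4.
  have Dx0 : 0 < cabs (D x) by rewrite cabs_gt0 D0.
  have m0 : 0 < m by rewrite divr_gt0.
  have [d d0 Hd] := Dc x x01 m m0.
  exists d => // a b /andP[a0 ab] b1 ad bd.
  have near y : a <= y <= b -> cabs (D y - D x) < m.
    move=> /andP[ay yb]; apply: Hd; first by apply/andP; split; lra.
    by move: ad bd ay yb; rewrite !ltr_norml => /andP[? ?] /andP[? ?] ? ?; apply/andP; split; lra.
  have in01 y : a <= y <= b -> 0 <= y <= 1.
    by move=> /andP[ay yb]; apply/andP; split; lra.
  have aa : a <= a <= b by rewrite lexx ab.
  have pos y : a <= y <= b -> 0 < complex.Re (D a * (D y)^-1).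
    move=> yab; have y0 := D0 _ (in01 _ yab).
    have Ha := near _ aa; have Hy := near _ yab.
    have q : cabs (D a - D y) < cabs (D y).
      have := cabsD (D a - D x) (D x - D y); rewrite addrA subrK (cabsB (D x)).
      have := cabsD (D x - D y) (D y); rewrite subrK (cabsB (D x)).
      by rewrite /m in Ha Hy; move: Ha Hy Dx0; clear; lra.
    have -> : D a * (D y)^-1 = 1 + (D a - D y) / D y by field.
    have : cabs ((D a - D y) / D y) < 1.
      by rewrite cabsM cabsV ltr_pdivrMr ?mul1r // cabs_gt0.
    move=> /(le_lt_trans (Re_le_cabs _)); rewrite ltr_norml raddfD /= => /andP[+ _].
    by clear; lra.
  exists (fun y => sqrtc (D a * (D y)^-1)); split.
  + apply: (segcont_comp (f := fun y => D a * (D y)^-1) (g := @sqrtc R)); last first.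
      by move=> y /pos /cderiv_sqrtc /cderiv_ccont.
    apply: (segcont_comp (f := D) (g := fun z => D a * z^-1)).
      by apply: segcontW Dc.
    by move=> y yab; apply: ccont_cstM; apply: ccont_inv; apply: D0; exact: in01.
  + by rewrite divff ?sqrtc1 // D0 // in01.
  + by move=> y yab; rewrite sqr_sqrtc mulrCA divff ?mulr1 // D0 // in01.
Qed.

End Segments.

(** * Analytic continuation *)

Section Continuation.
Variable R : realType.

(** Agreement near a point is flatness of the difference there, which [flat_zero] spreads, for each
    z separately, to half the radius of a disc of holomorphy about that point; the radius is uniform
    in z. *)
Lemma holo_germ_identity n (F1 F2 : R[i] * 'rV[R[i]]_(n + n) -> R[i]) c :
  holomorphic_near c F1 -> holomorphic_near c F2 ->
  exists2 r : R, 0 < r & forall c', cabs (c' - c) < r ->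
    (germ_eq c' F1 F2 <-> germ_eq c F1 F2).
Proof.
move=> /nbhs_cabsP [r1 r10 H1] /nbhs_cabsP [r2 r20 H2].
pose r := Num.min r1 r2.
have r0 : 0 < r by rewrite lt_min r10.
have Hr t z : cabs (t - c) < r -> exists d, cderiv (fun t => F1 (t, z) - F2 (t, z)) t d.
  rewrite lt_min => /andP[/H1 /(_ z) /slice_t [d1 D1] /H2 /(_ z) /slice_t [d2 D2]].
  by exists (d1 - d2); exact: cderivB.
clearbody r.
have zero c1 s t z : 0 < s -> (forall y, cabs (y - c1) < s -> cabs (y - c) < r) ->
    germ_eq c1 F1 F2 -> cabs (t - c1) < s / 2 -> F1 (t, z) = F2 (t, z).
  move=> s0 sr /nbhs_cabsP [u u0 Hu] ts; apply/eqP; rewrite -subr_eq0; apply/eqP.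
  apply: (@flat_zero _ (fun t => F1 (t, z) - F2 (t, z)) c1 s) => // [y /sr|k].
    exact: Hr.
  by exists 1; exists u => // y /Hu -> //; rewrite subrr cabs0 mulr_ge0 // exprn_ge0 // cabs_ge0.
exists (r / 4) => [|c' c'r]; first by rewrite divr_gt0.
split=> [g'|g].
  (* The ball of radius 3 r / 4 about c' stays in the ball of radius r about [c], and t is within r
     / 8 + r / 4 = 3 r / 8 of c', half of that radius. *)
  apply/nbhs_cabsP; exists (r / 8) => [|t tr z]; first by rewrite divr_gt0.
  apply: (zero c' (3 / 4 * r)) => //; first by rewrite mulr_gt0.
    by move=> y yc; have := cabsD3 y c' c; move: yc c'r; clear; lra.
  by have := cabsD3 t c c'; rewrite (cabsB c c'); move: tr c'r; clear; lra.
apply/nbhs_cabsP; exists (r / 4) => [|t tr z]; first by rewrite divr_gt0.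
apply: (zero c r) => //.
by have := cabsD3 t c' c; move: tr c'r; clear; lra.
Qed.

Lemma germ_eq_sym n (F1 F2 : R[i] * 'rV[R[i]]_n -> R[i]) c :
  germ_eq c F1 F2 -> germ_eq c F2 F1.
Proof. by apply: filterS => t H z; rewrite H. Qed.

Lemma germ_eq_trans n (F1 F2 F3 : R[i] * 'rV[R[i]]_n -> R[i]) c :
  germ_eq c F1 F2 -> germ_eq c F2 F3 -> germ_eq c F1 F3.
Proof. by apply: filterS2 => t H1 H2 z; rewrite H1. Qed.

Lemma within_seg (x : R) (A : set R) :
  (\forall y \near within `[0, 1]%classic (nbhs x), A y) <->
  exists2 d : R, 0 < d & forall y, 0 <= y <= 1 -> `|y - x| < d -> A y.
Proof.
rewrite near_withinE; split=> [/nbhs_ballP [d d0 H]|[d d0 H]].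
  exists d => // y y01 yx; apply: H; first by rewrite /ball /= distrC.
  by rewrite /= in_itv.
apply/nbhs_ballP; exists d => // y; rewrite /ball /= distrC => yx.
by rewrite in_itv /= => y01; exact: H.
Qed.

(** By the identity theorem, agreement of the two germs is locally constant in the parameter, hence
    constant on [0, 1]. The property of segments used in the induction is that agreement at one
    parameter implies agreement at every other. *)
Lemma continuation_unique n (p : R -> R[i]) F G H : segcont p 0 1 ->
  @analytic_continuation R (n + n) p F G -> analytic_continuation p F H ->
  germ_eq (p 1) (G 1) (H 1).
Proof.
move=> pc [g0 Gc] [h0 Hc].
pose T s := germ_eq (p s) (G s) (H s).
have T0 : T 0 by apply: germ_eq_trans g0 _; exact: germ_eq_sym.
suff S : forall x y, 0 <= x <= 1 -> 0 <= y <= 1 -> T x -> T y.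
  by apply: S T0; rewrite ?ler01 lexx.
apply: (@segment_induction R (fun a b => forall x y, a <= x <= b -> a <= y <= b -> T x -> T y)).
- move=> a c b a0 /andP[ac cb] b1 P1 P2 x y /andP[ax xb] /andP[ay yb] Tx.
  have Tc : T c.
    have [xc|cx] := leP x c.
      by apply: P1 Tx; rewrite ?ax ?xc ?ac ?lexx.
    by apply: P2 Tx; rewrite ?cb ?lexx ?xb ?ltW.
  have [yc|cy] := leP y c.
    by apply: P1 Tc; rewrite ?ay ?yc ?ac ?lexx.
  by apply: P2 Tc; rewrite ?cb ?lexx ?yb ?ltW.
- move=> x x01.
  have xin : x \in `[0, 1] by rewrite in_itv.
  have [Gh /within_seg [d1 d10 H1]] := Gc x xin.
  have [Hh /within_seg [d2 d20 H2]] := Hc x xin.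
  have [r r0 Hr] := holo_germ_identity Gh Hh.
  have [d3 d30 H3] := pc x x01 r r0.
  pose d := Num.min d1 (Num.min d2 d3).
  have key y : 0 <= y <= 1 -> `|y - x| < d -> (T y <-> T x).
    move=> y01; rewrite !lt_min => /and3P[/(H1 _ y01) E1 /(H2 _ y01) E2 /(H3 _ y01) E3].
    rewrite /T -(Hr _ E3); split=> E.
      by apply: germ_eq_trans (germ_eq_sym E1) _; apply: germ_eq_trans E E2.
    by apply: germ_eq_trans E1 _; apply: germ_eq_trans E _; exact: germ_eq_sym.
  exists d => [|a b /andP[a0 ab] b1 ax bx]; first by rewrite !lt_min d10 d20.
  have near y : a <= y <= b -> 0 <= y <= 1 /\ `|y - x| < d.
    move=> /andP[ay yb]; split; first by apply/andP; split; lra.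
    by move: ax bx ay yb; rewrite !ltr_norml => /andP[? ?] /andP[? ?] ? ?; apply/andP; split; lra.
  move=> u v /near [u01 ux] /near [v01 vx] Tu.
  exact: (proj2 (key v v01 vx) (proj1 (key u u01 ux) Tu)).
Qed.

(** Both numbers lie in the sector |arg| < pi / 4, so the argument of the quotient is below pi / 2
    in absolute value. *)
Lemma Re_div_gt0 (r r' : R[i]) : `|complex.Im r| < complex.Re r ->
  `|complex.Im r'| < complex.Re r' -> 0 < complex.Re (r' / r).
Proof.
case: r r' => [x y] [x' y'] /= H H'.
have x0 : 0 < x by exact: le_lt_trans H.
have x'0 : 0 < x' by exact: le_lt_trans H'.
have D : 0 < x ^+ 2 + y ^+ 2 by rewrite ltr_pwDl ?sqr_ge0 // exprn_gt0.
have -> : x' * (x / (x ^+ 2 + y ^+ 2)) - y' * - (y / (x ^+ 2 + y ^+ 2)) =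
  (x' * x + y' * y) / (x ^+ 2 + y ^+ 2) by field; rewrite gt_eqF.
rewrite divr_gt0 //.
have : `|y' * y| < x' * x by rewrite normrM ltr_pM.
by rewrite ltr_norml => /andP[+ _]; clear; lra.
Qed.

(** * Continuing the explicit solution along a path *)

Section Solution.
Variables (hbar : R) (m : nat) (a : 'rV[R[i]]_m) (alpha beta gamma : R[i]).
Hypotheses (hbar_gt0 : 0 < hbar) (a_unit : pairing a a = 1)
  (disc : gamma ^+ 2 - alpha * beta = 1).
Local Notation B := (Bform hbar a alpha beta gamma).
Local Notation Delta := (Delta hbar gamma).
Local Notation branch := (branch hbar gamma).
Local Notation branch_dom := (branch_dom hbar gamma).
Local Notation sol := (sol hbar a alpha beta gamma).

(** The two values have the same square 1 / Delta. Opposite signs would make psi / psi' = -(r' / r)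
    for the principal roots r and r', whose quotient has positive real part. *)
Lemma branch_eq psi psi' t : 0 < complex.Re (psi / psi') ->
  branch_dom psi t -> branch_dom psi' t -> branch psi t = branch psi' t.
Proof.
move=> P d d'; have [_ p0] := branch_dom_neq0 d; have [_ p'0] := branch_dom_neq0 d'.
have /eqP := branch_sqr d; rewrite -(branch_sqr d') eqf_sqr => /orP[/eqP //|/eqP].
have := sqrtc_Re_gt0 d; have := sqrtc_Re_gt0 d'; rewrite /branch.
set r := sqrtc (Delta t * psi ^+ 2)^-1; set r' := sqrtc (Delta t * psi' ^+ 2)^-1.
move=> Hr' Hr E.
have r0 : r != 0.
  by apply: contraTneq Hr => ->; rewrite /= normr0 ltxx.
have F : psi / psi' = - (r' / r).
  have -> : psi = - (psi' * r') / r by rewrite -E mulfK.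
  by field; rewrite p'0 r0.
exfalso; have := Re_div_gt0 Hr Hr'; rewrite F raddfN oppr_gt0 in P.
by rewrite ltNge ltW.
Qed.

Lemma branch_dom_near psi t : branch_dom psi t ->
  exists2 d : R, 0 < d & forall s, cabs (s - t) < d -> branch_dom psi s.
Proof.
move=> H; have [D0 p0] := branch_dom_neq0 H.
apply: (@ccont_Re_gt0 _ (fun s => (Delta s * psi ^+ 2)^-1) t) => //.
have Dp0 : Delta t * psi ^+ 2 != 0 by rewrite mulf_neq0 // expf_neq0.
have D1 := cderivM (cderiv_Delta hbar gamma t) (cderiv_cst (psi ^+ 2) t).
exact: cderiv_ccont (cderivV (f := fun s => Delta s * psi ^+ 2) Dp0 D1).
Qed.

Lemma differentiable_fst_comp (f : R[i] -> R[i]) t d (z : 'rV[R[i]]_(m + m)) :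
  cderiv f t d -> differentiable (fun p : R[i] * 'rV[R[i]]_(m + m) => f p.1) (t, z).
Proof.
move=> /cderiv_is_derive [/derivable1_diffP fd _].
apply: (@differentiable_comp _ _ _ _ (fun p : R[i] * 'rV[R[i]]_(m + m) => p.1) f) => //.
by apply: linear_differentiable => x; exact: cvg_fst.
Qed.

Lemma differentiable_snd_comp (g : 'rV[R[i]]_(m + m) -> R[i]) t z :
  differentiable g z -> differentiable (fun p : R[i] * 'rV[R[i]]_(m + m) => g p.2) (t, z).
Proof.
move=> gd.
apply: (@differentiable_comp _ _ _ _ (fun p : R[i] * 'rV[R[i]]_(m + m) => p.2) g) => //.
by apply: linear_differentiable => x; exact: cvg_snd.
Qed.

Lemma differentiable_sol psi t z : branch_dom psi t -> differentiable (sol psi) (t, z).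
Proof.
move=> H; have [D0 p0] := branch_dom_neq0 H.
have dU := differentiable_snd_comp t (differentiable_lin_u a z).
have dV := differentiable_snd_comp t (differentiable_lin_v a z).
have dB := differentiable_fst_comp z (cderiv_branch H).
have dP := differentiable_fst_comp z (cderiv_coef hbar_gt0 alpha D0).
have dQ := differentiable_fst_comp z (cderiv_coefQ hbar_gt0 D0).
have dS := differentiable_fst_comp z (cderiv_coef hbar_gt0 beta D0).
rewrite /sol /gauss.
pose u := fun p : R[i] * 'rV[R[i]]_(m + m) => lin_u a p.2.
pose v := fun p : R[i] * 'rV[R[i]]_(m + m) => lin_v a p.2.
have d2 : differentiable (fun p => u p * u p) (t, z) by apply: differentiableM.
have d3 : differentiable (fun p => u p * v p) (t, z) by apply: differentiableM.
have d4 : differentiable (fun p => v p * v p) (t, z) by apply: differentiableM.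
have dE : differentiable (fun p => coefP hbar alpha gamma p.1 * (u p * u p) +
   coefQ hbar gamma p.1 * (u p * v p) + coefS hbar beta gamma p.1 * (v p * v p)) (t, z).
  by apply: differentiableD; [apply: differentiableD|]; apply: differentiableM.
have /cderiv_is_derive [/derivable1_diffP dC _] := cderiv_cexp
  (coefP hbar alpha gamma t * (u (t, z) * u (t, z)) +
   coefQ hbar gamma t * (u (t, z) * v (t, z)) + coefS hbar beta gamma t * (v (t, z) * v (t, z))).
have dCE := @differentiable_comp _ _ _ _ _ (@cexp R) (t, z) dE dC.
have -> : (fun p : R[i] * 'rV[R[i]]_(m + m) => branch psi p.1 * cexp
    (coefP hbar alpha gamma p.1 * lin_u a p.2 ^+ 2 +
     coefQ hbar gamma p.1 * (lin_u a p.2 * lin_v a p.2) +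
     coefS hbar beta gamma p.1 * lin_v a p.2 ^+ 2)) =
  (fun p => branch psi p.1 * (@cexp R \o (fun p => coefP hbar alpha gamma p.1 * (u p * u p) +
   coefQ hbar gamma p.1 * (u p * v p) + coefS hbar beta gamma p.1 * (v p * v p))) p).
  by apply/funext => p.
exact: differentiableM.
Qed.

Lemma holomorphic_sol psi t : branch_dom psi t -> holomorphic_near t (sol psi).
Proof.
move=> /branch_dom_near [d d0 Hd]; apply/nbhs_cabsP; exists d => // s /Hd sd z.
exact: differentiable_sol.
Qed.

Lemma Delta0 : Delta 0 = 1.
Proof.
rewrite /Delta /tcos /tsin mulr0 ccos0 csin0; ring.
Qed.

Lemma branch_dom_point psi t : Delta t * psi ^+ 2 = 1 -> branch_dom psi t.
Proof. by rewrite /branch_dom => ->; rewrite invr1 /= ltr01. Qed.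

Lemma branch_point psi t : Delta t * psi ^+ 2 = 1 -> branch psi t = psi.
Proof. by rewrite /branch => ->; rewrite invr1 sqrtc1 mulr1. Qed.

Lemma sol_is_solution : star_exp_solution hbar B (sol 1).
Proof.
have E : Delta 0 * 1 ^+ 2 = 1 by rewrite Delta0 expr1n mulr1.
have D := branch_dom_point E.
split; first exact: holomorphic_sol.
- have [d d0 Hd] := branch_dom_near D; apply/nbhs_cabsP; exists d => // s /Hd sd z.
  have /cderiv_is_derive [_] := cderiv_sol a_unit hbar_gt0 disc z sd.
  by rewrite derive1E.
- move=> z; rewrite /sol /gauss /= branch_point // mul1r.
  rewrite /coefP /coefQ /coefS Delta0 invr1 subrr /tsin mulr0 csin0 !mulr0 !mul0r !addr0.
  exact: cexp0.
Qed.

Lemma Delta_end : Delta (pi / (2 * hbar))%:C = -1.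
Proof.
rewrite /Delta /tcos /tsin.
have -> : 2 * hbar%:C * (pi / (2 * hbar))%:C = (pi : R)%:C.
  have -> : (2 : R[i]) = (2%:R : R)%:C by rewrite rmorph_nat.
  by rewrite -!rmorphM; congr (_ %:C); field; rewrite gt_eqF.
by rewrite ccos_pi csin_pi mulr0 subr0.
Qed.

Lemma tsin_end : tsin hbar (pi / (2 * hbar))%:C = 0.
Proof.
rewrite /tsin.
have -> : 2 * hbar%:C * (pi / (2 * hbar))%:C = (pi : R)%:C.
  have -> : (2 : R[i]) = (2%:R : R)%:C by rewrite rmorph_nat.
  by rewrite -!rmorphM; congr (_ %:C); field; rewrite gt_eqF.
exact: csin_pi.
Qed.

(** At this time the sine vanishes and Delta = -1, so P = S = 0 and Q = -2 / (i hbar) = 2 i / hbar,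
    whatever alpha, beta and gamma; the prefactor is the selected root. *)
Lemma sol_end psi z : psi ^+ 2 = -1 -> sol psi ((pi / (2 * hbar))%:C, z) =
  psi * cexp (2 * 'i / hbar%:C * (lin_u a z * lin_v a z)).
Proof.
move=> p2; rewrite /sol /gauss /= branch_point; last by rewrite Delta_end p2 mulrNN mulr1.
congr (_ * cexp _).
rewrite /coefP /coefQ /coefS tsin_end Delta_end !mulr0 !mul0r add0r addr0.
congr (_ * _); rewrite invrN1 invfM iC_inv.
by field; rewrite hbarC_neq0.
Qed.

(** The germ at p s is the branch that takes the value psi s there. For nearby s' the quotient psi
    s' / psi s stays in the right half-plane, so [branch_eq] identifies the two germs near p s'. *)
Lemma continuation_sol F (p : R -> R[i]) psi : star_exp_solution hbar B F ->
  segcont p 0 1 -> p 0 = 0 -> segcont psi 0 1 -> psi 0 = 1 ->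
  (forall s, 0 <= s <= 1 -> Delta (p s) * psi s ^+ 2 = 1) ->
  analytic_continuation p F (fun s => sol (psi s)).
Proof.
move=> Fs pc p0 psic psi0 Hpsi; split.
  rewrite p0 psi0; apply: (star_exp_unique a_unit sol_is_solution Fs).
move=> s; rewrite in_itv /= => s01.
have Ds := branch_dom_point (Hpsi s s01); split; first exact: holomorphic_sol.
have [_ ps0] := branch_dom_neq0 Ds.
have [d1 d10 H1] := branch_dom_near Ds.
have [d2 d20 H2] := pc s s01 d1 d10.
have [d3 d30 H3] : exists2 d : R, 0 < d & forall y, 0 <= y <= 1 -> `|y - s| < d ->
    0 < complex.Re (psi y / psi s).
  apply: (segcont_Re_gt0 (f := fun y => psi y / psi s)) => //.
    by apply: segcontM => //; exact: segcont_cst.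
  by rewrite divff //= ltr01.
apply/within_seg; exists (Num.min d2 d3); first by rewrite lt_min d20.
move=> s' s'01; rewrite lt_min => /andP[/(H2 _ s'01) /H1 E1 /(H3 _ s'01) E3].
have E2 := branch_dom_point (Hpsi s' s'01).
have [r1 r10 R1] := branch_dom_near E1; have [r2 r20 R2] := branch_dom_near E2.
apply/nbhs_cabsP; exists (Num.min r1 r2); first by rewrite lt_min r10.
move=> t; rewrite lt_min => /andP[/R1 t1 /R2 t2] z.
by rewrite /sol /= (branch_eq E3 t2 t1).
Qed.

End Solution.
End Continuation.

(** The sign [c] is the end value of the lifted root of 1 / Delta: the path settles it before any
    continuation [G] or any z is given. *)
Theorem theorem4p1 (R : realType) (hbar : R) (m : nat) (a : 'rV[R[i]]_m)
    (alpha beta gamma : R[i])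
    (hbar_gt0 : 0 < hbar) (m_ge1 : (1 <= m)%N)
    (a_unit : pairing a a = 1) (disc : gamma ^+ 2 - alpha * beta = 1) :
  let B := Bform hbar a alpha beta gamma in
  (exists F, star_exp_solution hbar B F) /\
  (forall F1 F2, star_exp_solution hbar B F1 -> star_exp_solution hbar B F2 ->
     germ_eq 0 F1 F2) /\
  (forall F, star_exp_solution hbar B F ->
   forall p : R -> R[i],
     {within `[0, 1], continuous p} ->
     p 0 = 0 -> p 1 = (pi / (2 * hbar))%:C ->
     (forall s : R, s \in `[0, 1] ->
        ccos (2 * hbar%:C * p s) - 'i * gamma * csin (2 * hbar%:C * p s) != 0) ->
     exists c : R[i],
       [/\ c = 'i \/ c = - 'i,
           exists G, analytic_continuation p F G &
           forall G, analytic_continuation p F G ->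
             forall z : 'rV[R[i]]_(m + m),
               G 1 (p 1, z)
               = c * cexp (2 * 'i / hbar%:C * (lin_u a z * lin_v a z))]).
Proof.
move=> B; split; first by exists (sol hbar a alpha beta gamma 1); exact: sol_is_solution.
split; first by move=> F1 F2; exact: star_exp_unique.
move=> F Fs p /segcontP pc p0 p1 pD.
pose D s := Delta hbar gamma (p s).
have D0 s : 0 <= s <= 1 -> D s != 0 by move=> s01; apply: pD; rewrite in_itv.
have Dc : segcont D 0 1.
  apply: (segcont_comp (f := p) (g := Delta hbar gamma)) => // s _.
  exact: cderiv_ccont (cderiv_Delta _ _ _).
have [psi [psic psi0 psiD]] := sqrt_lift Dc D0.
have Hpsi s : 0 <= s <= 1 -> Delta hbar gamma (p s) * psi s ^+ 2 = 1.
  by move=> s01; rewrite [LHS]psiD // /D p0 Delta0.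
have G0 := continuation_sol hbar_gt0 a_unit disc Fs pc p0 psic psi0 Hpsi.
have in1 : 0 <= (1 : R) <= 1 by rewrite ler01 lexx.
have psi1 : psi 1 ^+ 2 = -1.
  by have := Hpsi 1 in1; rewrite p1 Delta_end // mulN1r => /eqP; rewrite eqr_oppLR => /eqP.
exists (psi 1); split.
- have : psi 1 ^+ 2 == 'i ^+ 2 by rewrite psi1 sqr_iC.
  by rewrite eqf_sqr => /orP[] /eqP ->; [left|right].
- by eexists; exact: G0.
(* An arbitrary continuation has the germ of the explicit one at p 1, in particular the same values
   there. *)
- move=> G GF z; rewrite -(sol_end a alpha beta gamma hbar_gt0 z psi1) -p1.
  have /nbhs_singleton := continuation_unique pc GF G0; exact.
Qed.
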